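(* Let $M$ be a level $R$-module of codimension three with maximal shifts given by $\overline d=(0,\overline d_1,\overline d_2,\overline d_3)$. Then $$e(M)\le\beta_0(M)\frac{\overline d_1\,\overline d_2\,\overline d_3}{3!}.$$
   Context: $k$ is a field, $R=k[x_1,\dots,x_n]$ is standard graded, and all $R$-modules are finitely generated and graded. $\beta_{i,j}(M)=\dim_k\operatorname{Tor}^R_i(M,k)_j$ and $\beta_0(M)=\sum_j\beta_{0,j}(M)$. For a Cohen-Macaulay module $M$ of codimension $p=\dim R-\dim M$, $h_M(t)=\big(\sum_{i,j}(-1)^i\beta_{i,j}(M)t^j\big)/(1-t)^p$ and the multiplicity is $e(M)=h_M(1)$. The maximal shifts are $\overline d_i=\max\{j:\beta_{i,j}(M)\ne0\}$, $0\le i\le p$, and the minimal shifts are $\underline d_i=\min\{j:\beta_{i,j}(M)\ne0\}$. $M$ of codimension $p$ is level if it is Cohen-Macaulay, $\underline d_0=\overline d_0$ and $\underline d_p=\overline d_p$. *)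

(* Defs.v *)
From HB Require Import structures.
From mathcomp Require Import all_boot all_order all_algebra.
From mathcomp Require Import mpoly.

Set Implicit Arguments.
Unset Strict Implicit.
Unset Printing Implicit Defensive.

Import Order.TTheory GRing.Theory Num.Theory.
Local Open Scope ring_scope.

(* Finitely generated Z-graded modules over the standard graded k[x_1,..,x_n].
   gm_decomp and gm_direct say that the module is the internal direct sum
   of its graded pieces. *)
Record gradedModule (k : fieldType) (n : nat) := GradedModule {
  gm_sort :> lmodType {mpoly k[n]};
  gm_piece : int -> {pred gm_sort};
  gm_piece_zmod : forall j, zmod_closed (gm_piece j);
  gm_piece_scale : forall (d : nat) (j : int) (f : {mpoly k[n]}) (x : gm_sort),
    f \is d.-homog -> x \in gm_piece j -> f *: x \in gm_piece (d%:Z + j);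
  gm_decomp : forall x : gm_sort, exists (J : seq int) (y : int -> gm_sort),
    (forall j, y j \in gm_piece j) /\ x = \sum_(j <- J) y j;
  gm_direct : forall (J : seq int) (y : int -> gm_sort), uniq J ->
    (forall j, y j \in gm_piece j) -> \sum_(j <- J) y j = 0 ->
    forall j, j \in J -> y j = 0;
  gm_fingen : exists g : seq gm_sort, forall x : gm_sort,
    exists c : 'I_(size g) -> {mpoly k[n]}, x = \sum_(i < size g) c i *: g`_i
}.

Section Dimension.
Variables (k : fieldType) (n : nat).
Local Notation R := {mpoly k[n]}.

Definition is_prime_ideal (P : {pred R}) : Prop :=
  idealr_closed P /\ prime_idealr_closed P.

Definition contains_ann (M : lmodType R) (P : {pred R}) : Prop :=
  forall f : R, (forall x : M, f *: x = 0) -> f \in P.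

(* P 0, ..., P d is a strictly increasing chain of primes containing Ann M. *)
Definition prime_chain (M : lmodType R) (d : nat) (P : nat -> {pred R}) : Prop :=
  (forall i, (i <= d)%N -> is_prime_ideal (P i) /\ contains_ann M (P i)) /\
  (forall i, (i < d)%N ->
     {subset P i <= P i.+1} /\ exists2 f, f \in P i.+1 & f \notin P i).

(* d = dim M, the Krull dimension of R / Ann M; no d qualifies if M = 0. *)
Definition is_krull_dim (M : lmodType R) (d : nat) : Prop :=
  (exists P, prime_chain M d P) /\
  (forall d' P, prime_chain M d' P -> (d' <= d)%N).

Definition is_codim (M : lmodType R) (p : nat) : Prop :=
  exists dR dM, [/\ is_krull_dim (R^o : lmodType R) dR, is_krull_dim M dM
                  & (dR = dM + p)%N].

(* x belongs to the submodule (s_1, ..., s_r) M. *)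
Definition in_ideal_mul (M : lmodType R) (s : seq R) (x : M) : Prop :=
  exists c : 'I_(size s) -> M, x = \sum_(i < size s) s`_i *: c i.

Definition regular_sequence (M : lmodType R) (s : seq R) : Prop :=
  (forall i, (i < size s)%N -> forall x : M,
     in_ideal_mul (take i s) (s`_i *: x) -> in_ideal_mul (take i s) x) /\
  (exists x : M, ~ in_ideal_mul s x).

Definition in_irrelevant (f : R) : bool := f@_(0%MM) == 0.

(* r = depth M, with respect to the ideal (x_1, ..., x_n). *)
Definition is_depth (M : lmodType R) (r : nat) : Prop :=
  (exists s : seq R,
     [/\ all in_irrelevant s, regular_sequence M s & size s = r]) /\
  (forall s : seq R,
     all in_irrelevant s -> regular_sequence M s -> (size s <= r)%N).

Definition cohen_macaulay (M : lmodType R) : Prop :=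
  exists d, is_depth M d /\ is_krull_dim M d.

End Dimension.

(* f is homogeneous of degree z : int (so f = 0 when z < 0). *)
Definition homog_int (k : fieldType) (n : nat) (z : int) (f : {mpoly k[n]}) :
    Prop :=
  match z with
  | Posz d => f \is d.-homog
  | Negz _ => f = 0
  end.

(* A graded free resolution  ... -> F_1 -> F_0 -> M -> 0  by finitely generated
   graded free modules, not necessarily minimal.  F_i has a basis indexed by
   'I_(fr_rank i), its a-th element having degree fr_deg a; elements of F_i are
   row vectors, and F_(i+1) -> F_i is right multiplication by fr_diff i. *)
Record freeResolution (k : fieldType) (n : nat) (M : gradedModule k n) :=
  FreeResolution {
  fr_rank : nat -> nat;
  fr_deg : forall i, 'I_(fr_rank i) -> int;
  fr_diff : forall i, 'M[{mpoly k[n]}]_(fr_rank i.+1, fr_rank i);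
  fr_aug : 'I_(fr_rank 0) -> M;
  fr_diff_homog : forall i a b,
    homog_int (fr_deg (i := i.+1) a - fr_deg (i := i) b) (fr_diff i a b);
  fr_aug_homog : forall a, fr_aug a \in @gm_piece k n M (fr_deg (i := 0%N) a);
  fr_aug_surj : forall x : M,
    exists v : 'rV_(fr_rank 0), x = \sum_a v 0 a *: fr_aug a;
  fr_exact0 : forall v : 'rV_(fr_rank 0),
    \sum_a v 0 a *: fr_aug a = 0 <-> exists w, v = w *m fr_diff 0;
  fr_exactS : forall i (v : 'rV_(fr_rank i.+1)),
    v *m fr_diff i = 0 <-> exists w, v = w *m fr_diff i.+1
}.

Section Betti.
Variables (k : fieldType) (n : nat) (M : gradedModule k n).
Variable F : freeResolution M.

(* The differential of F (x) k, where k = R / (x_1, ..., x_n): tensoring with k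
   replaces each entry by its constant term. *)
Definition tor_diff (i : nat) : 'M[k]_(fr_rank F i.+1, fr_rank F i) :=
  map_mx (mcoeff 0%MM) (fr_diff F i).

(* Its row space is the degree j component of F_i (x) k. *)
Definition tor_piece (i : nat) (j : int) : 'M[k]_(fr_rank F i) :=
  diag_mx (\row_a (fr_deg (f := F) a == j)%:R).

Definition tor_cycles (i : nat) (j : int) : 'M[k]_(fr_rank F i) :=
  match i with
  | 0 => tor_piece 0 j
  | i'.+1 => (tor_piece i'.+1 j :&: kermx (tor_diff i'))%MS
  end.

Definition tor_boundaries (i : nat) (j : int) :
    'M[k]_(fr_rank F i.+1, fr_rank F i) :=
  tor_piece i.+1 j *m tor_diff i.

(* beta_{i,j}(M) = dim_k Tor_i(M, k)_j = dim_k H_i(F (x) k)_j. *)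
Definition betti (i : nat) (j : int) : nat :=
  (\rank (tor_cycles i j) - \rank (tor_boundaries i j))%N.

(* beta_{i,j} vanishes unless j is one of these degrees. *)
Definition degrees (i : nat) : seq int :=
  undup (codom (@fr_deg _ _ _ F i)).

Definition betti_total (i : nat) : nat :=
  (\sum_(j <- degrees i) betti i j)%N.

Definition is_max_shift (i : nat) (d : int) : Prop :=
  betti i d != 0%N /\ forall j, betti i j != 0%N -> j <= d.

Definition is_min_shift (i : nat) (d : int) : Prop :=
  betti i d != 0%N /\ forall j, betti i j != 0%N -> d <= j.

(* A bound on the absolute values of all degrees occurring in F_0, ..., F_n. *)
Definition degree_bound : nat :=
  \max_(i < n.+1) \max_(a < fr_rank F i) `|fr_deg a|%N.

(* t^N * sum_{i,j} (-1)^i beta_{i,j} t^j  with N = degree_bound, the factor t^N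
   clearing negative exponents; beta_{i,j} = 0 for i > n. *)
Definition betti_numerator : {poly rat} :=
  \sum_(i < n.+1) \sum_(j <- degrees i)
     ((-1) ^+ i * (betti i j)%:R) *: 'X^(absz (j + degree_bound%:Z)).

(* e(M) = h_M(1) for M Cohen-Macaulay of codimension p; the quotient is
   t^N h_M(t), which takes the same value at 1. *)
Definition multiplicity (p : nat) : rat :=
  (betti_numerator %/ (1 - 'X) ^+ p).[1].

Definition is_level (p : nat) : Prop :=
  [/\ cohen_macaulay M, is_codim M p,
      exists d, is_min_shift 0 d /\ is_max_shift 0 d
    & exists d, is_min_shift p d /\ is_max_shift p d].

End Betti.

(* Main.v *)
(* Put F = D / (1 - t)^3, D the alternating sum of the t^(shifts) of the minimal
   resolution G.  The Auslander-Buchsbaum vanishing (an iterated mapping cone on a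
   maximal regular sequence) gives G length three, so that with b_i(l) the number of
   basis elements of degree l in G_i and d = d_3
     6 e(M) = b_0 d_1 d_2 d + sum_(0 < l < d) (d_1 - l)(d_2 - l)(d - l)(b_2(l) - b_1(l)).
   The last sum is shown to be nonpositive by Abel summation from the inequalities
     sum_(l <= j) l (d - l) b_2(l) <= sum_(l < j) l (d - l) b_1(l),   0 < j < d.
   These are obtained as in Boij-Soderberg theory, by pairing G with a supernatural
   bundle.  A generic linear section over C[t] in place of C reduces to three
   variables: the substitution theta : x_i -> X_i + t X_(i-1) is R[t] / (f) for a
   linear form f with the powers of t as coefficients, so exactness is preserved by
   McCoy's theorem as long as there is no socle.  Iterated once more, theta restricts
   G to the family of binary forms, and l (d - l) is the rank of a first cohomology
   group there, which has an explicit monomial basis; the differential G_2 -> G_1 is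
   injective on it, and minimality makes its components with l' >= l vanish.
   The divisibility of D by (1 - t)^3 comes from dim M = n - 3: a prime chain argument
   shows that M / (s) M is annihilated by powers of the variables, up to factors
   outside the irrelevant ideal, which bounds the Hilbert function of M. *)
Require Import Defs.
From HB Require Import structures.
From mathcomp Require Import all_boot all_order all_algebra.
From mathcomp Require Import mpoly ssrAC.
From mathcomp Require Import ring zify lra.
From mathcomp Require boolp classical_sets.

Set Implicit Arguments.
Unset Strict Implicit.
Unset Printing Implicit Defensive.

Import Order.TTheory GRing.Theory Num.Theory.
Local Open Scope ring_scope.

(** * Linear algebra over an integral domain *)

(** The section is generic over [C[t]] rather than over an enlarged field, so finite [k] is covered;
    the price is that everything runs over an integral domain, where ranks see a cokernel only up to
    torsion. Both ends of levelness enter. As [G_3] sits in the single degree [d], the socle over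
    three variables is confined to degree [d - 3]; this bounds the degree of the [h]-polynomial and
    keeps the binary family exact in degree [d - 1]. As [G_0] sits in degree 0, the entries of
    [G_1 -> G_0] have [t]-degree at most the degree of their source, so the two halves of a cocycle
    cannot cancel. The constant 6 is, up to sign, the third difference of the cubic
    [(d_1 - l)(d_2 - l)(d - l)]; the quadratic [l (d - l)] has third difference 0, so its total
    against [b_2 - b_1] is 0. The quotient of the two, [(d_1 - l)(d_2 - l) / l], decreases up to its
    smaller root, which is what Abel summation needs. Regular sequences need not be homogeneous, so
    [M / (s) M] carries no grading; the growth estimate uses degrees at most [N] and powers of the
    irrelevant ideal instead. *)

Section Fraction.
Local Open Scope quotient_scope.
Variable C : idomainType.
Local Notation F := {fraction C}.
Local Notation tofrac := (@FracField.tofrac C).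
Local Notation "x %:F" := (tofrac x).

Lemma fraction_numden (x : F) : exists a b, b != 0 /\ b%:F * x = a%:F.
Proof.
elim/quotW: x => r; exists (\n_r), (\d_r); split; first exact: denom_ratioP.
rewrite mulrC; unlock FracField.tofrac; rewrite -[LHS]FracField.pi_mul.
apply/eqmodP; rewrite /= FracField.equivfE /FracField.mulf !numden_Ratio ?oner_eq0 //.
- by rewrite !mulr1 mulrC.
- by rewrite mulf_neq0 ?oner_eq0 ?denom_ratioP.
- by rewrite mulr1 denom_ratioP.
Qed.

Definition fmx p q (A : 'M[C]_(p, q)) : 'M[F]_(p, q) := map_mx tofrac A.

Lemma fmx_inj p q (A B : 'M[C]_(p, q)) : fmx A = fmx B -> A = B.
Proof.
by move=> /matrixP AB; apply/matrixP => i j; have /eqP := AB i j; rewrite !mxE tofrac_eq => /eqP.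
Qed.

Lemma fmxM p q r (A : 'M[C]_(p, q)) (B : 'M_(q, r)) : fmx (A *m B) = fmx A *m fmx B.
Proof. exact: map_mxM. Qed.

Lemma clear_denominators p q (U : 'M[F]_(p, q)) :
  exists d (A : 'M[C]_(p, q)), d != 0 /\ d%:F *: U = fmx A.
Proof.
have /fin_all_exists[b bP] (x : 'I_p * 'I_q) : exists d, d != 0 /\ exists a, d%:F * U x.1 x.2 = a%:F.
  by have [a [d [d0 E]]] := fraction_numden (U x.1 x.2); exists d; split=> //; exists a.
pose d := \prod_x b x.
have d0 : d != 0 by rewrite prodf_seq_neq0; apply/allP => x _; case: (bP x).
have /fin_all_exists[a aP] (x : 'I_p * 'I_q) : exists a, d%:F * U x.1 x.2 = a%:F.
  have [_ [a aP]] := bP x; exists (\prod_(y | y != x) b y * a).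
  by rewrite /d (bigD1 x) //= [b x * _]mulrC !rmorphM /= -mulrA aP.
exists d, (\matrix_(i, j) a (i, j)); split=> //.
by apply/matrixP => i j; rewrite !mxE (aP (i, j)).
Qed.

Lemma idomain_kernel p q (A : 'M[C]_(p, q)) : (q < p)%N ->
  exists2 y : 'rV[C]_p, y != 0 & y *m A = 0.
Proof.
move=> qp; have : kermx (fmx A) != 0.
  by rewrite -mxrank_eq0 mxrank_ker; have := rank_leq_col (fmx A); lia.
case/rowV0Pn => u /sub_kermxP uA u0.
have [d [y [d0 yP]]] := clear_denominators u; exists y.
  apply: contraNneq u0 => y0; have : d%:F *: u = 0 by rewrite yP y0 /fmx map_mx0.
  by move/eqP; rewrite scaler_eq0 tofrac_eq0 (negPf d0).
by apply: fmx_inj; rewrite fmxM -yP -scalemxAl uA scaler0 /fmx map_mx0.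
Qed.

(** Exactness over [C] survives in the fraction field, since a kernel vector becomes integral after
    scaling; rank-nullity then applies. *)
Lemma rank_exact p q r (A : 'M[C]_(q, r)) (B : 'M_(p, q)) : B *m A = 0 ->
  (forall v : 'rV_q, v *m A = 0 -> exists w, v = w *m B) ->
  (\rank (fmx A) + \rank (fmx B) = q)%N.
Proof.
move=> BA ex; have BF : (fmx B <= kermx (fmx A))%MS.
  by apply/sub_kermxP; rewrite -fmxM BA /fmx map_mx0.
have FB : (kermx (fmx A) <= fmx B)%MS.
  apply/rV_subP => u /sub_kermxP uA.
  have [d [v [d0 vP]]] := clear_denominators u.
  have [w wP] : exists w, v = w *m B.
    by apply: ex; apply: fmx_inj; rewrite fmxM -vP -scalemxAl uA scaler0 /fmx map_mx0.
  apply/submxP; exists (d%:F^-1 *: fmx w); rewrite -scalemxAl -fmxM -wP -vP scalerA.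
  by rewrite mulVf ?scale1r // tofrac_eq0.
have : \rank (fmx B) = \rank (kermx (fmx A)).
  by apply/eqP; rewrite eqn_leq !mxrankS.
by rewrite mxrank_ker => ->; rewrite subnKC // rank_leq_row.
Qed.

(** Translates a numerical equality of ranks into a statement about elements over [C], where
    multiplication by variables can be used. *)
Lemma rank_full_torsion p q (A : 'M[C]_(p, q)) :
  (\rank (fmx A) = q)%N <->
  (forall v : 'rV_q, exists2 c, c != 0 & exists w, c *: v = w *m A).
Proof.
split=> [rA v|tor].
  have /submxP[W WP] : (fmx v <= fmx A)%MS by apply: submx_full; rewrite /row_full rA.
  have [d [w [d0 wP]]] := clear_denominators W; exists d => //; exists w.
  by apply: fmx_inj; rewrite fmxM -wP -scalemxAl -WP /fmx map_mxZ.
apply/eqP; rewrite -[_ == _]/(row_full _) -sub1mx; apply/row_subP => i.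
have [c c0 [w wP]] := tor (delta_mx 0 i); apply/submxP; exists (c%:F^-1 *: fmx w).
rewrite -scalemxAl -fmxM -wP /fmx map_mxZ scalerA mulVf ?tofrac_eq0 // scale1r.
by rewrite map_delta_mx rowE mulmx1.
Qed.

End Fraction.

(** * Acyclic complexes modulo variables *)

Section Kill.
Variables (C : idomainType) (n : nat).
Local Notation R := {mpoly C[n]}.

Definition kill (v : nat) : R -> R :=
  mmap (@mpolyC n C) (fun i : 'I_n => if (i < v)%N then 0 else 'X_i).
HB.instance Definition _ v := GRing.RMorphism.on (kill v).

Lemma mpoly_gen_ind (Q : R -> Prop) :
  (forall c, Q c%:MP) -> (forall i, Q 'X_i) ->
  (forall f g, Q f -> Q g -> Q (f + g)) ->
  (forall f g, Q f -> Q g -> Q (f * g)) -> forall f, Q f.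
Proof.
move=> QC QX QD QM f; rewrite (mpolyE f).
have Q0 : Q 0 by rewrite -(mpolyC0 n C); exact: QC.
have Q1 : Q 1 by rewrite -(mpolyC1 n C); exact: QC.
apply: (big_ind Q Q0 QD) => m _; rewrite -mul_mpolyC; apply: (QM) => //.
rewrite mpolyXE_id; apply: (big_ind Q Q1 QM) => i _.
by elim: (m i) => [|d IHd]; rewrite ?expr0 // exprS; apply: (QM).
Qed.

Lemma killC v c : kill v c%:MP = c%:MP. Proof. exact: mmapC. Qed.
Lemma killX v i : kill v 'X_i = if (i < v)%N then 0 else 'X_i.
Proof. by rewrite /kill mmapX mmap1U. Qed.

Lemma kill0 f : kill 0 f = f.
Proof.
elim/mpoly_gen_ind: f => [c|i|f g|f g]; rewrite ?killC ?killX //.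
  by rewrite rmorphD /= => -> ->.
by rewrite rmorphM /= => -> ->.
Qed.

Lemma killK v f : kill v (kill v f) = kill v f.
Proof.
elim/mpoly_gen_ind: f => [c|i|f g Ef Eg|f g Ef Eg].
- by rewrite !killC.
- by rewrite !killX; case: ifP => h; rewrite ?rmorph0 // killX h.
- by rewrite !rmorphD /= Ef Eg.
by rewrite !rmorphM /= Ef Eg.
Qed.

Lemma kill_all f : kill n f = (f@_0%MM)%:MP.
Proof.
elim/mpoly_gen_ind: f => [c|i|f g Ef Eg|f g Ef Eg].
- by rewrite killC mpolyCK.
- by rewrite killX ltn_ord mcoeffX mnm1_eq0 mpolyC0.
- by rewrite rmorphD /= Ef Eg mcoeffD mpolyCD.
by rewrite rmorphM /= Ef Eg rmorphM /= mpolyCM.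
Qed.

Lemma killS (v : 'I_n) f : exists g, kill v f = kill v.+1 f + 'X_v * g.
Proof.
elim/mpoly_gen_ind: f => [c|i|f g [f' Ef] [g' Eg]|f g [f' Ef] [g' Eg]].
- by exists 0; rewrite !killC mulr0 addr0.
- rewrite !killX (ltnS i v) (leq_eqVlt i v); case: (ltngtP i v) => h /=.
  + by exists 0; rewrite mulr0 addr0.
  + by exists 0; rewrite mulr0 addr0.
  + by exists 1; rewrite mulr1 add0r (val_inj h).
- by exists (f' + g'); rewrite !rmorphD /= Ef Eg; ring.
exists (kill v.+1 f * g' + f' * kill v.+1 g + 'X_v * f' * g').
by rewrite !rmorphM /= Ef Eg; ring.
Qed.

Lemma kill_le v w f : (v <= w)%N -> kill v f = 0 -> kill w f = 0.
Proof.
move=> lvw fv; have -> : kill w f = kill w (kill v f).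
  elim/mpoly_gen_ind: f {fv} => [c|i|f g Ef Eg|f g Ef Eg].
  - by rewrite !killC.
  - rewrite !killX; case: (ltnP i v) => h; first by rewrite (leq_trans h lvw) rmorph0.
    by rewrite killX.
  - by rewrite !rmorphD /= Ef Eg.
  by rewrite !rmorphM /= Ef Eg.
by rewrite fv rmorph0.
Qed.

End Kill.

Section KillRows.
Variables (C : idomainType) (n : nat).
Local Notation R := {mpoly C[n]}.

Definition killr v p q (A : 'M[R]_(p, q)) : 'M[R]_(p, q) := map_mx (@kill C n v) A.

Lemma killrM v p q r (A : 'M[R]_(p, q)) (B : 'M_(q, r)) :
  killr v (A *m B) = killr v A *m killr v B.
Proof. exact: map_mxM. Qed.
Lemma killrD v p q (A B : 'M[R]_(p, q)) : killr v (A + B) = killr v A + killr v B.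
Proof. exact: map_mxD. Qed.
Lemma killrB v p q (A B : 'M[R]_(p, q)) : killr v (A - B) = killr v A - killr v B.
Proof. exact: map_mxB. Qed.
Lemma killrZ v c p q (A : 'M[R]_(p, q)) : killr v (c *: A) = kill v c *: killr v A.
Proof. exact: map_mxZ. Qed.
Lemma killr_eq0_M v p q r (A : 'M[R]_(p, q)) (B : 'M_(q, r)) :
  killr v A = 0 -> killr v (A *m B) = 0.
Proof. by rewrite killrM => ->; rewrite mul0mx. Qed.
Lemma killr0 p q (A : 'M[R]_(p, q)) : killr 0 A = A.
Proof. by apply/matrixP => i j; rewrite mxE kill0. Qed.

Lemma killr_le v w p q (A : 'M[R]_(p, q)) : (v <= w)%N ->
  killr v A = 0 -> killr w A = 0.
Proof.
move=> lvw /matrixP A0; apply/matrixP => i j; have := A0 i j.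
by rewrite !mxE => /(kill_le lvw).
Qed.

(** The variables form a regular sequence: [kill v] fixes ['X_v], and its values lie in a domain. *)
Lemma killr_regular (v : 'I_n) p q (A : 'M[R]_(p, q)) :
  killr v ('X_v *: A) = 0 -> killr v A = 0.
Proof.
move/matrixP => A0; apply/matrixP => i j; have := A0 i j.
rewrite !mxE rmorphM /= killX ltnn => /eqP; rewrite mulf_eq0 => /orP[|/eqP->//].
by move/eqP/(congr1 (mcoeff U_(v))); rewrite mcoeffXU eqxx mcoeff0 => /eqP; rewrite oner_eq0.
Qed.

Lemma killrS_eq0 (v : 'I_n) p q (A : 'M[R]_(p, q)) : killr v.+1 A = 0 ->
  exists B, killr v (A - 'X_v *: B) = 0.
Proof.
move=> A0; have ex i j : exists g, kill v (A i j) = 'X_v * g.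
  have [g ->] := killS v (A i j); move/matrixP/(_ i j): A0; rewrite !mxE => ->.
  by exists g; rewrite add0r.
have [B BP] : exists B : 'M_(p, q), forall i j, kill v (A i j) = 'X_v * B i j.
  have /fin_all_exists[b bP] (x : 'I_p * 'I_q) :
      exists g, kill v (A x.1 x.2) = 'X_v * g by exact: ex.
  by exists (\matrix_(i, j) b (i, j)) => i j; rewrite mxE (bP (i, j)).
exists B; apply/matrixP => i j; rewrite !mxE rmorphB rmorphM /= killX ltnn.
rewrite -[kill v (A i j)]killK BP rmorphM /= killX ltnn.
by rewrite subrr.
Qed.

End KillRows.

(** Exactness is required at positive positions only, so the family is a resolution of the cokernel
    of [df 0], possibly of infinite length. *)
Definition acyclic (R : nzRingType) (rk : nat -> nat)
    (df : forall i, 'M[R]_(rk i.+1, rk i)) : Prop :=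
  (forall i, df i.+1 *m df i = 0) /\
  (forall i (v : 'rV_(rk i.+1)), v *m df i = 0 -> exists w, v = w *m df i.+1).

Section Tower.
Variables (C : idomainType) (n : nat).
Local Notation R := {mpoly C[n]}.
Variables (rk : nat -> nat) (df : forall i, 'M[R]_(rk i.+1, rk i)).
Hypothesis acy : acyclic df.

(* F / (x_0, .., x_(v-1)) F is exact above degree v, since killing one variable costs one degree. *)
Lemma acyclic_kill v i (w : 'rV_(rk i.+1)) : (v <= n)%N -> (v <= i)%N ->
  killr v (w *m df i) = 0 -> exists u, killr v (w - u *m df i.+1) = 0.
Proof.
case: acy => dd ex; elim: v i w => [|v IHv] i w lvn lvi.
  rewrite killr0 => /ex[u ->]; exists u; by rewrite subrr /killr map_mx0.
case: i w lvi => // i w lvi wd0; pose x := Ordinal lvn.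
have [z zP] := @killrS_eq0 _ _ x _ _ _ wd0.
(* ['X_x] times [z *m df i] agrees with [w *m df i.+1 *m df i = 0], and ['X_x] is regular. So [z] is
   a cycle one position lower, and a lift [u] of it corrects [w] to the cycle [w - 'X_x *: u] modulo
   one variable fewer. *)
have zd : killr v (z *m df i) = 0.
  apply: (@killr_regular _ _ x); rewrite /= -[RHS](_ : killr v (w *m df i.+1 *m df i) = _); last first.
    by rewrite -mulmxA dd mulmx0 /killr map_mx0.
  apply/eqP; rewrite eq_sym -subr_eq0 -killrB scalemxAl -mulmxBl.
  by apply/eqP/killr_eq0_M.
have [u uP] := IHv i z (ltnW lvn) lvi zd.
have wxu : killr v ((w - 'X_x *: u) *m df i.+1) = 0.
  rewrite mulmxBl -scalemxAl.
  have -> : w *m df i.+1 - 'X_x *: (u *m df i.+1) =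
     (w *m df i.+1 - 'X_x *: z) + 'X_x *: (z - u *m df i.+1).
    by rewrite scalerBr addrA subrK.
  by rewrite killrD zP killrZ uP scaler0 addr0.
have [t tP] := IHv i.+1 (w - 'X_x *: u) (ltnW lvn) (leqW lvi) wxu.
exists t; have -> : w - t *m df i.+2 = (w - 'X_x *: u - t *m df i.+2) + 'X_x *: u.
  by rewrite addrAC subrK.
by rewrite killrD (killr_le (leqnSn v) tP) add0r killrZ killX /= ltnSn scale0r.
Qed.

End Tower.

(** * Homogeneous rows and the socle *)

Section Part.
Variables (C : idomainType) (n : nat).
Local Notation R := {mpoly C[n]}.
Implicit Types (p : pred nat) (f g : R).

(* l is the degree of the basis element of which f is the coordinate. *)
Definition part p (l : nat) f : R :=
  \sum_(m <- msupp f | p (mdeg m + l)%N) f@_m *: 'X_[m].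

Lemma mcoeff_part p l f m :
  (part p l f)@_m = if p (mdeg m + l)%N then f@_m else 0.
Proof.
rewrite /part raddf_sum /=; under eq_bigr => k _ do rewrite mcoeffZ mcoeffX.
have [mf|/memN_msupp_eq0 fm] := boolP (m \in msupp f); last first.
  rewrite fm if_same big1_seq // => k /andP[_ kf].
  case: eqVneq => [km|]; last by rewrite mulr0.
  by rewrite km fm mul0r.
case: ifP => pm.
  rewrite (big_rem m) //= pm eqxx mulr1 big1_seq ?addr0 // => k /andP[_].
  rewrite mem_rem_uniq ?msupp_uniq // inE => /andP[/negPf -> _].
  by rewrite mulr0.
rewrite big1 // => k pk; case: eqVneq => [km|]; last by rewrite mulr0.
by move: pk; rewrite km pm.
Qed.

(** The degree condition on a matrix entry from a basis element of degree [l] to one of degree [l'].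
    Written additively it avoids truncated subtraction and forces the entry to be 0 when
    [l < l']. *)
Definition homog_rel (l l' : nat) f :=
  forall m, f@_m != 0 -> (mdeg m + l')%N = l.

Lemma part0 p l : part p l 0 = 0.
Proof. by apply/mpolyP => m; rewrite mcoeff_part mcoeff0 if_same. Qed.

Lemma part_id p l f : (forall m, f@_m != 0 -> p (mdeg m + l)%N) -> part p l f = f.
Proof.
move=> fp; apply/mpolyP => m; rewrite mcoeff_part.
by have [->|/fp ->] := eqVneq f@_m 0; rewrite ?if_same.
Qed.

Lemma partD p l : {morph part p l : f g / f + g}.
Proof.
move=> f g; apply/mpolyP => m; rewrite !(mcoeff_part, mcoeffD).
by case: ifP => _; rewrite ?addr0.
Qed.

Lemma partM p l l' f g : homog_rel l l' g ->
  part p l' (f * g) = part p l f * g.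
Proof.
move=> hg; apply/mpolyP => m; rewrite mcoeff_part !mcoeffM.
have -> : (if p (mdeg m + l')%N then
    \sum_(k : 'X_{1..n < (mdeg m).+1, (mdeg m).+1} | m == (k.1 + k.2)%MM) f@_k.1 * g@_k.2
    else 0) =
  \sum_(k : 'X_{1..n < (mdeg m).+1, (mdeg m).+1} | m == (k.1 + k.2)%MM)
   (if p (mdeg m + l')%N then f@_k.1 * g@_k.2 else 0).
  by case: ifP => // _; rewrite big1.
apply: eq_bigr => k /eqP mk; rewrite mcoeff_part.
have [->|/hg <-] := eqVneq g@_k.2 0; first by rewrite !mulr0 if_same.
rewrite addnA -mdegD -mk.
by case: ifP => // _; rewrite mul0r.
Qed.

Lemma homog_relX l (i : 'I_n) : homog_rel l.+1 l 'X_i.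
Proof.
move=> m; rewrite mcoeffX; case: (U_(i)%MM =P m) => [<-|_]; rewrite ?eqxx //.
by rewrite mdeg1 add1n.
Qed.

Lemma part_kill p l v f : part p l (kill v f) = kill v (part p l f).
Proof.
have partZX c m : part p l (c *: 'X_[m]) = if p (mdeg m + l)%N then c *: 'X_[m] else 0.
  apply/mpolyP => k; rewrite mcoeff_part (fun_if (mcoeff k)) mcoeffZ mcoeffX mcoeff0.
  case: (m =P k) => [->|_]; first by [].
  by rewrite mulr0 !if_same.
have killM c m : kill v (c *: 'X_[m]) =
  if [forall i : 'I_n, (i < v)%N ==> (m i == 0%N)] then c *: 'X_[m] else 0.
  rewrite -mul_mpolyC rmorphM /= killC mpolyXE_id rmorph_prod /=.
  case: ifP => [/forallP mv|/negbT]; last first.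
    rewrite negb_forall => /existsP[i]; rewrite negb_imply => /andP[iv mi].
    by rewrite (bigD1 i) //= rmorphXn /= killX iv expr0n (negPf mi) mul0r mulr0.
  congr (_ * _); apply: eq_bigr => i _; rewrite rmorphXn /= killX.
  case: ifP => // iv; have := mv i; rewrite iv => /eqP ->; by rewrite !expr0.
elim/mpolyind: f => [|c m f _ _ IHf]; first by rewrite part0 rmorph0 part0.
rewrite partD !rmorphD /= partD IHf; congr (_ + _).
rewrite partZX killM; case: ifP => h; case: ifP => h'.
- by rewrite partZX h' killM h.
- by rewrite partZX h' rmorph0.
- by rewrite part0 killM h.
by rewrite part0 rmorph0.
Qed.

End Part.

Section GradedRows.
Variables (C : idomainType) (n : nat).
Local Notation R := {mpoly C[n]}.
Implicit Types (p : pred nat).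

(** A predicate on degrees serves both the graded pieces, with [pred1 j], and the truncations to
    degrees at most [N]. *)
Definition partr p q (dg : 'I_q -> nat) (v : 'rV[R]_q) : 'rV[R]_q :=
  \row_a part p (dg a) (v 0 a).

Definition homogr j q (dg : 'I_q -> nat) (v : 'rV[R]_q) :=
  forall a, homog_rel j (dg a) (v 0 a).

Definition homogm q q' (dg : 'I_q -> nat) (dg' : 'I_q' -> nat) (A : 'M[R]_(q, q')) :=
  forall a b, homog_rel (dg a) (dg' b) (A a b).

Lemma partrD p q (dg : 'I_q -> nat) : {morph partr p dg : v w / v + w}.
Proof. by move=> v w; apply/rowP => a; rewrite !mxE partD. Qed.

Lemma partr0 p q (dg : 'I_q -> nat) : partr p dg 0 = 0.
Proof. by apply: (addrI (partr p dg 0)); rewrite -partrD !addr0. Qed.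

Lemma partrN p q (dg : 'I_q -> nat) : {morph partr p dg : v / - v}.
Proof. by move=> v; apply: (addrI (partr p dg v)); rewrite -partrD !subrr partr0. Qed.

Lemma partrB p q (dg : 'I_q -> nat) : {morph partr p dg : v w / v - w}.
Proof. by move=> v w; rewrite partrD partrN. Qed.

Lemma partr_mul p q q' (dg : 'I_q -> nat) (dg' : 'I_q' -> nat) v A :
  homogm dg dg' A -> partr p dg' (v *m A) = partr p dg v *m A.
Proof.
move=> hA; apply/rowP => b; rewrite !mxE.
rewrite (big_morph (part p (dg' b)) (@partD _ _ _ _) (part0 _ _ _ _)).
by apply: eq_bigr => a _; rewrite (partM _ _ (hA a b)) mxE.
Qed.

Lemma partr_killr p q (dg : 'I_q -> nat) v (w : 'rV[R]_q) :
  partr p dg (killr v w) = killr v (partr p dg w).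
Proof. by apply/rowP => a; rewrite !mxE part_kill. Qed.

Lemma homogr_partr j q (dg : 'I_q -> nat) v : homogr j dg (partr (pred1 j) dg v).
Proof.
move=> a m; rewrite mxE mcoeff_part /=.
by case: (_ =P j) => // _ /eqP.
Qed.

Lemma homogr_partrE j q (dg : 'I_q -> nat) v :
  homogr j dg v -> partr (pred1 j) dg v = v.
Proof.
by move=> hv; apply/rowP => a; rewrite mxE part_id // => m /hv /= ->.
Qed.

Lemma homogr_mul j q q' (dg : 'I_q -> nat) (dg' : 'I_q' -> nat) v A :
  homogm dg dg' A -> homogr j dg v -> homogr j dg' (v *m A).
Proof.
move=> hA /homogr_partrE <-; rewrite -(partr_mul _ _ hA); exact: homogr_partr.
Qed.

Lemma partr_scaleX j q (dg : 'I_q -> nat) (i : 'I_n) (v : 'rV[R]_q) :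
  partr (pred1 j.+1) dg ('X_i *: v) = 'X_i *: partr (pred1 j) dg v.
Proof.
apply/rowP => a; rewrite !mxE mulrC (partM _ _ (@homog_relX _ _ _ i)) mulrC.
congr (_ * _); apply/mpolyP => m; rewrite !mcoeff_part /=.
by rewrite addnS eqSS.
Qed.

Lemma homogr_scaleX j q (dg : 'I_q -> nat) (i : 'I_n) (v : 'rV[R]_q) :
  homogr j dg v -> homogr j.+1 dg ('X_i *: v).
Proof. by move=> /homogr_partrE <-; rewrite -partr_scaleX; apply: homogr_partr. Qed.

Lemma homogr_eq0 j q (dg : 'I_q -> nat) (v : 'rV[R]_q) :
  (forall a, j < dg a)%N -> homogr j dg v -> v = 0.
Proof.
move=> jd hv; apply/rowP => a; rewrite mxE; apply/mpolyP => m; rewrite mcoeff0.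
apply/eqP/negPn/negP => /hv; have := jd a; lia.
Qed.

Lemma homogr0 j q (dg : 'I_q -> nat) : homogr j dg (0 : 'rV[R]_q).
Proof. by move=> a m; rewrite mxE mcoeff0 eqxx. Qed.

End GradedRows.

Section Socle.
Variables (C : idomainType) (n : nat).
Local Notation R := {mpoly C[n]}.
Variables (rk : nat -> nat) (dg : forall i, 'I_(rk i) -> nat).
Variable (df : forall i, 'M[R]_(rk i.+1, rk i)).
Hypothesis acy : acyclic df.
Hypothesis hdf : forall i, homogm (@dg i.+1) (@dg i) (df i).

(** This is the injectivity of the map from the socle in degree [j] to [Tor_n] with the residue ring
    in degree [j + n], a composite of [n] connecting maps, one for each variable. *)
Lemma socle_lift j (z : 'rV_(rk 0)) : homogr j (@dg 0) z ->
  (forall u : 'I_n, exists y, 'X_u *: z = y *m df 0) ->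
  exists2 w : 'rV_(rk n), homogr (j + n) (@dg n) w &
    (exists y, killr n (w - y *m df n) = 0) -> exists y, z = y *m df 0.
Proof.
move=> hz soc; case: (acy) => dd ex.
suff [w [hw ws wb]] : exists w : 'rV_(rk n), [/\ homogr (j + n) (@dg n) w,
    (forall u : 'I_n, exists y, killr n ('X_u *: w - y *m df n) = 0) &
    (exists y, killr n (w - y *m df n) = 0) -> exists y, z = y *m df 0].
  by exists w.
suff st v : (v <= n)%N -> exists w : 'rV_(rk v), [/\ homogr (j + v) (@dg v) w,
    (forall u : 'I_n, exists y, killr v ('X_u *: w - y *m df v) = 0) &
    (exists y, killr v (w - y *m df v) = 0) -> exists y, z = y *m df 0] by exact: st.
elim: v => [_|v IHv lvn].
  exists z; split; rewrite ?addn0 //.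
    move=> u; have [y ->] := soc u; exists y; by rewrite subrr killr0.
  by case=> y; rewrite killr0 => /subr0_eq ->; exists y.
have [w [hw ws wb]] := IHv (ltnW lvn); pose x := Ordinal lvn.
(* The connecting map: ['X_x *: w] is a boundary modulo the earlier variables, and its preimage, cut
   down to the right degree, is the next representative. *)
have [y0 y0P] := ws x; pose y := partr (pred1 (j + v.+1)%N) (@dg v.+1) y0.
have yP : killr v ('X_x *: w - y *m df v) = 0.
  rewrite -(partr_mul _ _ (@hdf v)) -[X in killr v (X - _)](homogr_partrE (dg := dg (i := v)) (j := (j + v.+1)%N)).
    by rewrite -partrB -partr_killr y0P partr0.
  by rewrite addnS; apply: homogr_scaleX.
exists y; split; first exact: homogr_partr.
  move=> u; have [yu yuP] := ws u.
  have : killr v (('X_u *: y - 'X_x *: yu) *m df v) = 0.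
    rewrite mulmxBl -!scalemxAl.
    have -> : 'X_u *: (y *m df v) - 'X_x *: (yu *m df v) =
      'X_x *: ('X_u *: w - yu *m df v) - 'X_u *: ('X_x *: w - y *m df v).
      rewrite !scalerBr !scalerA [_ * 'X_x]mulrC opprB [RHS]addrC addrA subrK //.
    by rewrite killrB !killrZ yP yuP !scaler0 subrr.
  case/(acyclic_kill acy (ltnW lvn) (leqnn v)) => t tP; exists t.
  have -> : 'X_u *: y - t *m df v.+1 =
      ('X_u *: y - 'X_x *: yu - t *m df v.+1) + 'X_x *: yu by rewrite addrAC subrK.
  by rewrite killrD (killr_le (leqnSn v) tP) killrZ killX /= ltnSn scale0r addr0.
(* If [y] is the boundary of [t] up to ['X_x *: s], applying [df v] gives
   ['X_x *: w = 'X_x *: (s *m df v)] modulo the earlier variables, and ['X_x] cancels. *)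
case=> t tP; apply: wb; have [s sP] := @killrS_eq0 _ _ x _ _ _ tP; exists s.
apply: (@killr_regular _ _ x); rewrite scalerBr.
have -> : 'X_x *: w - 'X_x *: (s *m df v) = ('X_x *: w - y *m df v) +
    (y - t *m df v.+1 - 'X_x *: s) *m df v.
  by rewrite !mulmxBl -mulmxA dd mulmx0 subr0 -scalemxAl addrA subrK.
by rewrite killrD yP add0r; apply: killr_eq0_M.
Qed.

End Socle.

(** * McCoy's theorem and base change *)

Section McCoy.
Variables (R : comNzRingType) (E : lmodType R) (N Gam : E -> Prop) (f : {poly R}).
Hypotheses (N0 : N 0) (ND : forall x y, N x -> N y -> N (x + y))
  (NZ : forall a x, N x -> N (a *: x)).
Hypotheses (Gam0 : Gam 0) (GamZ : forall i x, Gam x -> Gam (f`_i *: x)).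
Hypothesis soc : forall x, Gam x -> (forall i, N (f`_i *: x)) -> N x.

(* c is the coefficient sequence of a polynomial with coefficients in E; this is
   McCoy's theorem for the module E / N. *)
Lemma mccoy (m : nat) (c : nat -> E) :
  (forall l, (m <= l)%N -> c l = 0) -> (forall l, Gam (c l)) ->
  (forall l, N (\sum_(i < l.+1) f`_i *: c (l - i)%N)) -> forall l, N (c l).
Proof.
have NB x y : N x -> N y -> N (x - y).
  by move=> Nx Ny; apply: ND => //; rewrite -scaleN1r; apply: NZ.
elim: m c => [|m IHm] c c0 cG cN; first by move=> l; rewrite c0.
suff fc d i : (size f - i <= d)%N -> forall l, N (f`_i *: c l).
  by move=> l; apply: soc => // i; exact: (fc (size f)) (leq_subr _ _) _.
elim: d i => [|d IHd] i sfi l.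
  by rewrite nth_default ?scale0r //; move: sfi; rewrite leqn0 subn_eq0.
(* In the coefficient of index [m + i] the terms with smaller index of [f] vanish because [c] stops
   at [m], and those with larger index lie in [N] by the descending induction. *)
have Nm : N (f`_i *: c m).
  have := cN (m + i)%N; have li : (i < (m + i).+1)%N by lia.
  rewrite (bigD1 (Ordinal li)) //= addnK => Nsum.
  set S := \sum_(_ < _ | _) _ in Nsum.
  have NS : N S.
    apply: (big_ind N) => // k /eqP kNi.
    have [ki|ki|kEi] := ltngtP k i.
    - by rewrite c0 ?scaler0 //; lia.
    - by apply: IHd; lia.
    by case: kNi; apply: val_inj.
  by have := NB _ _ Nsum NS; rewrite addrK.
(* The sequence scaled by the [i]-th coefficient of [f] and stripped of its top term, which is
   already in [N]: it is shorter, and [f] still multiplies it into [N]. *)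
pose c' l := if (l < m)%N then f`_i *: c l else 0.
have Nc' : forall l, N (c' l).
  apply: IHm => [k mk|k|k]; rewrite /c'.
  - by rewrite ltnNge mk.
  - by case: ifP => // _; apply: GamZ.
  have -> : \sum_(j < k.+1) f`_j *: (if (k - j < m)%N then f`_i *: c (k - j)%N else 0)
    = f`_i *: (\sum_(j < k.+1) f`_j *: c (k - j)%N)
      - \sum_(j < k.+1) (if (k - j < m)%N then 0 else f`_j *: (f`_i *: c (k - j)%N)).
    rewrite scaler_sumr -sumrB; apply: eq_bigr => j _.
    rewrite !scalerA [f`_i * _]mulrC; case: ifP => _; rewrite ?subr0 -?scalerA //.
    by rewrite scaler0 subrr.
  apply: NB; first exact: NZ.
  apply: (big_ind N) => // j _; case: ltnP => // mkj.
  apply: NZ; case: (ltngtP m (k - j)%N) mkj => // [mkj|<- //] _.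
  by rewrite c0 ?scaler0.
have [lm|ml|->//] := ltngtP l m; last by rewrite c0 ?scaler0.
by have := Nc' l; rewrite /c' lm.
Qed.

End McCoy.

Section PolyRows.
Variable R : comNzRingType.
Local Notation P := {poly R}.

Definition coefr l q (V : 'rV[P]_q) : 'rV[R]_q := map_mx (fun p : P => p`_l) V.
Definition pmx p q (A : 'M[R]_(p, q)) : 'M[P]_(p, q) := map_mx (@polyC R) A.

Lemma coefr_mul l p q (V : 'rV[P]_p) (A : 'M[R]_(p, q)) :
  coefr l (V *m pmx A) = coefr l V *m A.
Proof.
apply/rowP => b; rewrite !mxE coef_sum; apply: eq_bigr => a _.
by rewrite !mxE coefMC.
Qed.

Lemma coefrZ l q (f : P) (V : 'rV[P]_q) :
  coefr l (f *: V) = \sum_(i < l.+1) f`_i *: coefr (l - i) V.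
Proof.
apply/rowP => b; rewrite !mxE coefM summxE; apply: eq_bigr => i _.
by rewrite !mxE.
Qed.

Lemma coefr_inj q (V W : 'rV[P]_q) : (forall l, coefr l V = coefr l W) -> V = W.
Proof.
move=> VW; apply/rowP => a; apply/polyP => l; have /rowP/(_ a) := VW l.
by rewrite !mxE.
Qed.

Definition sizer q (V : 'rV[P]_q) := (\max_a size (V 0%R a))%N.

Lemma coefr_ge l q (V : 'rV[P]_q) : (sizer V <= l)%N -> coefr l V = 0.
Proof.
move=> Vl; apply/rowP => a; rewrite !mxE nth_default //.
by apply: leq_trans Vl; apply: (leq_bigmax a).
Qed.

Lemma coefr_in_image p q (B : 'M[R]_(p, q)) (V : 'rV[P]_q) :
  (forall l, exists w, coefr l V = w *m B) -> exists W, V = W *m pmx B.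
Proof.
move=> Vl; have /fin_all_exists[w wP] (l : 'I_(sizer V)) :
  exists w, coefr l V = w *m B by exact: Vl.
exists (\sum_(l < sizer V) 'X^l *: pmx (w l)); apply: coefr_inj => l; rewrite coefr_mul.
have -> : coefr l (\sum_(k < sizer V) 'X^k *: pmx (w k)) =
    \sum_(k < sizer V) (l == k)%:R *: w k.
  apply/rowP => a; rewrite !mxE summxE coef_sum summxE; apply: eq_bigr => k _.
  by rewrite !mxE coefMC coefXn.
have [lV|Vl'] := ltnP l (sizer V).
  rewrite (bigD1 (Ordinal lV)) //= eqxx scale1r big1 ?addr0 => [|k kl].
    exact: (wP (Ordinal lV)).
  case: eqP => [lk|_]; last by rewrite scale0r.
  by case/eqP: kl; apply: val_inj.
rewrite coefr_ge // big1 ?mul0mx // => k _.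
case: eqP => [lk|_]; last by rewrite scale0r.
by move: Vl'; rewrite lk leqNgt ltn_ord.
Qed.

Lemma exact_pmx p q r (A : 'M[R]_(q, r)) (B : 'M[R]_(p, q)) :
  (forall v : 'rV_q, v *m A = 0 -> exists w, v = w *m B) ->
  forall V : 'rV[P]_q, V *m pmx A = 0 -> exists W, V = W *m pmx B.
Proof.
move=> ex V VA; apply: coefr_in_image => l; apply: ex.
by rewrite -coefr_mul VA; apply/rowP => b; rewrite !mxE coef0.
Qed.

(** [Gam] limits where the cokernel must have no socle: over three variables a socle is present, but
    only in one degree. *)
Lemma mccoy_rows p q (B : 'M[R]_(p, q)) (f : P) (Gam : 'rV[R]_q -> Prop) :
  Gam 0 -> (forall i x, Gam x -> Gam (f`_i *: x)) ->
  (forall x, Gam x -> (forall i, exists y, f`_i *: x = y *m B) ->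
     exists y, x = y *m B) ->
  forall V : 'rV[P]_q, (forall l, Gam (coefr l V)) ->
  (exists W, f *: V = W *m pmx B) -> exists W, V = W *m pmx B.
Proof.
move=> G0 GZ soc V VG [W WP]; apply: coefr_in_image.
apply: (@mccoy R _ (fun x => exists w, x = w *m B) Gam f _ _ _ G0 GZ soc (sizer V)) => //.
- by exists 0; rewrite mul0mx.
- by move=> _ _ [w ->] [w' ->]; exists (w + w'); rewrite mulmxDl.
- by move=> a _ [w ->]; exists (a *: w); rewrite scalemxAl.
- by move=> l; exact: coefr_ge.
by move=> l; rewrite -coefrZ WP coefr_mul; eexists.
Qed.

End PolyRows.

(* Base change of an acyclic complex along R -> R[t] / (f) = R'. *)
Section BaseChange.
Variables (R R' : comNzRingType) (th : {rmorphism {poly R} -> R'}) (f : {poly R}).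
Hypothesis th_surj : forall y, exists x, th x = y.
Hypothesis th_ker : forall x, th x = 0 -> exists q, x = f * q.
Hypothesis thf : th f = 0.
Hypothesis freg : forall x, f * x = 0 -> x = 0.
Variables (rk : nat -> nat) (df : forall i, 'M[R]_(rk i.+1, rk i)).
Hypothesis acy : acyclic df.

Lemma th_mx_surj p q (A : 'M[R']_(p, q)) : exists B, map_mx th B = A.
Proof.
have /fin_all_exists[b bP] (x : 'I_p * 'I_q) : exists y, th y = A x.1 x.2 by exact: th_surj.
by exists (\matrix_(i, j) b (i, j)); apply/matrixP => i j; rewrite !mxE bP.
Qed.

Lemma th_mx_ker p q (A : 'M[{poly R}]_(p, q)) : map_mx th A = 0 -> exists B, A = f *: B.
Proof.
move=> /matrixP A0; have /fin_all_exists[b bP] (x : 'I_p * 'I_q) :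
  exists y, A x.1 x.2 = f * y by apply: th_ker; have := A0 x.1 x.2; rewrite !mxE.
by exists (\matrix_(i, j) b (i, j)); apply/matrixP => i j; rewrite !mxE (bP (i, j)).
Qed.

Lemma fmx_reg p q (A : 'M[{poly R}]_(p, q)) : f *: A = 0 -> A = 0.
Proof.
move=> /matrixP A0; apply/matrixP => i j; have := A0 i j; rewrite !mxE; exact: freg.
Qed.

Definition thdf i : 'M[R']_(rk i.+1, rk i) := map_mx (th \o @polyC R) (df i).

Lemma thdfE i : thdf i = map_mx th (pmx (df i)).
Proof. by apply/matrixP => a b; rewrite !mxE. Qed.

Lemma thdf_dd i : thdf i.+1 *m thdf i = 0.
Proof. by case: acy => dd _; rewrite /thdf -map_mxM dd map_mx0. Qed.

(** At the bottom, exactness needs [f] to be regular on the cokernel of [df 0]. This is asked only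
    of the [G] that arise from [V], so that the lemma can be used in a single degree. *)
Lemma thdf_exact0 (V : 'rV[{poly R}]_(rk 1)) :
  map_mx th V *m thdf 0 = 0 ->
  (forall G, f *: G = V *m pmx (df 0) -> exists H, G = H *m pmx (df 0)) ->
  exists W, map_mx th V = W *m thdf 1.
Proof.
case: acy => dd ex; rewrite thdfE -map_mxM => /th_mx_ker[G GP] mc.
have [H HP] := mc G (esym GP).
have : (V - f *: H) *m pmx (df 0) = 0.
  by rewrite mulmxBl GP HP -scalemxAl subrr.
case/(exact_pmx (ex 0)) => W WP; exists (map_mx th W).
rewrite thdfE -map_mxM -WP map_mxB map_mxZ thf scale0r subr0 //.
Qed.

(** Here the cokernel of [df i.+1] embeds into a free module by [df i], so [f] is regular on it
    automatically. *)
Lemma thdf_exactS i (V : 'rV[R']_(rk i.+2)) :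
  V *m thdf i.+1 = 0 -> exists W, V = W *m thdf i.+2.
Proof.
case: acy => dd ex; have [V' <-] := th_mx_surj V; rewrite thdfE -map_mxM.
move=> /th_mx_ker[G GP].
have [H HP] : exists H, G = H *m pmx (df i.+1).
  apply: (exact_pmx (ex i)); apply: fmx_reg; rewrite scalemxAl -GP -mulmxA.
  by rewrite /pmx -map_mxM dd map_mx0 mulmx0.
have : (V' - f *: H) *m pmx (df i.+1) = 0.
  by rewrite mulmxBl GP HP -scalemxAl subrr.
case/(exact_pmx (ex i.+1)) => W WP; exists (map_mx th W).
by rewrite thdfE -map_mxM -WP map_mxB map_mxZ thf scale0r subr0.
Qed.

Lemma thdf_acyclic :
  (forall G : 'rV[{poly R}]_(rk 0), (exists W, f *: G = W *m pmx (df 0)) ->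
     exists H, G = H *m pmx (df 0)) ->
  acyclic thdf.
Proof.
move=> mc; split=> [i|[|i] V]; first exact: thdf_dd; last exact: thdf_exactS.
have [V' <-] := th_mx_surj V => V0; apply: thdf_exact0 => // G GP.
by apply: mc; exists V'.
Qed.

End BaseChange.

(** * Restriction to a generic linear section *)

Section Theta_mor.
Variables (C : idomainType) (n : nat).
Local Notation R := {mpoly C[n.+1]}.
Local Notation C' := {poly C}.
Local Notation R' := {mpoly C'[n]}.

Definition tvar : R' := ('X : C')%:MP.

Definition theta_var (i : 'I_n.+1) : R' :=
  oapp (fun j : 'I_n => 'X_j) 0 (unlift ord_max i)
  + tvar * oapp (fun j : 'I_n => 'X_j) 0 (unlift ord0 i).

(* The point of P^n whose associated binary form is (1 + t z) (sum_j X_j z^j). *)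
Definition theta_mor : R -> R' := mmap (@mpolyC n C' \o @polyC C) theta_var.
HB.instance Definition _ := GRing.RMorphism.on theta_mor.

Definition Theta_mor : {poly R} -> R' := horner_eval tvar \o map_poly theta_mor.
HB.instance Definition _ := GRing.RMorphism.on Theta_mor.

Definition Theta_rm : {rmorphism {poly R} -> R'} := Theta_mor.

(** The recursion solves [x_k = X_k + t X_(k-1)] for [X_k]. For [k = n] it is the obstruction to
    solvability: up to a factor it is the value of the form with coefficients [x_j] at the root
    [-1/t] of [1 + t z]. *)
Fixpoint root_form (k : nat) : {poly R} :=
  match k with
  | 0 => ('X_(inord 0) : R)%:P
  | k'.+1 => ('X_(inord k) : R)%:P - 'X * root_form k'
  end.

Definition Psi : R' -> {poly R} :=
  mmap (map_poly (@mpolyC n.+1 C)) (fun i : 'I_n => root_form i).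
HB.instance Definition _ := GRing.RMorphism.on Psi.

Lemma thetaC c : theta_mor c%:MP = c%:P%:MP. Proof. exact: mmapC. Qed.
Lemma thetaX i : theta_mor 'X_i = theta_var i.
Proof. by rewrite /theta_mor mmapX mmap1U. Qed.
Lemma ThetaC g : Theta_mor g%:P = theta_mor g.
Proof. by rewrite /Theta_mor /= map_polyC /horner_eval hornerC. Qed.
Lemma ThetaX : Theta_mor 'X = tvar.
Proof. by rewrite /Theta_mor /= map_polyX /horner_eval hornerX. Qed.
Lemma ThetaE p : Theta_mor p = \sum_(i < size p) theta_mor p`_i * tvar ^+ i.
Proof.
rewrite -[p in LHS]coefK poly_def rmorph_sum /=; apply: eq_bigr => i _.
by rewrite -mul_polyC rmorphM rmorphXn /= ThetaC ThetaX.
Qed.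
Lemma PsiC c : Psi c%:MP = map_poly (@mpolyC n.+1 C) c. Proof. exact: mmapC. Qed.
Lemma PsiX i : Psi 'X_i = root_form i.
Proof. by rewrite /Psi mmapX mmap1U. Qed.
Lemma Psit : Psi tvar = 'X. Proof. by rewrite PsiC map_polyX. Qed.

Lemma inord_max : inord n = ord_max :> 'I_n.+1.
Proof. by apply/val_inj; rewrite /= inordK. Qed.

Lemma Psi_xup i : Psi (theta_var i) = ('X_i)%:P - (if i == ord_max then root_form n else 0).
Proof.
have rfE (j : 'I_n) : Psi 'X_j = root_form j by exact: PsiX.
rewrite /theta_var rmorphD rmorphM /= Psit; case: (unliftP ord_max i) => [j|] ij /=.
  rewrite rfE (_ : i == ord_max = false) ?subr0; last first.
    by rewrite ij eq_sym (negPf (neq_lift _ _)).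
  case: (unliftP ord0 i) => [j'|] ij' /=.
    rewrite rfE; have jj' : j = j'.+1 :> nat.
      by rewrite -(lift_max j) -ij ij' lift0.
    rewrite jj' /= subrK; congr (polyC 'X_ _); apply/val_inj.
    by rewrite /= -jj' -(lift_max j) -ij inord_val.
  have j0 : j = 0 :> nat by rewrite -(lift_max j) -ij ij'.
  rewrite j0 /= rmorph0 mulr0 addr0; congr (polyC 'X_ _); apply/val_inj.
  by rewrite ij' /= inordK.
rewrite ij eqxx rmorph0 add0r.
case: (unliftP ord0 ord_max) => [j'|] ij' /=.
  rewrite rfE; have nj : n = j'.+1 by rewrite -(lift0 j') -ij'.
  have rfS k : k = j'.+1 -> root_form k = ('X_(inord k))%:P - 'X * root_form j'.
    by move=> ->.
  by rewrite (rfS _ nj) inord_max opprB addrC subrK.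
have n0 : n = 0%N := congr1 (@nat_of_ord _) ij'.
have rf0 k : k = 0%N -> root_form k = ('X_(inord k))%:P by move=> ->.
by rewrite rmorph0 mulr0 (rf0 _ n0) inord_max subrr.
Qed.

Lemma Psi_Theta p : exists q, p - Psi (Theta_mor p) = root_form n * q.
Proof.
suff gen (r : R) : exists q, r%:P - Psi (theta_mor r) = root_form n * q.
  elim/poly_ind: p => [|p c [q qP]].
    by exists 0; rewrite !rmorph0 subr0 mulr0.
  have [q' q'P] := gen c; exists (q * 'X + q'); rewrite mulrDr mulrA -qP -q'P.
  rewrite !rmorphD !rmorphM /= ThetaC ThetaX Psit; ring.
elim/mpoly_gen_ind: r => [c|i|g h [q qP] [q' q'P]|g h [q qP] [q' q'P]].
- by exists 0; rewrite thetaC PsiC map_polyC subrr mulr0.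
- rewrite thetaX Psi_xup; case: ifP => _; last by exists 0; rewrite subr0 subrr mulr0.
  by exists 1; rewrite opprB addrC subrK mulr1.
- exists (q + q'); rewrite mulrDr -qP -q'P !rmorphD /=; ring.
exists (q * h%:P + Psi (theta_mor g) * q').
rewrite mulrDr [_ * (Psi _ * _)]mulrCA -q'P mulrA -qP !rmorphM /=; ring.
Qed.

Lemma Theta_Psi_X (i : 'I_n) : Theta_mor (root_form i) = 'X_i.
Proof.
case: i => i; elim: i => [|i IHi] lin /=.
  rewrite ThetaC thetaX /theta_var; set i0 := inord 0.
  have i0E : i0 = 0 :> nat by rewrite inordK.
  case: (unliftP ord_max i0) => [j|] E /=; last by exfalso; move: (lin); rewrite -[X in (_ < X)%N]/(nat_of_ord (@ord_max n)) -E i0E ?ltnn.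
  case: (unliftP ord0 i0) => [j'|] E' /=; first by move: i0E; rewrite E' lift0.
  by rewrite mulr0 addr0; congr 'X_ _; apply/val_inj; rewrite /= -(lift_max j) -E.
have lin' : (i < n)%N by apply: ltnW.
rewrite rmorphB rmorphM /= ThetaX (IHi lin') ThetaC thetaX /theta_var; set i0 := inord i.+1.
have i0E : i0 = i.+1 :> nat by rewrite inordK // ltnS ltnW.
case: (unliftP ord_max i0) => [j|] E /=; last by exfalso; move: (lin); rewrite -[X in (_ < X)%N]/(nat_of_ord (@ord_max n)) -E i0E ?ltnn.
case: (unliftP ord0 i0) => [j'|] E' /=; last by move: i0E; rewrite E'.
rewrite (_ : j' = Ordinal lin') ?addrK.
  by congr 'X_ _; apply/val_inj; rewrite /= -(lift_max j) -E.
by apply/val_inj; move: i0E; rewrite E' lift0 => -[].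
Qed.

Lemma Theta_Psi y : Theta_mor (Psi y) = y.
Proof.
elim/mpoly_gen_ind: y => [c|i|g h Eg Eh|g h Eg Eh].
- rewrite PsiC; elim/poly_ind: c => [|p c IHp]; first by rewrite !rmorph0.
  rewrite !rmorphD !rmorphM /= map_polyX ThetaX IHp map_polyC ThetaC thetaC.
  by [].
- by rewrite PsiX Theta_Psi_X.
- by rewrite !rmorphD /= Eg Eh.
by rewrite !rmorphM /= Eg Eh.
Qed.

Lemma Theta_root : Theta_mor (root_form n) = 0.
Proof.
have := Theta_Psi (theta_var ord_max); rewrite Psi_xup eqxx rmorphB /= ThetaC thetaX.
by move/eqP; rewrite subr_eq -subr_eq0 opprD addrA subrr sub0r oppr_eq0 => /eqP.
Qed.

Lemma Theta_ker p : Theta_mor p = 0 -> exists q, p = root_form n * q.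
Proof.
by move=> p0; have [q] := Psi_Theta p; rewrite p0 rmorph0 subr0; exists q.
Qed.

Lemma coef_root_form k i : (k <= n)%N ->
  (root_form k)`_i = if (i <= k)%N then (-1) ^+ i * 'X_(inord (k - i)) else 0.
Proof.
elim: k i => [|k IHk] i lkn /=.
  by rewrite coefC; case: i => [|i] //=; rewrite expr0 mul1r.
rewrite coefB coefC coefXM; case: i => [|i] /=; first by rewrite subr0 expr0 mul1r.
rewrite sub0r IHk ?(ltnW lkn) // ltnS subSS; case: ifP => _; rewrite ?oppr0 //.
by rewrite exprS mulN1r mulNr.
Qed.

Lemma root_form_neq0 : root_form n != 0.
Proof.
apply/negP => /eqP/(congr1 (fun p : {poly R} => p`_0)).
rewrite coef_root_form // coef0 expr0 mul1r => /(congr1 (mcoeff U_(inord (n - 0)))).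
by rewrite mcoeffXU eqxx mcoeff0 => /eqP; rewrite oner_eq0.
Qed.

(** Up to sign the [t]-coefficients of the linear form are exactly the variables, so McCoy's
    condition on an element is that it lies in the socle. *)
Lemma root_form_vars q p (B : 'M[R]_(p, q)) (z : 'rV_q) :
  (forall i, exists y, (root_form n)`_i *: z = y *m B) ->
  forall u : 'I_n.+1, exists y, 'X_u *: z = y *m B.
Proof.
move=> h u; have [y] := h (n - u)%N; rewrite coef_root_form // leq_subr.
rewrite subKn ?inord_val; last by rewrite -ltnS.
move=> E; exists ((-1) ^+ (n - u) *: y); rewrite -scalemxAl -E scalerA.
by rewrite mulrA -exprD addnn -mul2n exprM sqrrN !expr1n mul1r.
Qed.

End Theta_mor.

Lemma coefM_top (C : nzRingType) (p q : {poly C}) d e :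
  (size p <= d.+1)%N -> (size q <= e.+1)%N -> (p * q)`_(d + e) = p`_d * q`_e.
Proof.
move=> sp sq; rewrite coefM; have ld : (d < (d + e).+1)%N by rewrite ltnS leq_addr.
rewrite (bigD1 (Ordinal ld)) //= addKn big1 ?addr0 // => i /eqP ne.
have [id|di|E] := ltngtP i d; last by case: ne; apply: val_inj.
  rewrite [q`__]nth_default ?mulr0 //; apply: leq_trans sq _; lia.
rewrite [p`__]nth_default ?mul0r //; apply: leq_trans sp _; lia.
Qed.

Section ThetaGrading.
Variables (C : idomainType) (n : nat).
Local Notation R := {mpoly C[n.+1]}.
Local Notation C' := {poly C}.
Local Notation R' := {mpoly C'[n]}.
Local Notation xup := (@theta_var C n).
Local Notation theta := (@theta_mor C n).

(* theta at t = oo *)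
Definition kappa : R -> {mpoly C[n]} :=
  mmap (@mpolyC n C) (fun i => oapp (fun j : 'I_n => 'X_j) 0 (unlift ord0 i)).
HB.instance Definition _ := GRing.RMorphism.on kappa.

Lemma kappaC c : kappa c%:MP = c%:MP. Proof. exact: mmapC. Qed.
Lemma kappaX i : kappa 'X_i = oapp (fun j : 'I_n => 'X_j) 0 (unlift ord0 i).
Proof. by rewrite /kappa mmapX mmap1U. Qed.

(** Under [theta_mor] a form of degree [e] becomes a form of degree [e] in the [X_j] whose
    coefficients have degree at most [e] in [t]; [G] is its value at [t = oo]. *)
Definition lead (e : nat) (F : R') (G : {mpoly C[n]}) :=
  forall m, (F@_m != 0 -> mdeg m = e) /\ (size F@_m <= e.+1)%N /\ (F@_m)`_e = G@_m.

Lemma leadD e F F' G G' : lead e F G -> lead e F' G' -> lead e (F + F') (G + G').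
Proof.
move=> h h' m; have [h1 [h2 h3]] := h m; have [h1' [h2' h3']] := h' m.
rewrite !mcoeffD coefD h3 h3'; split; last split=> //.
  have [E|/h1//] := eqVneq F@_m 0; rewrite E add0r; exact: h1'.
by apply: leq_trans (size_polyD _ _) _; rewrite geq_max h2.
Qed.

Lemma leadZ e c F G : lead e F G -> lead e (c%:P *: F) (c *: G).
Proof.
move=> h m; have [h1 [h2 h3]] := h m; rewrite !mcoeffZ coefCM h3; split; last split=> //.
  by move=> ne; apply: h1; apply: contraNneq ne => ->; rewrite mulr0.
by rewrite mul_polyC; apply: leq_trans (size_scale_leq _ _) h2.
Qed.

Lemma leadM e e' F F' G G' :
  lead e F G -> lead e' F' G' -> lead (e + e') (F * F') (G * G').
Proof.
move=> h h' m; rewrite !mcoeffM coef_sum; split; last split.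
- move=> ne; apply/eqP; apply: contraNT ne => mee; apply/eqP; apply: big1 => k /eqP/(congr1 mdeg) mk.
  have [->|/(proj1 (h _)) d1] := eqVneq F@_k.1 0; first by rewrite mul0r.
  have [->|/(proj1 (h' _)) d2] := eqVneq F'@_k.2 0; first by rewrite mulr0.
  by move: mee; rewrite {1}mk mdegD d1 d2 eqxx.
- apply: (big_ind (fun p : C' => (size p <= (e + e').+1)%N)).
  + by rewrite size_poly0.
  + by move=> p q sp sq; apply: leq_trans (size_polyD _ _) _; rewrite geq_max sp.
  move=> k _; have [_ [s1 _]] := h k.1; have [_ [s2 _]] := h' k.2.
  apply: leq_trans (size_polyMleq _ _) _; have := leq_add s1 s2; move: (_ + _)%N => a; lia.
apply: eq_bigr => k _; have [_ [s1 <-]] := h k.1; have [_ [s2 <-]] := h' k.2.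
exact: coefM_top.
Qed.

Lemma lead0 e : lead e 0 0.
Proof. by move=> m; rewrite !mcoeff0 eqxx size_poly0 coef0. Qed.

Lemma lead1 : lead 0 1 1.
Proof.
move=> m; rewrite !mcoeff1; case: (m =P 0%MM) => [->|_].
  by rewrite mdeg0 size_poly1 coef1.
by rewrite eqxx size_poly0 coef0.
Qed.

Lemma lead_xup i : lead 1 (xup i) (oapp (fun j : 'I_n => 'X_j) 0 (unlift ord0 i)).
Proof.
have hX (o : option 'I_n) m : exists b : bool,
    ((oapp (fun j : 'I_n => 'X_j) 0 o : R')@_m = b%:R) /\
    ((oapp (fun j : 'I_n => 'X_j) 0 o : {mpoly C[n]})@_m = b%:R) /\ (b -> mdeg m = 1%N).
  case: o => [j|] /=; last by exists false; rewrite !mcoeff0.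
  exists (U_(j)%MM == m); rewrite !mcoeffX; split=> //; split=> // /eqP <-.
  by rewrite mdeg1.
move=> m; have [b1 [E1 [_ d1]]] := hX (unlift ord_max i) m.
have [b2 [E2 [E2' d2]]] := hX (unlift ord0 i) m.
rewrite /theta_var mcoeffD /tvar mcoeffCM E1 E2 E2'.
have sb (b : bool) : (size (b%:R : C') <= 1)%N.
  by case: b; rewrite ?size_poly1 ?size_poly0.
split; last split.
- case: b1 d1 {E1} => [d1 _|_]; first exact: d1.
  case: b2 d2 {E2 E2'} => [d2 _|_]; first exact: d2.
  by rewrite mulr0 addr0 eqxx.
- apply: leq_trans (size_polyD _ _) _; rewrite geq_max (leq_trans (sb _)) //=.
  by rewrite mulrC (leq_trans (size_polyMleq _ _)) // size_polyX addn2 /= ltnS.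
rewrite coefD coefXM /=; case: b1 {E1 d1}; case: b2 {E2 E2' d2}; rewrite ?coef1 ?coef0 ?add0r //.
Qed.

Lemma lead_thetaX m : lead (mdeg m) (theta 'X_[m]) (kappa 'X_[m]).
Proof.
rewrite mdegE mpolyXE_id !rmorph_prod /=.
apply: (big_ind3 (fun e F G => lead e F G)) => [|e F G e' F' G'|i _].
- exact: lead1.
- exact: leadM.
rewrite !rmorphXn /= thetaX kappaX.
by elim: (m i) => [|d IHd]; [exact: lead1 | rewrite !exprS -add1n; apply: leadM (lead_xup i) IHd].
Qed.

Lemma lead_theta e g : (forall m, g@_m != 0 -> mdeg m = e) ->
  lead e (theta g) (kappa g).
Proof.
move=> hg; rewrite (mpolyE g) !rmorph_sum /= big_seq [X in lead _ _ X]big_seq.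
apply: (big_ind2 (fun F G => lead e F G)) => [|F G F' G'|m].
- exact: lead0.
- exact: leadD.
rewrite mcoeff_msupp => /hg <-; rewrite -!mul_mpolyC !rmorphM /= thetaC kappaC !mul_mpolyC.
by apply: leadZ; exact: lead_thetaX.
Qed.

Lemma part_theta p l (g : R) : part p l (theta g) = theta (part p l g).
Proof.
have partX0 (D : idomainType) k : part p l (0 : {mpoly D[k]}) = 0.
  by apply/mpolyP => m; rewrite mcoeff_part mcoeff0 if_same.
elim/mpolyind: g => [|c m g _ _ IHg]; first by rewrite partX0 rmorph0 partX0.
rewrite partD !rmorphD /= partD IHg; congr (_ + _).
have hc m' : (c *: 'X_[m])@_m' != 0 -> mdeg m' = mdeg m.
  by rewrite mcoeffZ mcoeffX; case: (m =P m') => [<-//|_]; rewrite mulr0 eqxx.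
have hl := lead_theta hc.
have [pm|npm] := boolP (p (mdeg m + l)%N).
  by rewrite !part_id // => m'; [move/hc -> | move/(proj1 (hl m')) ->].
have -> : part p l (c *: 'X_[m]) = 0.
  apply/mpolyP => m'; rewrite mcoeff_part mcoeff0; case: ifP => // pm'.
  apply/eqP/negPn/negP => /hc E; by move: npm; rewrite -E pm'.
rewrite rmorph0; apply/mpolyP => m'; rewrite mcoeff_part mcoeff0; case: ifP => // pm'.
apply/eqP/negPn/negP => /(proj1 (hl m')) E; by move: npm; rewrite -E pm'.
Qed.

Lemma homog_rel_theta l l' (g : R) : homog_rel l l' g -> homog_rel l l' (theta g).
Proof.
move=> hg; have -> : g = part (pred1 l) l' g by rewrite part_id // => m /hg /= ->.
by rewrite -part_theta => m; rewrite mcoeff_part /=; case: (_ =P l) => // _ /eqP.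
Qed.

End ThetaGrading.

Section Reduction.
Variables (C : idomainType) (n : nat).
Local Notation R := {mpoly C[n.+1]}.
Local Notation C' := {poly C}.
Local Notation R' := {mpoly C'[n]}.
Variables (rk : nat -> nat) (dg : forall i, 'I_(rk i) -> nat).
Variable (df : forall i, 'M[R]_(rk i.+1, rk i)).
Hypothesis acy : acyclic df.
Hypothesis hdf : forall i, homogm (@dg i.+1) (@dg i) (df i).

Definition theta_df i : 'M[R']_(rk i.+1, rk i) := map_mx (@theta_mor C n) (df i).

Lemma redE i : theta_df i = thdf (Theta_rm C n) df i.
Proof. by apply/matrixP => a b; rewrite mxE [in RHS]mxE; apply/esym/ThetaC. Qed.

Lemma red_homogm i : homogm (@dg i.+1) (@dg i) (theta_df i).
Proof. by move=> a b; rewrite mxE; apply: homog_rel_theta; apply: hdf. Qed.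

Lemma root_form_reg (x : {poly R}) : root_form C n n * x = 0 -> x = 0.
Proof. by move/eqP; rewrite mulf_eq0 (negPf (root_form_neq0 _ _)) => /eqP. Qed.

Lemma partr_sum (m : nat) q (d : 'I_q -> nat) (z : 'rV[R]_q) :
  exists B, z = \sum_(j < B) partr (pred1 (j : nat)) d z.
Proof.
exists (\max_a (msize (z 0%R a) + d a)).+1; apply/rowP => a; rewrite summxE.
apply/mpolyP => k; rewrite raddf_sum /=.
have [zk|nzk] := eqVneq (z 0 a)@_k 0.
  by rewrite zk big1 // => j _; rewrite mxE mcoeff_part zk if_same.
have lk : (mdeg k + d a < (\max_a (msize (z 0%R a) + d a)).+1)%N.
  rewrite ltnS; apply: leq_trans (leq_bigmax a); rewrite leq_add2r.
  by apply/ltnW/msize_mdeg_lt; rewrite mcoeff_msupp.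
rewrite (bigD1 (Ordinal lk)) //= mxE mcoeff_part /= eqxx big1 ?addr0 // => j /eqP ne.
rewrite mxE mcoeff_part /=; case: eqP => // E; case: ne; exact/val_inj.
Qed.

(** Over [n + 1] variables a socle element is detected in position [n + 1] of the complex, which is
    empty here. The element is first split into homogeneous parts. *)
Lemma socle_free (z : 'rV_(rk 0)) : rk n.+1 = 0%N ->
  (forall u : 'I_n.+1, exists y, 'X_u *: z = y *m df 0) -> exists y, z = y *m df 0.
Proof.
move=> rk0 soc; have [B ->] := partr_sum 0 (@dg 0) z.
apply: (big_ind (fun z => exists y, z = y *m df 0)).
- by exists 0; rewrite mul0mx.
- by move=> _ _ [y ->] [y' ->]; exists (y + y'); rewrite mulmxDl.
move=> j _; have soc' (u : 'I_n.+1) : exists y,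
    'X_u *: partr (pred1 (j : nat)) (@dg 0) z = y *m df 0.
  have [y yP] := soc u; exists (partr (pred1 (j : nat).+1) (@dg 1) y).
  by rewrite -(partr_mul _ _ (@hdf 0)) -yP partr_scaleX.
have [w _] := socle_lift acy hdf (@homogr_partr _ _ j _ (@dg 0) z) soc'.
apply; exists 0; rewrite mul0mx subr0; apply/rowP => a; by have := ltn_ord a; rewrite [X in (_ < X)%N]rk0.
Qed.

Lemma red_acyclic : rk n.+1 = 0%N -> acyclic theta_df.
Proof.
move=> rk0; have acy' : acyclic (thdf (Theta_rm C n) df).
  apply: (@thdf_acyclic _ _ (Theta_rm C n) (root_form C n n)) => //.
  - by move=> y; exists (Psi y); exact: Theta_Psi.
  - exact: Theta_ker.
  - exact: Theta_root.
  - exact: root_form_reg.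
  move=> G; apply: (@mccoy_rows _ _ _ _ _ (fun=> True)) => // z _ soc.
  by apply: socle_free => // u; apply: root_form_vars soc u.
case: acy' => dd ex; split=> [i|i v]; first by rewrite !redE.
by rewrite redE => /ex[w ->]; exists w; rewrite redE.
Qed.

End Reduction.

(** * Complexes over three variables *)

Section PartPoly.
Variables (C : idomainType) (n : nat).
Local Notation R := {mpoly C[n.+1]}.
Local Notation Theta := (Theta_rm C n).

Definition partP q p (dg : 'I_q -> nat) (V : 'rV[{poly R}]_q) : 'rV[{poly R}]_q :=
  \row_a \poly_(i < size (V 0 a)) part p (dg a) (V 0 a)`_i.

Lemma coefr_partP q p (dg : 'I_q -> nat) V l :
  coefr l (partP p dg V) = partr p dg (coefr l V).
Proof.
apply/rowP => a; rewrite !mxE coef_poly; case: ltnP => // sl.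
by rewrite nth_default // part0.
Qed.

Lemma homog_tvarX l i : homog_rel l l (tvar C n ^+ i).
Proof.
rewrite /tvar -rmorphXn /= => m; rewrite mcoeffC.
by case: (m =P 0%MM) => [->|_]; rewrite ?mdeg0 ?mulr0 ?eqxx.
Qed.

Lemma Theta_widen (p : {poly R}) N : (size p <= N)%N ->
  Theta p = \sum_(i < N) theta_mor p`_i * tvar C n ^+ i.
Proof.
move=> sN; rewrite -[LHS]/(Theta_mor p) ThetaE (big_ord_widen N (fun i => theta_mor p`_i * tvar C n ^+ i) sN).
rewrite big_mkcond; apply: eq_bigr => i _; case: ltnP => // si.
by rewrite nth_default // rmorph0 mul0r.
Qed.

Lemma map_Theta_partP q p (dg : 'I_q -> nat) V :
  map_mx Theta (partP p dg V) = partr p dg (map_mx Theta V).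
Proof.
apply/rowP => a; rewrite !mxE (Theta_widen (size_poly _ _)) (Theta_widen (leqnn _)).
rewrite (big_morph (part p (dg a)) (@partD _ _ _ _) (part0 _ _ _ _)).
apply: eq_bigr => i _; rewrite (partM _ _ (@homog_tvarX (dg a) i)) part_theta.
by rewrite coef_poly ltn_ord.
Qed.

Lemma partP_root_form q (dg : 'I_q -> nat) j G :
  partP (pred1 j.+1) dg (root_form C n n *: G) = root_form C n n *: partP (pred1 j) dg G.
Proof.
apply: coefr_inj => l; rewrite coefr_partP !coefrZ.
rewrite (big_morph (partr (pred1 j.+1) dg) (@partrD _ _ _ _ _) (@partr0 _ _ _ _ _)).
apply: eq_bigr => i _; rewrite coefr_partP coef_root_form //; case: ifP => _.
  rewrite -!scalerA.
  have sg (v : 'rV[R]_q) : (-1) ^+ i *: v = if odd i then - v else v.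
    by rewrite -signr_odd; case: (odd i); rewrite ?expr1 ?scaleN1r // scale1r.
  by rewrite !sg; case: (odd i); rewrite ?partrN partr_scaleX.
by rewrite !scale0r partr0.
Qed.

End PartPoly.

Section Supernatural.
Variable C : idomainType.
Local Notation R := {mpoly C[3]}.
Local Notation C' := {poly C}.
Local Notation R' := {mpoly C'[2]}.
Variables (rk : nat -> nat) (dg : forall i, 'I_(rk i) -> nat).
Variable (df : forall i, 'M[R]_(rk i.+1, rk i)).
Hypothesis acy : acyclic df.
Hypothesis hdf : forall i, homogm (@dg i.+1) (@dg i) (df i).
Variable e : nat.
Hypothesis dg0 : forall a : 'I_(rk 0), dg a = 0%N.
Hypothesis dg3 : forall a : 'I_(rk 3), dg a = e.+2.
Local Notation Th := (Theta_rm C 2).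
Local Notation red := (theta_df df).

(** The representative in position 3 has degree [j + 3], while the basis there has degree [e + 2];
    when these differ it has no constant terms. *)
Lemma socle_degree j (z : 'rV_(rk 0)) : (j + 3 != e.+2)%N -> homogr j (@dg 0) z ->
  (forall u : 'I_3, exists y, 'X_u *: z = y *m df 0) -> exists y, z = y *m df 0.
Proof.
move=> je hz soc; have [w hw] := socle_lift acy hdf hz soc.
apply; exists 0; rewrite mul0mx subr0; apply/rowP => a; rewrite !mxE kill_all.
suff -> : (w 0 a)@_0%MM = 0 by rewrite mpolyC0.
by apply/eqP/negPn/negP => /hw; rewrite mdeg0 dg3 add0n => E; rewrite E eqxx in je.
Qed.

(** In degree [e + 1] McCoy's theorem meets only elements of degree at least [e] in the cokernel of
    [df 0], above the only possible socle degree [e - 1]. *)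
Lemma red_exact1 (V : 'rV[R']_(rk 1)) : homogr e.+1 (@dg 1) V ->
  V *m red 0 = 0 -> exists2 W, homogr e.+1 (@dg 2) W & V = W *m red 1.
Proof.
move=> hV V0.
have [V1 V1P] := @th_mx_surj _ _ Th (fun y => ex_intro _ _ (Theta_Psi y)) _ _ V.
pose V2 := partP (pred1 e.+1) (@dg 1) V1.
have V2P : map_mx Th V2 = V by rewrite map_Theta_partP V1P homogr_partrE.
have [W WP] : exists W, map_mx Th V2 = W *m thdf Th df 1.
  apply: (@thdf_exact0 _ _ Th (root_form C 2 2) (@Theta_ker C 2) (@Theta_root C 2) _ _ acy).
    by rewrite V2P -redE.
  move=> G GP.
  have hV2 l : homogr e.+1 (@dg 0) (coefr l V2 *m df 0).
    apply: (homogr_mul (@hdf 0)); rewrite coefr_partP; exact: homogr_partr.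
  have G' : G = partP (pred1 e) (@dg 0) G.
    apply/eqP; rewrite -subr_eq0; apply/eqP/(fmx_reg (@root_form_reg C 2)).
    rewrite scalerBr -partP_root_form GP; apply/eqP; rewrite subr_eq0; apply/eqP.
    by apply: coefr_inj => l; rewrite coefr_partP coefr_mul homogr_partrE.
  (* The admissible set must be stable under the coefficients of the linear form, which raise
     degrees by one; hence all degrees [j] with [e <= j]. *)
  apply: (@mccoy_rows _ _ _ _ (root_form C 2 2)
    (fun z => exists2 j, (e <= j)%N & homogr j (@dg 0) z)).
  - by exists e => //; exact: homogr0.
  - move=> i z [j ej hz]; rewrite coef_root_form //; case: ifP => _; last first.
      by exists e => //; rewrite scale0r; exact: homogr0.
    exists j.+1; first exact: leqW.
    rewrite -scalerA; have := @homogr_scaleX _ _ _ _ _ (inord (2 - i)) _ hz.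
    rewrite -signr_odd; case: (odd i); rewrite ?expr1 ?scaleN1r ?expr0 ?scale1r //.
    by move=> h a m; rewrite mxE mcoeffN oppr_eq0; exact: h.
  - move=> z [j ej hz] soc; apply: (@socle_degree j) => //; first by lia.
    by move=> u; apply: root_form_vars soc u.
  - by move=> l; exists e => //; rewrite G' coefr_partP; exact: homogr_partr.
  by exists V2.
exists (partr (pred1 e.+1) (@dg 2) W); first exact: homogr_partr.
rewrite -(partr_mul _ _ (@red_homogm _ _ _ _ _ hdf 1)) redE -WP V2P.
by rewrite homogr_partrE.
Qed.

Lemma red_exact2 (V : 'rV[R']_(rk 2)) : homogr e.+1 (@dg 2) V ->
  V *m red 1 = 0 -> V = 0.
Proof.
move=> hV; rewrite redE.
case/(@thdf_exactS _ _ Th (root_form C 2 2) (fun y => ex_intro _ _ (Theta_Psi y))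
  (@Theta_ker C 2) (@Theta_root C 2) (@root_form_reg C 2) _ _ acy 0) => W WP.
rewrite -(homogr_partrE hV) WP -redE (partr_mul _ _ (@red_homogm _ _ _ _ _ hdf 2)).
rewrite (homogr_eq0 (j := e.+1) (dg := dg (i := 3)) (v := partr _ _ _)) ?mul0mx //.
  by move=> a; rewrite dg3.
exact: homogr_partr.
Qed.

End Supernatural.

(** * Leading coefficients in [t] and exactness at infinity *)

Section TopCoef.
Variables (C : idomainType) (n : nat).
Local Notation R := {mpoly C[n.+1]}.
Local Notation C' := {poly C}.
Local Notation R' := {mpoly C'[n]}.

Definition tcoef d (F : R') : {mpoly C[n]} :=
  \sum_(m <- msupp F) (F@_m)`_d *: 'X_[m].

Lemma mcoeff_tcoef d F m : (tcoef d F)@_m = (F@_m)`_d.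
Proof.
rewrite /tcoef raddf_sum /=; under eq_bigr => k _ do rewrite mcoeffZ mcoeffX.
have [mF|/memN_msupp_eq0 Fm] := boolP (m \in msupp F); last first.
  rewrite Fm coef0 big1_seq // => k /andP[_ kF].
  by case: (k =P m) => [E|_]; rewrite ?mulr0 // E Fm coef0 mul0r.
rewrite (big_rem m) //= eqxx mulr1 big1_seq ?addr0 // => k /andP[_].
rewrite mem_rem_uniq ?msupp_uniq // inE => /andP[/negPf -> _].
by rewrite mulr0.
Qed.

Lemma tcoef_mul d e (F H : R') (G : {mpoly C[n]}) m : (forall m, size F@_m <= d.+1)%N -> lead e H G ->
  ((F * H)@_m)`_(d + e) = (tcoef d F * G)@_m.
Proof.
move=> sF lH; rewrite !mcoeffM coef_sum; apply: eq_bigr => k _.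
by have [_ [sH <-]] := lH k.2; rewrite mcoeff_tcoef coefM_top.
Qed.

(** A section of [kappa] that avoids [x_0], by which relations at [t = oo] become relations of the
    original complex modulo [x_0]. *)
Definition shiftX : {mpoly C[n]} -> R := mmap (@mpolyC n.+1 C) (fun j => 'X_(lift ord0 j)).
HB.instance Definition _ := GRing.RMorphism.on shiftX.

Lemma shiftXC c : shiftX c%:MP = c%:MP. Proof. exact: mmapC. Qed.
Lemma shiftXX i : shiftX 'X_i = 'X_(lift ord0 i).
Proof. by rewrite /shiftX mmapX mmap1U. Qed.

Lemma kill1E g : kill 1 g = shiftX (kappa g).
Proof.
elim/mpoly_gen_ind: g => [c|i|f g Ef Eg|f g Ef Eg].
- by rewrite killC kappaC shiftXC.
- rewrite killX kappaX; case: (unliftP ord0 i) => [j|] -> /=.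
    by rewrite shiftXX.
  by rewrite rmorph0.
- by rewrite !rmorphD /= Ef Eg.
by rewrite !rmorphM /= Ef Eg.
Qed.

Lemma shiftXK g : kappa (shiftX g) = g.
Proof.
elim/mpoly_gen_ind: g => [c|i|f g Ef Eg|f g Ef Eg].
- by rewrite shiftXC kappaC.
- by rewrite shiftXX kappaX liftK.
- by rewrite !rmorphD /= Ef Eg.
by rewrite !rmorphM /= Ef Eg.
Qed.

Lemma homog_rel_shiftX l l' g : homog_rel l l' g -> homog_rel l l' (shiftX g).
Proof.
move=> hg; rewrite (mpolyE g) rmorph_sum /= big_seq.
apply: (big_ind (homog_rel l l')) => [m|f h hf hh m|m].
- by rewrite mcoeff0 eqxx.
- rewrite mcoeffD; have [->|/hf//] := eqVneq f@_m 0; rewrite add0r; exact: hh.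
rewrite mcoeff_msupp => /hg <-; rewrite -mul_mpolyC rmorphM /= shiftXC mul_mpolyC.
have : shiftX 'X_[m] \is (mdeg m).-homog.
  rewrite mdegE mpolyXE_id rmorph_prod /=.
  apply: (big_ind2 (fun (f : R) d => f \is d.-homog)) => [|f d f' d'|i _].
  - exact: dhomog1.
  - exact: dhomogM.
  rewrite rmorphXn /= shiftXX.
  have h1 : ('X_(lift ord0 i) : R) \is 1.-homog by rewrite dhomogX; apply/eqP; exact: mdeg1.
  by have := dhomogMn (m i) h1; rewrite mul1n.
by move/(dhomogZ g@_m)/dhomogP => h k; rewrite -mcoeff_msupp => /h ->.
Qed.

End TopCoef.

Section Supernatural.
Variable C : idomainType.
Local Notation R := {mpoly C[3]}.
Local Notation C' := {poly C}.
Local Notation R' := {mpoly C'[2]}.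
Variables (rk : nat -> nat) (dg : forall i, 'I_(rk i) -> nat).
Variable (df : forall i, 'M[R]_(rk i.+1, rk i)).
Hypothesis acy : acyclic df.
Hypothesis hdf : forall i, homogm (@dg i.+1) (@dg i) (df i).
Variable e : nat.
Hypothesis dg0 : forall a : 'I_(rk 0), dg a = 0%N.
Hypothesis dg3 : forall a : 'I_(rk 3), dg a = e.+2.
Local Notation red := (theta_df df).
Local Notation N := e.+2.

Lemma lead_red i a b : (dg (i := i) b <= dg (i := i.+1) a)%N ->
  lead (dg (i := i.+1) a - dg (i := i) b) (red i a b) (kappa (df i a b)).
Proof. by move=> ab; rewrite mxE; apply: lead_theta => m /hdf; lia. Qed.

Lemma red_eq0 i a b : (dg (i := i.+1) a < dg (i := i) b)%N -> df i a b = 0.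
Proof.
move=> ab; apply/mpolyP => m; rewrite mcoeff0; apply/eqP/negPn/negP => /hdf; lia.
Qed.

(* Exactness at infinity: the t-degree of a solution is controlled by that of
   its image, since the leading coefficients in t form a solution modulo x_0. *)
Lemma bounded_preimage (g : 'rV[R']_(rk 2)) : homogr e.+1 (@dg 2) g ->
  (forall b m, ((g *m red 1) 0 b)@_m != 0 ->
     (size ((((g *m red 1) 0 b)@_m)%R : {poly C}) + dg b <= N)%N) ->
  forall a m, (g 0 a)@_m != 0 -> (size (((g 0 a)@_m)%R : {poly C}) + dg a <= N)%N.
Proof.
move=> hg bd.
(* Descent on the excess [k] of the [t]-degrees over the claimed bound; some finite excess always
   holds, by taking maxima over the support. *)
suff st k : (forall a m, (g 0 a)@_m != 0 -> (size (((g 0 a)@_m)%R : {poly C}) + dg a <= N + k)%N) ->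
    forall a m, (g 0 a)@_m != 0 -> (size (((g 0 a)@_m)%R : {poly C}) + dg a <= N)%N.
  apply: (st (\max_a (\max_(m <- msupp (g 0%R a)) (size (((g 0 a)@_m)%R : {poly C})) + dg a))%N) => a m gm.
  apply: leq_trans (leq_addl _ _).
  apply: leq_trans (leq_bigmax a); rewrite leq_add2r.
  by apply: leq_bigmax_seq => //; rewrite mcoeff_msupp.
elim: k => [|k IHk] h; first by move=> a m /h; rewrite addn0.
apply: IHk; have [K KE NK] : exists2 K, (N + k = K)%N & (N <= K)%N by exists (N + k)%N; rewrite ?leq_addr.
have hK : (N + k.+1 = K.+1)%N by rewrite addnS KE.
rewrite KE.
have sz a m : (size (((g 0 a)@_m)%R : {poly C}) <= K.+1 - dg a)%N.
  have [->|/h] := eqVneq (g 0 a)@_m 0; first by rewrite size_poly0.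
  by rewrite hK; move: (size _) (dg a) => x y; lia.
(* A coefficient exceeds the bound for [K] only if it has size [K.+1 - dg a], so this row collects
   exactly the leading coefficients to be excluded. *)
pose top : 'rV_(rk 2) := \row_a if (dg a <= K)%N then tcoef (K - dg a) (g 0 a) else 0.
suff top0 : top = 0.
  move=> a m gm; have := h a m gm; rewrite hK leq_eqVlt => /orP[/eqP E|]; last by rewrite ltnS.
  have s0 : (0 < size (((g 0 a)@_m)%R : {poly C}))%N by rewrite size_poly_gt0.
  have dK : (dg a <= K)%N by move: E s0; move: (size _) (dg a) => x y; lia.
  have /rowP/(_ a) := top0; rewrite !mxE dK => /(congr1 (mcoeff m)).
  rewrite mcoeff_tcoef mcoeff0 => lc; case/negP: gm; rewrite -lead_coef_eq0 lead_coefE.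
  have -> : (size ((g 0 a)@_m : {poly C})).-1 = (K - dg a)%N.
    by move: E s0 dK; move: (size _) (dg a) => x y; lia.
  by rewrite lc.
have topd : top *m map_mx (@kappa C 2) (df 1) = 0.
  apply/rowP => b; rewrite !mxE; apply/mpolyP => m; rewrite mcoeff0 raddf_sum /=.
  have [dbK|Kdb] := leqP (dg b) K; last first.
    apply: big1 => a _; rewrite !mxE; case: ifP => daK; last by rewrite mul0r mcoeff0.
    by rewrite (red_eq0 (leq_ltn_trans daK Kdb)) rmorph0 mulr0 mcoeff0.
  have : (((g *m red 1) 0 b)@_m)`_(K - dg b) = 0.
    have [->|/bd hb] := eqVneq ((g *m red 1) 0 b)@_m 0; first by rewrite coef0.
    by rewrite nth_default //; move: hb; move: (size _) (dg b) => x y; lia.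
  rewrite mxE raddf_sum /= coef_sum => E; rewrite -[RHS]E.
  apply: eq_bigr => a _; rewrite !mxE.
  have [dab|dba] := ltnP (dg a) (dg b).
    by rewrite (red_eq0 dab) !rmorph0 !mulr0 !mcoeff0 coef0.
  case: ifP => daK.
    have -> : (K - dg b = (K - dg a) + (dg a - dg b))%N by move: (dg a) (dg b) dba daK => x y; lia.
    rewrite (@tcoef_mul _ _ _ _ _ _ (kappa (df 1 a b))) //.
      by move=> m'; rewrite -subSn //.
    by have := lead_red dba; rewrite mxE.
  have -> : g 0 a = 0.
    apply/mpolyP => m'; rewrite mcoeff0; apply/eqP; rewrite -size_poly_eq0 -leqn0.
    by apply: leq_trans (sz a m') _; rewrite leqn0 subn_eq0 ltnNge daK.
  by rewrite !mul0r !mcoeff0 coef0.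
pose T : 'rV[R]_(rk 2) := map_mx (@shiftX C 2) top.
have kT : killr 1 T = T.
  by apply/rowP => a; rewrite !mxE kill1E shiftXK.
have hT : homogr e.+1 (@dg 2) T.
  move=> a; rewrite mxE; apply: homog_rel_shiftX; rewrite mxE; case: ifP => _ m; last first.
    by rewrite mcoeff0 eqxx.
  by rewrite mcoeff_tcoef => nz; apply: hg; apply: contraNneq nz => ->; rewrite coef0.
(* Modulo [x_0] the complex is still exact at position 2, so [T] comes from position 3, whose basis
   has degree [e + 2], above the degree [e + 1] of [T]. *)
have : killr 1 (T *m df 1) = 0.
  rewrite killrM kT; have -> : killr 1 (df 1) = map_mx (@shiftX C 2) (map_mx (@kappa C 2) (df 1)).
    by apply/matrixP => a b; rewrite !mxE kill1E.
  by rewrite -map_mxM topd map_mx0.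
case/(acyclic_kill acy) => // u uP.
have T0 : T = 0.
  have : partr (pred1 e.+1) (@dg 2) (killr 1 (T - u *m df 2)) = 0.
    by rewrite uP partr0.
  rewrite partr_killr partrB (homogr_partrE hT) (partr_mul _ _ (@hdf 2)).
  rewrite (homogr_eq0 (j := e.+1) (dg := dg (i := 3)) (v := partr _ _ _)).
  - by rewrite mul0mx subr0 kT.
  - by move=> a; rewrite dg3.
  exact: homogr_partr.
apply/rowP => a; have /rowP/(_ a) := T0; rewrite !mxE => /(congr1 (@kappa C 2)).
by rewrite shiftXK rmorph0.
Qed.

End Supernatural.

Lemma poly_split (C : nzRingType) d (p q : {poly C}) :
  (size p <= d)%N -> p + 'X^d * q = 0 -> p = 0 /\ q = 0.
Proof.
move=> sp E; have q0 : q = 0.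
  apply/polyP => i; have /(congr1 (fun p : {poly C} => p`_(i + d))) := E.
  rewrite coefD [p`__]nth_default ?add0r; last by apply: leq_trans sp _; rewrite leq_addl.
  by rewrite coefXnM ltnNge leq_addl /= addnK !coef0.
by move: E; rewrite q0 mulr0 addr0.
Qed.

Lemma sum_neq0 (V : nmodType) (I : finType) (f : I -> V) :
  \sum_x f x != 0 -> exists x, f x != 0.
Proof.
case: (pickP (fun x => f x != 0)) => [x fx _|f0]; first by exists x.
by rewrite big1 ?eqxx // => x _; apply/eqP/negbFE/f0.
Qed.

Lemma sum_single (V : nmodType) (I : finType) (f : I -> V) x :
  (forall y, y != x -> f y = 0) -> \sum_y f y = f x.
Proof. by move=> f0; rewrite (bigD1 x) //= big1 ?addr0. Qed.

(** * Injectivity on first cohomology and partial sums of Betti numbers *)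

Section Supernatural.
Variable C : idomainType.
Local Notation R := {mpoly C[3]}.
Local Notation C' := {poly C}.
Local Notation R' := {mpoly C'[2]}.
Variables (rk : nat -> nat) (dg : forall i, 'I_(rk i) -> nat).
Variable (df : forall i, 'M[R]_(rk i.+1, rk i)).
Hypothesis acy : acyclic df.
Hypothesis hdf : forall i, homogm (@dg i.+1) (@dg i) (df i).
Variable e : nat.
Hypothesis dg0 : forall a : 'I_(rk 0), dg a = 0%N.
Hypothesis dg3 : forall a : 'I_(rk 3), dg a = e.+2.
Local Notation red := (theta_df df).
Local Notation N := e.+2.

Lemma mcoeff_tvarX d (f : R') m : (tvar C 2 ^+ d * f)@_m = 'X^d * f@_m.
Proof. by rewrite /tvar -rmorphXn /= mcoeffCM. Qed.

(** A Cech argument on the [t]-line. At a basis element of degree [l], exponents below [N - l]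
    belong to one chart, those from [N] on to the other, and the gap of length [l] carries the first
    cohomology. If the class of [V *m red 1] vanishes, both of its chart parts lift, so [V] is
    itself a sum of chart parts and has nothing in the gap. *)
Lemma cohomology_injective (V : 'rV[R']_(rk 2)) : homogr e.+1 (@dg 2) V ->
  (forall a m i, ((V 0 a)@_m)`_i != 0 -> (i < N <= i + dg a)%N) ->
  (forall b m i, (i < N <= i + dg b)%N -> (((V *m red 1) 0 b)@_m)`_i = 0) ->
  V = 0.
Proof.
move=> hV supp; have [U UV] : exists U, U = V *m red 1 by exists (V *m red 1).
rewrite -UV => van.
have hU : homogr e.+1 (@dg 1) U by rewrite UV; apply: homogr_mul hV; exact: red_homogm.
pose am : 'rV_(rk 1) := \row_b map_mpoly (take_poly (N - dg b)) (U 0 b).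
pose ap : 'rV_(rk 1) := \row_b map_mpoly (drop_poly N) (U 0 b).
have UE : U = am + tvar C 2 ^+ N *: ap.
  apply/rowP => b; rewrite !mxE; apply/mpolyP => m.
  rewrite mcoeffD mcoeff_tvarX !mcoeff_map_mpoly; apply/polyP => i.
  rewrite coefD coef_take_poly coefXnM coef_drop_poly.
  have [iN|Ni] := ltnP i N; last first.
    rewrite subnK // ifF ?add0r //; apply/negbTE; rewrite -leqNgt.
    by apply: leq_trans (leq_subr _ _) Ni.
  rewrite addr0; case: ltnP => // Nd; apply: van; rewrite iN.
  by move: (dg b) Nd => x; lia.
have ham : homogr e.+1 (@dg 1) am.
  move=> b m; rewrite mxE mcoeff_map_mpoly => nz; apply: hU.
  by apply: contraNneq nz => ->; rewrite raddf0.
have hap : homogr e.+1 (@dg 1) ap.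
  move=> b m; rewrite mxE mcoeff_map_mpoly => nz; apply: hU.
  by apply: contraNneq nz => ->; rewrite raddf0.
(* Since position 0 has degree 0, an entry of [red 0] from degree [l] has [t]-degree at most [l]. So
   [am *m red 0] stays below [t^N] and cannot cancel against the image of [ap]. *)
have sam c m : (size ((((am *m red 0) 0 c)@_m)%R : C') <= N)%N.
  rewrite mxE raddf_sum /=; apply: (big_ind (fun p : C' => (size p <= N)%N)).
  - by rewrite size_poly0.
  - by move=> p q sp sq; apply: leq_trans (size_polyD _ _) _; rewrite geq_max sp.
  move=> b _; rewrite mcoeffM; apply: (big_ind (fun p : C' => (size p <= N)%N)).
  - by rewrite size_poly0.
  - by move=> p q sp sq; apply: leq_trans (size_polyD _ _) _; rewrite geq_max sp.
  move=> k _; rewrite [am 0 b]mxE mcoeff_map_mpoly /=.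
  set p := take_poly _ _.
  have sp : (size p <= N - dg b)%N by exact: size_take_poly.
  have db : (dg (i := 0%N) c <= dg (i := 1%N) b)%N by rewrite dg0.
  have [_ [sq _]] := lead_red hdf db k.2; rewrite dg0 subn0 in sq.
  have [Nd|dN] := ltnP N (dg b).
    have -> : p = 0 by apply/eqP; rewrite -size_poly_eq0 -leqn0; apply: leq_trans sp _; lia.
    by rewrite mul0r size_poly0.
  apply: leq_trans (size_polyMleq _ _) _; move: sp sq.
  by move: (size _) (size _) (dg b) dN => x y z; lia.
have Ud : U *m red 0 = 0.
  by rewrite UV -mulmxA /theta_df -map_mxM (proj1 acy) map_mx0 mulmx0.
have split0 c m : ((am *m red 0) 0 c)@_m = 0 /\ ((ap *m red 0) 0 c)@_m = 0.
  have := congr1 (fun W : 'rV_(rk 0) => (W 0 c)@_m) Ud.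
  have addE (A B : 'rV[R']_(rk 0)) : ((A + tvar C 2 ^+ N *: B) 0 c)@_m =
      (A 0 c)@_m + 'X^N * (B 0 c)@_m by rewrite 2!mxE mcoeffD mcoeff_tvarX.
  rewrite /= UE mulmxDl -scalemxAl addE [in RHS]mxE mcoeff0.
  exact: poly_split (sam c m).
have amd : am *m red 0 = 0.
  by apply/rowP => c; apply/mpolyP => m; rewrite (proj1 (split0 c m)) mxE mcoeff0.
have apd : ap *m red 0 = 0.
  by apply/rowP => c; apply/mpolyP => m; rewrite (proj2 (split0 c m)) mxE mcoeff0.
have [g hg gP] := red_exact1 acy hdf dg3 ham amd.
have [g' hg' g'P] := red_exact1 acy hdf dg3 hap apd.
have VE : V = g + tvar C 2 ^+ N *: g'.
  apply/eqP; rewrite -subr_eq0; apply/eqP/(red_exact2 acy hdf dg3); last first.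
    by rewrite mulmxBl mulmxDl -scalemxAl -gP -g'P -UE UV subrr.
  move=> a m; rewrite !mxE mcoeffB mcoeffD mcoeff_tvarX => nz; apply/eqP.
  apply: contraNT nz => md.
  have z0 (W : 'rV[R']_(rk 2)) : homogr e.+1 (@dg 2) W -> (W 0 a)@_m = 0.
    by move=> hW; apply/eqP; apply: contraNT md => /hW ->.
  by rewrite !z0 // mulr0 addr0 subrr.
(* The part [g'] needs no bound, being multiplied by [t^N]; [g] must stay below the gap, which is
   the regularity of the preimage at [t = oo]. *)
have bg := bounded_preimage acy hdf dg3 hg _.
have {}bg : forall a m, (g 0 a)@_m != 0 -> (size (((g 0 a)@_m)%R : {poly C}) + dg a <= N)%N.
  apply: bg => b m; rewrite -gP mxE mcoeff_map_mpoly /= -size_poly_gt0.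
  have := size_take_poly (N - dg b) (U 0 b)@_m.
  have aux (x y z : nat) : (x <= z - y -> 0 < x -> x + y <= z)%N by lia.
  exact: aux.
apply/rowP => a; rewrite mxE; apply/mpolyP => m; rewrite mcoeff0; apply/polyP => i.
rewrite coef0; apply/eqP/negPn/negP => nz; have /andP[iN Ni] := supp a m i nz.
move: nz; rewrite VE !mxE mcoeffD mcoeff_tvarX coefD coefXnM iN addr0.
have [->|/bg sg] := eqVneq (g 0 a)@_m 0; first by rewrite coef0 eqxx.
by rewrite nth_default ?eqxx //; move: sg Ni; move: (size _) (dg a) => x y; lia.
Qed.

(* The basis of H^1(O(-1-l, e-l)) for l = dg a: monomials t^i X_0^s X_1^(e+1-l-s). *)
Definition coh_basis q (d : 'I_q -> nat) (P : pred nat) :=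
  [set x : 'I_q * 'I_N * 'I_N | [&& P (d x.1.1), (N <= x.1.2 + d x.1.1)%N & (x.2 + d x.1.1 < N)%N]].

(** For degree [l] there are [l] exponents of [t] in the gap and [N - l] exponents of [X_0]. *)
Lemma card_coh_basis q (d : 'I_q -> nat) (P : pred nat) : (forall l, P l -> l < N)%N ->
  #|coh_basis d P| = (\sum_(a | P (d a)) d a * (N - d a))%N.
Proof.
move=> PN; rewrite -sum1_card.
rewrite (eq_bigl (fun x : 'I_q * 'I_N * 'I_N => (P (d x.1.1) && (N <= x.1.2 + d x.1.1)%N) && (x.2 + d x.1.1 < N)%N)); last first.
  by move=> x; rewrite inE andbA.
rewrite -(pair_big_dep (fun y : 'I_q * 'I_N => P (d y.1) && (N <= y.2 + d y.1)%N)
  (fun (y : 'I_q * 'I_N) (s : 'I_N) => (s + d y.1 < N)%N) (fun _ _ => 1%N)) /=.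
rewrite -(pair_big_dep (fun a => P (d a)) (fun a (i : 'I_N) => (N <= i + d a)%N)
  (fun (a : 'I_q) (i : 'I_N) => (\sum_(s < N | (s + d a < N)%N) 1)%N)) /=.
apply: eq_bigr => a /PN da.
have cnt k (Q : pred nat) : (k <= N)%N -> (forall s : nat, (s < N)%N -> Q s = (s < k)%N) ->
   (\sum_(s < N | Q s) 1 = k)%N.
  move=> kN QE; rewrite (eq_bigl (fun s : 'I_N => (s < k)%N)) => [|s]; last exact: QE.
  by rewrite -(big_ord_widen _ (fun=> 1%N) kN) sum1_card card_ord.
rewrite (eq_bigr (fun=> (N - d a)%N)); last first.
  by move=> i _; apply: (cnt _ (fun s => (s + d a < N)%N)); lia.
rewrite sum_nat_cond_const; congr (_ * _)%N; rewrite -sum1dep_card.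
have E : (\sum_(i < N | (N <= i + d a)%N) 1 + \sum_(i < N | ~~ (N <= i + d a)%N) 1 = N)%N.
  rewrite -[RHS]card_ord -sum1_card.
  rewrite [RHS](bigID (fun i : 'I_N => (N <= i + d a)%N)) /=.
  by congr (_ + _)%N; apply: eq_bigl => i; rewrite ?inE.
have vE : (\sum_(i < N | ~~ (N <= i + d a)%N) 1 = N - d a)%N.
  by apply: (cnt _ (fun s => ~~ (N <= s + d a)%N)); lia.
apply/eqP; rewrite -(eqn_add2r (N - d a)) -{1}vE E subnKC //; exact: ltnW.
Qed.

Definition mon2 (l s : nat) : 'X_{1..2} :=
  [multinom (if val k == 0%N then s else e.+1 - l - s)%N | k < 2].

Lemma mdeg2 (m : 'X_{1..2}) : mdeg m = (m ord0 + m ord_max)%N.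
Proof. by rewrite mdegE big_ord_recl big_ord1; congr (_ + m _)%N; apply: val_inj. Qed.

Lemma mon2E l (m : 'X_{1..2}) : (mdeg m + l = e.+1)%N -> m = mon2 l (m ord0).
Proof.
rewrite mdeg2 => E; apply/mnmP => k; rewrite mnmE.
have [k0|k1] : k = ord0 \/ k = ord_max.
  by case: k => -[|[|k]] // h; [left|right]; apply: val_inj.
- by rewrite k0.
by rewrite k1 /=; lia.
Qed.

Lemma mdeg_mon2 l s : (s + l < N)%N -> (mdeg (mon2 l s) + l = e.+1)%N.
Proof. by rewrite mdeg2 !mnmE /=; lia. Qed.

Hypothesis min1 : forall a b, (df 1 a b)@_0%MM = 0.

Lemma minimal_eq0 a b : (dg (i := 2) a <= dg (i := 1%N) b)%N -> df 1 a b = 0.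
Proof.
move=> ab; apply/mpolyP => m; rewrite mcoeff0; apply/eqP/negPn/negP => nz.
have := hdf nz; have [m0|] := posnP (mdeg m); last by lia.
by move/eqP: m0 nz; rewrite mdeg_eq0 => /eqP ->; rewrite min1 eqxx.
Qed.

(** By minimality the cohomology of the summands of degree at most [j] in position 2 maps into that
    of the summands of degree less than [j] in position 1. The map is injective, so the ranks
    compare. *)
Lemma betti_partial_sums j : (j < N)%N ->
  (\sum_(a : 'I_(rk 2) | dg a <= j) dg a * (N - dg a) <=
   \sum_(b : 'I_(rk 1) | dg b < j) dg b * (N - dg b))%N.
Proof.
move=> jN.
rewrite -(@card_coh_basis _ _ (fun l => l <= j)%N); last by move=> l; lia.
rewrite -(@card_coh_basis _ _ (fun l => l < j)%N); last by move=> l; lia.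
set I2 := coh_basis _ _; set I1 := coh_basis _ _; rewrite leqNgt; apply/negP => lt12.
have xI (x : 'I_#|I2|) : [&& dg (enum_val x).1.1 <= j, N <= (enum_val x).1.2 + dg (enum_val x).1.1
    & (enum_val x).2 + dg (enum_val x).1.1 < N]%N.
  by move: (enum_valP x); rewrite in_set.
pose bas (x : 'I_(rk 2) * 'I_N * 'I_N) : 'rV[R']_(rk 2) :=
  (tvar C 2 ^+ x.1.2 * 'X_[mon2 (dg x.1.1) x.2]) *: delta_mx 0 x.1.1.
(* The matrix of the map on cohomology in the monomial bases; a kernel vector [y] is reassembled
   into a row [V] to which injectivity applies. *)
pose A := \matrix_(x < #|I2|, z < #|I1|)
  (((bas (enum_val x) *m red 1) 0 (enum_val z).1.1)
    @_(mon2 (dg (enum_val z).1.1) (enum_val z).2))`_((enum_val z).1.2).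
have [y y0 yA] := idomain_kernel A lt12.
pose V : 'rV[R']_(rk 2) := \sum_x (y 0 x)%:P%:MP *: bas (enum_val x).
have VE a m i : ((V 0 a)@_m)`_i =
    \sum_x y 0 x * (((bas (enum_val x)) 0 a)@_m)`_i.
  rewrite summxE raddf_sum coef_sum; apply: eq_bigr => x _.
  by rewrite mxE /= mcoeffCM coefCM.
have VdE b m i : (((V *m red 1) 0 b)@_m)`_i =
    \sum_x y 0 x * (((bas (enum_val x) *m red 1) 0 b)@_m)`_i.
  rewrite mulmx_suml summxE raddf_sum coef_sum; apply: eq_bigr => x _.
  by rewrite -scalemxAl; move: (bas (enum_val x) *m red 1) => W; rewrite mxE /= mcoeffCM coefCM.
have basE x a m i : (((bas x) 0 a)@_m)`_i =
    if [&& a == x.1.1, mon2 (dg x.1.1) x.2 == m & i == x.1.2] then 1 else 0.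
  rewrite mxE mxE eqxx /= mulr_natr; case: (a =P x.1.1) => _; last by rewrite mcoeff0 coef0.
  rewrite mulr1n mcoeff_tvarX mcoeffX mulr_natr; case: (_ =P m) => _; last by rewrite coef0.
  by rewrite mulr1n coefXn; case: eqP.
have hV : homogr e.+1 (@dg 2) V.
  move=> a m nz; have [i nzi] : exists i, ((V 0 a)@_m)`_i != 0.
    by exists (size (V 0 a)@_m).-1; rewrite -lead_coefE lead_coef_eq0.
  move: nzi; rewrite VE => /sum_neq0[x]; rewrite mulf_eq0 negb_or basE => /andP[_].
  case: ifP => [|_]; last by rewrite eqxx.
  case/and3P=> /eqP -> /eqP <- _ _; apply: mdeg_mon2.
  by case/and3P: (xI x).
have V0 : V = 0.
  apply: cohomology_injective => // [a m i|b m i iN].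
    rewrite VE => /sum_neq0[x]; rewrite mulf_eq0 negb_or basE => /andP[_].
    case: ifP => [|_]; last by rewrite eqxx.
    case/and3P=> /eqP -> _ /eqP -> _; rewrite ltn_ord /=.
    by case/and3P: (xI x).
  have [->|nz] := eqVneq ((V *m red 1) 0 b)@_m 0; first by rewrite coef0.
  have hm : (mdeg m + dg (i := 1%N) b = e.+1)%N.
    by apply: (homogr_mul (@red_homogm _ _ _ _ _ hdf 1) hV).
  (* Columns of degree at least [j] are not recorded in [A]: there the coordinate vanishes by
     minimality. The remaining ones vanish because [y *m A = 0]. *)
  have [jb|bj] := leqP j (dg b).
    case/negP: nz; suff -> : (V *m red 1) 0 b = 0 by rewrite mcoeff0.
    rewrite mxE big1 // => a _; have [aj|ja] := leqP (dg a) j.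
      by rewrite [red _ _ _]mxE (minimal_eq0 (leq_trans aj jb)) rmorph0 mulr0.
    suff -> : V 0 a = 0 by rewrite mul0r.
    apply/mpolyP => k; apply/polyP => l; rewrite VE mcoeff0 coef0 big1 // => x _.
    rewrite basE; case: eqP => [ax|_]; last by rewrite mulr0.
    by have := xI x; rewrite -ax leqNgt ja.
  have sN : (m ord0 < N)%N by move: hm; rewrite mdeg2; move: (dg b) => l; lia.
  have iN' : (i < N)%N by case/andP: iN.
  have zI : (b, Ordinal iN', Ordinal sN) \in I1.
    rewrite inE /= bj; case/andP: iN => _ -> /=.
    by move: hm; rewrite mdeg2; move: (dg b) => l; lia.
  have zE : (y *m A) 0 (enum_rank_in zI (b, Ordinal iN', Ordinal sN)) = 0.
    by rewrite yA mxE.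
  rewrite VdE -[RHS]zE [RHS]mxE; apply: eq_bigr => x _; rewrite [A _ _]mxE.
  by rewrite enum_rankK_in //= -(mon2E hm).
case/negP: y0; apply/eqP/rowP => x; rewrite mxE.
have V00 a m i : ((V 0 a)@_m)`_i = 0 by rewrite V0 mxE mcoeff0 coef0.
set a := (enum_val x).1.1; set m := mon2 (dg a) (enum_val x).2; set i := (enum_val x).1.2.
have bE : (((bas (enum_val x)) 0 a)@_m)`_i = 1 by rewrite basE !eqxx.
pose f x' := y 0 x' * (((bas (enum_val x')) 0 a)@_m)`_i.
have fx : f x = y 0 x by rewrite /f bE mulr1.
have f0 x' : x' != x -> f x' = 0.
  move=> nx; rewrite /f basE; case: ifP => [|_]; last by rewrite mulr0.
  case/and3P=> /eqP E1 /eqP/(congr1 (fun m : 'X_{1..2} => m ord0)).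
  rewrite !mnmE /= => E2 /eqP E3; case/negP: nx; rewrite -(inj_eq enum_val_inj).
  apply/eqP; move: E1 E2 E3; rewrite /a /i.
  case: (enum_val x) => -[a1 i1] s1; case: (enum_val x') => -[a' i'] s' /=.
  by move=> -> E2 E3; rewrite (val_inj E3) (val_inj E2).
have <- : \sum_x' f x' = y 0 x.
  by rewrite -fx; apply: sum_single.
exact: etrans (esym (VE a m i)) (V00 a m i).
Qed.

End Supernatural.

(** * Euler characteristics *)

Lemma card_mnm_le n B k : (k < B)%N ->
  #|[set m : 'X_{1..n < B} | (mdeg m <= k)%N]| = 'C(n + k, n).
Proof.
move=> kB; rewrite -card_partial_ord_partitions.
pose f (m : 'X_{1..n < B}) : n.-tuple 'I_k.+1 := [tuple inord (m i) | i < n].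
have le_mdeg (m : 'X_{1..n}) i : (m i <= mdeg m)%N.
  by rewrite mdegE (bigD1 i) //= leq_addr.
have fE (m : 'X_{1..n < B}) : (mdeg m <= k)%N -> forall i, tnth (f m) i = m i :> nat.
  by move=> mk i; rewrite tnth_mktuple inordK // ltnS (leq_trans (le_mdeg _ _)).
rewrite -(@card_in_imset _ _ f) => [|m m']; last first.
  rewrite !inE => /fE mE /fE m'E ff; apply/val_inj/mnmP => i.
  by rewrite -mE -m'E ff.
apply/eq_card => t; rewrite [in RHS]inE; apply/imsetP/idP => [[m] | tk].
  rewrite inE => mk ->; rewrite big_tuple (eq_bigr (fun i => m i)) => [|i _]; last exact: fE.
  by rewrite -mdegE.
have sE : mdeg [multinom (tnth t i : nat) | i < n] = (\sum_(i <- t) i)%N.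
  by rewrite mdegE big_tuple; apply: eq_bigr => i _; rewrite mnmE.
have mB : (mdeg [multinom (tnth t i : nat) | i < n] < B)%N.
  by rewrite sE; apply: leq_ltn_trans kB.
exists (BMultinom mB); first by rewrite inE /= sE.
apply: eq_from_tnth => i; apply: val_inj; rewrite /= fE /= ?sE //.
by rewrite mnmE.
Qed.

Lemma card_mnm_eq n B k : (k < B)%N ->
  #|[set m : 'X_{1..n.+1 < B} | mdeg m == k]| = 'C(n + k, n).
Proof.
move=> kB; have := card_mnm_le n.+1 kB.
have -> : [set m : 'X_{1..n.+1 < B} | (mdeg m <= k)%N] =
  [set m : 'X_{1..n.+1 < B} | mdeg m == k] :|: [set m : 'X_{1..n.+1 < B} | (mdeg m < k)%N].
  by apply/setP => m; rewrite !inE leq_eqVlt.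
rewrite cardsU (_ : _ :&: _ = set0) ?cards0 ?subn0; last first.
  by apply/setP => m; rewrite !inE; case: ltngtP.
case: k kB => [|k] kB.
  have -> : [set m : 'X_{1..n.+1 < B} | (mdeg m < 0)%N] = set0.
    by apply/setP => m; rewrite !inE.
  by rewrite cards0 !addn0 !binn.
rewrite -[#|[set m : 'X_{1..n.+1 < B} | (mdeg m < k.+1)%N]|]/#|[set m : 'X_{1..n.+1 < B} | (mdeg m <= k)%N]|.
rewrite (card_mnm_le n.+1 (ltnW kB)).
by rewrite (addSnnS n k) (addSn n k.+1) binS => E; lia.
Qed.

Section Euler.
Variables (C : idomainType) (n : nat).
Local Notation R := {mpoly C[n]}.
Variables (p : pred nat) (B : nat).
Hypothesis pB : forall j, p j -> (j < B)%N.

Section Coordinates.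
Variables (q : nat) (d : 'I_q -> nat).

(** The monomial [C]-basis of the part selected by [p]. The bound [B] makes the type of monomials
    finite and loses nothing, by [pB]. *)
Definition pbasis := [set x : 'I_q * 'X_{1..n < B} | p (mdeg x.2 + d x.1)].

Definition decode (w : 'rV[C]_#|pbasis|) : 'rV[R]_q :=
  \row_a \sum_(t < #|pbasis| | (enum_val t).1 == a) w 0 t *: 'X_[(enum_val t).2].

Definition encode (v : 'rV[R]_q) : 'rV[C]_#|pbasis| :=
  \row_(t < #|pbasis|) (v 0 (enum_val t).1)@_((enum_val t).2).

Lemma decodeK w : encode (decode w) = w.
Proof.
apply/rowP => t; rewrite mxE mxE raddf_sum /= (bigD1 t) //=.
rewrite mcoeffZ mcoeffX eqxx mulr1 big1 ?addr0 // => s /andP[/eqP st sn].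
rewrite mcoeffZ mcoeffX; case: eqP => [tm|_]; last by rewrite mulr0.
case/negP: sn; rewrite -(inj_eq enum_val_inj); apply/eqP.
by rewrite [LHS]surjective_pairing [RHS]surjective_pairing st (val_inj tm).
Qed.

Lemma partr_decode w : partr p d (decode w) = decode w.
Proof.
apply/rowP => a; rewrite mxE part_id // => m; rewrite mxE raddf_sum /=.
apply: contraR => npm; apply/eqP; apply: big1 => t /eqP ta.
rewrite mcoeffZ mcoeffX; case: eqP => [tm|_]; last by rewrite mulr0.
by have := enum_valP t; rewrite inE ta tm (negPf npm).
Qed.

Lemma encodeK v : decode (encode v) = partr p d v.
Proof.
rewrite -partr_decode; apply/rowP => a; rewrite mxE [RHS]mxE.
apply/mpolyP => m; rewrite !mcoeff_part; case: ifP => // pm.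
have mB : (mdeg m < B)%N by apply: leq_ltn_trans (pB pm); rewrite leq_addr.
have xP : (a, BMultinom mB) \in pbasis by rewrite inE.
pose t := enum_rank_in xP (a, BMultinom mB).
have tE : enum_val t = (a, BMultinom mB) by rewrite enum_rankK_in.
have := congr1 (fun w : 'rV_#|pbasis| => w 0 t) (decodeK (encode v)).
by rewrite /= ![encode _ 0 t]mxE tE.
Qed.

Lemma encode_partr v : encode (partr p d v) = encode v.
Proof. by rewrite -encodeK decodeK. Qed.

Lemma encodeD v v' : encode (v + v') = encode v + encode v'.
Proof. by apply/rowP => t; rewrite !mxE mcoeffD. Qed.

Lemma encodeZ c v : encode (c%:MP *: v) = c *: encode v.
Proof. by apply/rowP => t; rewrite !mxE mcoeffCM. Qed.

Lemma encode0 : encode 0 = 0.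
Proof. by apply/rowP => t; rewrite !mxE mcoeff0. Qed.

Lemma encode_sum (I : Type) (r : seq I) (P : pred I) F :
  encode (\sum_(i <- r | P i) F i) = \sum_(i <- r | P i) encode (F i).
Proof. exact: (big_morph _ encodeD encode0). Qed.

Lemma decodeZ c w : decode (c *: w) = c%:MP *: decode w.
Proof.
apply/rowP => a; rewrite !mxE mulr_sumr; apply: eq_bigr => t _.
by rewrite mxE mul_mpolyC scalerA.
Qed.

Lemma decode0 : decode 0 = 0.
Proof. by apply/rowP => a; rewrite !mxE big1 // => t _; rewrite mxE scale0r. Qed.

Lemma decodeD w w' : decode (w + w') = decode w + decode w'.
Proof.
apply/rowP => a; rewrite !mxE -big_split /=; apply: eq_bigr => t _.
by rewrite mxE scalerDl.
Qed.

Lemma decode_sum (I : Type) (r : seq I) (P : pred I) F :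
  decode (\sum_(i <- r | P i) F i) = \sum_(i <- r | P i) decode (F i).
Proof. exact: (big_morph _ decodeD decode0). Qed.

Lemma card_pbasis : #|pbasis| = (\sum_a #|[set m : 'X_{1..n < B} | p (mdeg m + d a)]|)%N.
Proof.
rewrite -sum1_card (eq_bigl (fun x : 'I_q * 'X_{1..n < B} => p (mdeg x.2 + d x.1)));
  last by move=> x; rewrite inE.
rewrite -(pair_big_dep xpredT (fun a (m : 'X_{1..n < B}) => p (mdeg m + d a)) (fun _ _ => 1%N)) /=.
by apply: eq_bigr => a _; rewrite -sum1dep_card.
Qed.

End Coordinates.

Variables (rk : nat -> nat) (dg : forall i, 'I_(rk i) -> nat).
Variable (df : forall i, 'M[R]_(rk i.+1, rk i)).
Hypothesis acy : acyclic df.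
Hypothesis hdf : forall i, homogm (@dg i.+1) (@dg i) (df i).

Definition pdim i := #|pbasis (@dg i)|.

Definition pdf i : 'M[C]_(pdim i.+1, pdim i) :=
  \matrix_t encode (@dg i) (decode (delta_mx 0 t) *m df i).

Lemma mul_pdf i w : w *m pdf i = encode (@dg i) (decode w *m df i).
Proof.
rewrite [w in RHS]row_sum_delta decode_sum mulmx_suml encode_sum mulmx_sum_row.
by apply: eq_bigr => t _; rewrite decodeZ -scalemxAl encodeZ rowK.
Qed.

Lemma encode_df i (y : 'rV_(rk i.+1)) :
  encode (@dg i) (y *m df i) = encode (@dg i.+1) y *m pdf i.
Proof.
by rewrite mul_pdf encodeK -(partr_mul _ _ (@hdf i)) encode_partr.
Qed.

Lemma pdf_dd i : pdf i.+1 *m pdf i = 0.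
Proof.
apply/row_matrixP => t; rewrite row_mul rowK row0 -encode_df -mulmxA (proj1 acy) mulmx0.
exact: encode0.
Qed.

Lemma pdf_exact i (v : 'rV_(pdim i.+1)) : v *m pdf i = 0 -> exists w, v = w *m pdf i.+1.
Proof.
rewrite mul_pdf => E; have : decode v *m df i = 0.
  by rewrite -[decode v]partr_decode -(partr_mul _ _ (@hdf i)) -encodeK E decode0.
case/(proj2 acy) => u uP; exists (encode (@dg i.+2) u).
by rewrite -encode_df -uP decodeK.
Qed.

(** The alternating sum of the [pdim i] is the rank of the cokernel of [pdf 0]; this additive form
    avoids natural subtraction. *)
Lemma euler_rank : rk 4 = 0%N ->
  (\rank (fmx (pdf 0)) + pdim 2 = pdim 1 + pdim 3)%N.
Proof.
move=> rk4; have n4 : pdim 4 = 0%N.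
  rewrite /pdim card_pbasis; move: (@dg 4); rewrite rk4 => d.
  by rewrite big_ord0.
have E0 := rank_exact (pdf_dd 0) (@pdf_exact 0).
have E1 := rank_exact (pdf_dd 1) (@pdf_exact 1).
have E2 := rank_exact (pdf_dd 2) (@pdf_exact 2).
have E3 : \rank (fmx (pdf 3)) = 0%N.
  by apply/eqP; rewrite -leqn0 -[X in (_ <= X)%N]n4; exact: rank_leq_row.
by rewrite E3 addn0 in E2; lia.
Qed.

(** Vanishing of the Euler characteristic only says that the cokernel has rank 0 over [C] in the
    selected degrees, hence the factor [c]. *)
Lemma euler_torsion : rk 4 = 0%N ->
  (pdim 0 + pdim 2 = pdim 1 + pdim 3)%N <->
  (forall z : 'rV_(rk 0), partr p (@dg 0) z = z ->
     exists2 c, c != 0 & exists y, c%:MP *: z = y *m df 0).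
Proof.
move=> /euler_rank E; split=> [E'|tor].
  have /rank_full_torsion rt : \rank (fmx (pdf 0)) = pdim 0 by lia.
  move=> z zp; have [c c0 [w wP]] := rt (encode (@dg 0) z).
  exists c => //; exists (decode w).
  rewrite -partr_decode -(partr_mul _ _ (@hdf 0)) -encodeK -mul_pdf -wP decodeZ encodeK zp //.
suff /rank_full_torsion : forall v : 'rV_(pdim 0), exists2 c, c != 0 & exists w, c *: v = w *m pdf 0 by lia.
move=> v; have [c c0 [y yP]] := tor (decode v) (partr_decode v).
exists c => //; exists (encode (@dg 1) y).
by rewrite -encode_df -yP encodeZ decodeK.
Qed.

Lemma euler_span E (u : 'I_E -> 'rV[R]_(rk 0)) : rk 4 = 0%N ->
  (forall v : 'rV_(rk 0), exists (c : 'I_E -> C) y,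
     partr p (@dg 0) (v - \sum_e (c e)%:MP *: u e - y *m df 0) = 0) ->
  (pdim 0 + pdim 2 <= pdim 1 + pdim 3 + E)%N.
Proof.
move=> /euler_rank Er span.
suff : (pdim 0 <= \rank (fmx (pdf 0)) + E)%N by lia.
pose U := \matrix_(e < E) encode (@dg 0) (u e).
have /mxrankS : (1%:M <= fmx (pdf 0) + fmx U)%MS.
  apply/row_subP => t; rewrite rowE mulmx1.
  have [c [y cyP]] := span (decode (delta_mx 0 t)).
  have : delta_mx 0 t = (\row_e c e) *m U + encode (@dg 1) y *m pdf 0.
    apply/eqP; rewrite -subr_eq0 opprD addrA -encode_df -[delta_mx 0 t]decodeK.
    have -> : (\row_e c e) *m U = encode (@dg 0) (\sum_e (c e)%:MP *: u e).
      rewrite mulmx_sum_row encode_sum; apply: eq_bigr => e _.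
      by rewrite encodeZ rowK mxE.
    have NE v : - encode (@dg 0) v = encode (@dg 0) (- v).
      by apply/rowP => s; rewrite !mxE mcoeffN.
    by rewrite !NE -!encodeD -encode_partr cyP encode0.
  move/(congr1 (@fmx _ _ _)); rewrite /fmx map_delta_mx => ->.
  rewrite map_mxD !map_mxM addrC; apply: addmx_sub_adds; exact: submxMl.
rewrite mxrank1 => /leq_trans; apply; apply: leq_trans (mxrank_adds_leqif _ _) _.
by rewrite leq_add2l rank_leq_row.
Qed.

End Euler.

(* Rank in degrees at most N of F_i over a polynomial ring in n variables, that is, in
   degree N over one in n + 1 variables. *)
Definition cdim n (rk : nat -> nat) (dg : forall i, 'I_(rk i) -> nat) i N :=
  (\sum_(a : 'I_(rk i) | dg i a <= N) 'C(n + (N - dg i a), n))%N.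

Lemma pdim_cdim m n (p : pred nat) B (rk : nat -> nat) (dg : forall i, 'I_(rk i) -> nat) i N :
  (forall d, (#|[set x : 'X_{1..m < B} | p (mdeg x + d)%N]| =
     if d <= N then 'C(n + (N - d), n) else 0)%N) ->
  pdim m p B dg i = cdim n dg i N.
Proof.
move=> E; rewrite /pdim card_pbasis /cdim [RHS]big_mkcond /=.
by apply: eq_bigr => a _; rewrite E.
Qed.

Lemma mcoeff0_theta (C : idomainType) n (f : {mpoly C[n.+1]}) :
  (theta_mor f)@_0%MM = (f@_0%MM)%:P.
Proof.
elim/mpoly_gen_ind: f => [c|i|f g Ef Eg|f g Ef Eg].
- by rewrite thetaC !mpolyCK.
- have [_ [_ _]] := lead_xup C i 0%MM; have [h _] := lead_xup C i 0%MM.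
  rewrite thetaX [in RHS]mcoeffX mnm1_eq0 polyC0; apply/eqP.
  by apply: contraT => /h; rewrite mdeg0.
- by rewrite rmorphD !mcoeffD /= Ef Eg polyCD.
by rewrite !rmorphM /= Ef Eg.
Qed.

(** * Reduction to three variables *)

Section Core.
Variables (rk : nat -> nat) (dg : forall i, 'I_(rk i) -> nat) (e : nat).
Hypothesis rk_ge4 : forall i, (4 <= i)%N -> rk i = 0%N.
Hypothesis dg0 : forall a : 'I_(rk 0), dg a = 0%N.
Hypothesis dg3 : forall a : 'I_(rk 3), dg a = e.+2.

Local Notation hdim := (cdim 2 dg).

Lemma hdimE k i :
  pdim 3 (pred1 i) i.+1 dg k = hdim k i.
Proof.
apply: pdim_cdim => d; case: leqP => [di|id]; last first.
  by apply/eqP; rewrite cards_eq0; apply/eqP/setP => m; rewrite !inE; apply/negbTE; lia.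
rewrite -(@card_mnm_eq 2 i.+1 (i - d)); last by lia.
by apply: eq_card => m; rewrite !inE; lia.
Qed.

(** If the cokernel is torsion in degree [i + 1], a nonzero multiple of each element of degree [i]
    is killed by all variables. There is no socle outside degree [e - 1], so that multiple is zero
    in the cokernel. *)
Lemma top_degree3 (C : idomainType) (df : forall i, 'M[{mpoly C[3]}]_(rk i.+1, rk i)) :
  acyclic df -> (forall i, homogm (@dg i.+1) (@dg i) (df i)) ->
  forall i, (i + 3 != e.+2)%N -> (hdim 0 i.+1 + hdim 2 i.+1 = hdim 1 i.+1 + hdim 3 i.+1)%N ->
  (hdim 0 i + hdim 2 i = hdim 1 i + hdim 3 i)%N.
Proof.
move=> acy hdf i ie.
have pB k : forall j, pred1 k j -> (j < k.+1)%N by move=> j /eqP ->.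
have ET k := euler_torsion (pB k) acy hdf (rk_ge4 (leqnn 4)).
rewrite -!hdimE => /ET tor; apply/ET => z zi.
have hz : homogr i (@dg 0) z by rewrite -zi; exact: homogr_partr.
have /fin_all_exists[c cP] (u : 'I_3) : exists c, c != 0 /\ exists y, c%:MP *: ('X_u *: z) = y *m df 0.
  have [c c0 yP] := tor ('X_u *: z) (homogr_partrE (homogr_scaleX hz)).
  by exists c.
pose d := \prod_u c u; have d0 : d != 0.
  by rewrite prodf_seq_neq0; apply/allP => u _; case: (cP u).
exists d => //; apply: (socle_degree acy hdf dg3 ie).
  move=> a m; rewrite mxE mcoeffCM => nz; apply: hz.
  by apply: contraNneq nz => ->; rewrite mulr0.
move=> u; have [_ [y yP]] := cP u; exists ((\prod_(u' | u' != u) c u')%:MP *: y).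
rewrite -scalemxAl -yP !scalerA; congr (_ *: _).
by rewrite /d (bigD1 u) //= mpolyCM; ring.
Qed.

(** The conclusion involves only ranks and degrees, so the induction on the number of variables may
    replace [C] by [C[t]] each time. *)
Lemma core_statement m (C : idomainType) (df : forall i, 'M[{mpoly C[m.+3]}]_(rk i.+1, rk i)) :
  acyclic df -> (forall i, homogm (@dg i.+1) (@dg i) (df i)) ->
  (forall a b, (df 1 a b)@_0%MM = 0) ->
  (forall j, (j < e.+2)%N ->
     (\sum_(a : 'I_(rk 2) | dg a <= j) dg a * (e.+2 - dg a) <=
      \sum_(b : 'I_(rk 1) | dg b < j) dg b * (e.+2 - dg b))%N) /\
  (forall i, (i + 3 != e.+2)%N ->
     (hdim 0 i.+1 + hdim 2 i.+1 = hdim 1 i.+1 + hdim 3 i.+1)%N ->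
     (hdim 0 i + hdim 2 i = hdim 1 i + hdim 3 i)%N).
Proof.
elim: m C df => [|m IHm] C df acy hdf min1.
  split=> [j je|]; last exact: (top_degree3 acy hdf).
  exact: (betti_partial_sums acy hdf dg0 dg3 min1).
apply: (IHm _ (theta_df df)).
- apply: red_acyclic acy hdf _; exact: rk_ge4.
- by move=> i; apply: red_homogm.
by move=> a b; rewrite mxE mcoeff0_theta min1 polyC0.
Qed.

End Core.

(** * Depth and mapping cones *)

Section Cone.
Variables (R : comNzRingType) (rk : nat -> nat) (df : forall i, 'M[R]_(rk i.+1, rk i)).
Variable s : R.

Definition cone_rk i := if i is i'.+1 then (rk i'.+1 + rk i')%N else rk 0.

Definition cone_df i : 'M[R]_(cone_rk i.+1, cone_rk i) :=
  match i with
  | 0 => col_mx (df 0) s%:M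
  | i'.+1 => block_mx (df i'.+1) 0 s%:M (- df i')
  end.

Lemma cone_acyclic : acyclic df ->
  (forall v : 'rV_(rk 0), (exists y, s *: v = y *m df 0) -> exists y, v = y *m df 0) ->
  acyclic cone_df.
Proof.
move=> [dd ex] reg; split.
  case=> [|i] /=.
    rewrite mul_block_col mul0mx addr0 dd mulNmx mul_scalar_mx mul_mx_scalar subrr.
    by rewrite col_mx0.
  rewrite mulmx_block !mul0mx !mulmx0 !addr0 !dd add0r.
  rewrite mul_scalar_mx mulNmx mul_mx_scalar subrr mulmxN mulNmx dd !oppr0.
  by apply/eqP; rewrite block_mx_eq0 !eqxx.
case=> [|i] /= v; rewrite -[v]hsubmxK.
  move: (lsubmx v) (rsubmx v) => x y; rewrite mul_row_col mul_mx_scalar => E.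
  have [|z zP] := reg y; first by exists (- x); rewrite mulNmx; apply/eqP; rewrite -addr_eq0 addrC E.
  have [|u uP] := ex 0 (x + s *: z).
    by rewrite mulmxDl -scalemxAl -zP.
  exists (row_mx u (- z)); rewrite mul_row_block mulmx0 add0r !mulNmx mulmxN opprK -zP.
  by rewrite mul_mx_scalar -uP addrK.
move: (lsubmx v) (rsubmx v) => x y; rewrite mul_row_block mulmx0 add0r mul_mx_scalar.
rewrite -[0]row_mx0 => /eq_row_mx[E1 /eqP]; rewrite mulmxN oppr_eq0 => /eqP/ex[z zP].
have [|u uP] := ex i.+1 (x + s *: z).
  by rewrite mulmxDl -scalemxAl -zP.
exists (row_mx u (- z)); rewrite mul_row_block mulmx0 add0r !mulNmx mulmxN opprK -zP.
by rewrite mul_mx_scalar -uP addrK.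
Qed.

End Cone.

Definition in_sub (R : comNzRingType) p q (A : 'M[R]_(p, q)) (s : seq R) (v : 'rV[R]_q) : Prop :=
  exists y (c : 'I_(size s) -> 'rV_q), v = y *m A + \sum_(i < size s) s`_i *: c i.

Lemma in_sub_col (R : comNzRingType) p q (A : 'M[R]_(p, q)) a s v :
  in_sub (col_mx A a%:M) s v <-> in_sub A (a :: s) v.
Proof.
split=> [[y [c ->]]|[y [c ->]]].
  exists (lsubmx y), (fun i => if unlift ord0 i is Some j then c j else rsubmx y).
  rewrite -{1}[y]hsubmxK mul_row_col mul_mx_scalar big_ord_recl unlift_none addrA.
  by congr (_ + _); apply: eq_bigr => i _; rewrite liftK.
exists (row_mx y (c ord0)), (fun i => c (lift ord0 i)).
by rewrite mul_row_col mul_mx_scalar big_ord_recl addrA.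
Qed.

Section Depth.
Variables (C : idomainType) (n : nat).
Local Notation R := {mpoly C[n]}.

Definition cterm p q (A : 'M[R]_(p, q)) : 'M[C]_(p, q) := map_mx (mcoeff 0%MM) A.

Lemma cterm_kill p q (A : 'M[R]_(p, q)) : killr n A = map_mx (@mpolyC n C) (cterm A).
Proof. by apply/matrixP => i j; rewrite !mxE kill_all. Qed.

Lemma ctermM p q r (A : 'M[R]_(p, q)) (B : 'M_(q, r)) : cterm (A *m B) = cterm A *m cterm B.
Proof. exact: map_mxM. Qed.

Lemma ctermC p q (A : 'M[C]_(p, q)) : cterm (map_mx (@mpolyC n C) A) = A.
Proof. by apply/matrixP => i j; rewrite !mxE mpolyCK. Qed.

Lemma cterm_inj p q (A : 'M[R]_(p, q)) : killr n A = 0 <-> cterm A = 0.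
Proof.
rewrite cterm_kill; split=> [|->]; last exact: map_mx0.
by move=> A0; rewrite -[cterm A]ctermC A0 /cterm map_mx0.
Qed.

(** After reduction to constant terms the cone on [a] splits into the complex and its shift, since
    [a] has no constant term. Exactness of the cone at position [i + 2] thus gives exactness of the
    complex at [i + 1], and each element of [s] gains one position over killing the [n]
    variables. *)
Lemma tor_exact (s : seq R) : forall (rk : nat -> nat) (df : forall i, 'M[R]_(rk i.+1, rk i)),
  acyclic df -> all (fun f => f@_0%MM == 0) s ->
  (forall i, (i < size s)%N -> forall v, in_sub (df 0) (take i s) (s`_i *: v) ->
     in_sub (df 0) (take i s) v) ->
  forall i, (n <= i + size s)%N -> forall v : 'rV_(rk i.+1),
    v *m cterm (df i) = 0 -> exists w, v = w *m cterm (df i.+1).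
Proof.
elim: s => [|a s IHs] rk df acy /=.
  move=> _ _ i; rewrite addn0 => ni v v0.
  have [] := @acyclic_kill _ _ _ _ acy n i (map_mx (@mpolyC n C) v) (leqnn n) ni.
    by rewrite cterm_inj ctermM ctermC.
  move=> u /cterm_inj; rewrite /cterm map_mxB => /eqP; rewrite subr_eq0 => /eqP.
  by rewrite -!/(cterm _) ctermC ctermM => ->; exists (cterm u).
move=> /andP[/eqP a0 s0] reg i ni v v0.
have acy' : acyclic (cone_df df a).
  apply: cone_acyclic => // w [y wy].
  have := reg 0%N isT w; rewrite take0 /= => -[|y' [c]].
    exists y, (fun _ => 0); rewrite big_ord0 addr0; exact: wy.
  by rewrite big_ord0 addr0 => ->; exists y'.
have ni' : (n <= i.+1 + size s)%N by lia.
have reg' j : (j < size s)%N -> forall w, in_sub (cone_df df a 0) (take j s) (s`_j *: w) ->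
     in_sub (cone_df df a 0) (take j s) w.
  by move=> js w /in_sub_col h; apply/in_sub_col; apply: (reg j.+1 js).
have bE (p q r t : nat) (A : 'M[R]_(p, q)) (B : 'M_(p, r)) (D : 'M_(t, q)) (E : 'M_(t, r)) :
  cterm (block_mx A B D E) = block_mx (cterm A) (cterm B) (cterm D) (cterm E) by exact: map_block_mx.
have aE p : cterm (a%:M : 'M_p) = 0.
  by apply/matrixP => x y; rewrite !mxE mcoeffMn a0 mul0rn.
have [|w] := IHs _ _ acy' s0 reg' i.+1 ni' (row_mx 0 v).
  rewrite [cone_df _ _ _]/= bE mul_row_block aE mulmx0 mul0mx addr0 mul0mx add0r.
  have -> : cterm (- df i) = - cterm (df i) by exact: map_mxN.
  by rewrite mulmxN v0 oppr0 row_mx0.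
rewrite [cone_df _ _ _]/= bE -[w]hsubmxK mul_row_block => /eq_row_mx[_].
have -> : cterm (0 : 'M[R]_(rk i.+3, rk i.+1)) = 0 by exact: map_mx0.
have -> : cterm (- df i.+1) = - cterm (df i.+1) by exact: map_mxN.
by rewrite mulmx0 add0r mulmxN -mulNmx => ->; exists (- rsubmx w).
Qed.

End Depth.

(** * Minimal resolutions *)

Lemma mulmxBB (R : pzRingType) m n p (A B : 'M[R]_(m, n)) (D E : 'M_(n, p)) :
  (A - B) *m (D - E) = A *m D - A *m E - (B *m D - B *m E).
Proof. by rewrite mulmxBl !mulmxBr. Qed.

Section Reduction.
Variables (R : pzRingType) (rk : nat -> nat).
Variable d : forall i, 'M[R]_(rk i.+1, rk i).
Variable h : forall i, 'M[R]_(rk i, rk i.+1).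
Variable g : forall i, 'M[R]_(rk i.+1, rk i).
Hypothesis dd : forall i, d i.+1 *m d i = 0.
Hypothesis hdh : forall i, h i *m d i *m h i = h i.
Hypothesis hh : forall i, h i *m h i.+1 = 0.

(** Gaussian elimination with fixed index sets. [h] is a partial inverse of [d], [red_a] and [red_b]
    project onto the basis elements to be deleted, [red_core] is a Schur complement, and the masks
    erase the deleted rows and columns. *)
Definition red_b i : 'M[R]_(rk i) := h i *m g i.
Definition red_a i : 'M[R]_(rk i) := if i is i'.+1 then g i' *m h i' else 0.
Definition red_mask i := 1%:M - red_a i - red_b i.
Definition red_core i := d i - d i *m h i *m d i.
Definition reduction i := red_mask i.+1 *m red_core i *m red_mask i.

Lemma core_h i : red_core i *m h i = 0.
Proof. by rewrite mulmxBl -!mulmxA [d i *m (h i *m _)]mulmxA -mulmxA [h i *m _]mulmxA hdh subrr. Qed.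

Lemma h_core i : h i *m red_core i = 0.
Proof. by rewrite mulmxBr !mulmxA hdh subrr. Qed.

Lemma core_b i : red_core i *m red_b i = 0.
Proof. by rewrite /red_b mulmxA core_h mul0mx. Qed.

Lemma a_core i : red_a i.+1 *m red_core i = 0.
Proof. by rewrite /red_a -mulmxA h_core mulmx0. Qed.

Lemma d_core i : d i.+1 *m red_core i = 0.
Proof. by rewrite mulmxBr !mulmxA dd !mul0mx subrr. Qed.

Lemma core_core i : red_core i.+1 *m red_core i = 0.
Proof. by rewrite {1}/red_core mulmxBl d_core sub0r -mulmxA d_core mulmx0 oppr0. Qed.

Lemma core_mask i : red_core i *m red_mask i = red_core i - red_core i *m red_a i.
Proof. by rewrite !mulmxBr mulmx1 core_b subr0. Qed.

Lemma mask_core i : red_mask i.+1 *m red_core i = red_core i - red_b i.+1 *m red_core i.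
Proof. by rewrite !mulmxBl mul1mx a_core subr0. Qed.

Lemma reduction_dd i : reduction i.+1 *m reduction i = 0.
Proof.
have E : red_core i.+1 *m red_mask i.+1 *m (red_mask i.+1 *m red_core i) = 0.
  rewrite mask_core core_mask mulmxBB core_core.
  rewrite mulmxA core_b mul0mx -mulmxA a_core mulmx0 -mulmxA [red_a _ *m (_ *m _)]mulmxA.
  by rewrite /red_a /red_b -!mulmxA [h i *m (h _ *m _)]mulmxA hh !mul0mx !mulmx0 !subr0.
transitivity (red_mask i.+2 *m (red_core i.+1 *m red_mask i.+1 *m
    (red_mask i.+1 *m red_core i)) *m red_mask i); first by rewrite /reduction !mulmxA.
by rewrite E mulmx0 mul0mx.
Qed.

(** The comparison map from the reduced complex back to the original one is [v |-> v - v d h], which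
    carries cycles to cycles. *)
Lemma reduction_kernel i (v : 'rV_(rk i.+1)) :
  v *m red_a i.+1 = 0 -> v *m red_b i.+1 = 0 -> v *m reduction i = 0 ->
  (v - v *m d i *m h i) *m d i = 0.
Proof.
move=> va vb; rewrite /reduction mulmxA mulmxA.
have -> : v *m red_mask i.+1 = v by rewrite !mulmxBr va vb mulmx1 !subr0.
have -> : (v - v *m d i *m h i) *m d i = v *m red_core i.
  by rewrite mulmxBl mulmxBr !mulmxA.
rewrite -mulmxA core_mask mulmxBr mulmxA.
case: i v va vb => [|i] v va vb; first by rewrite /red_a mulmx0 subr0.
move=> /eqP; rewrite subr_eq0 => /eqP E.
rewrite E; have : v *m red_core i.+1 *m (d i *m h i) = 0.
  rewrite -!mulmxA [red_core _ *m (_ *m _)]mulmxA.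
  have -> : red_core i.+1 *m d i = 0 by rewrite mulmxBl -!mulmxA dd !mulmx0 subrr.
  by rewrite mul0mx mulmx0.
have ad : red_a i.+1 *m (d i *m h i) = red_a i.+1.
  by rewrite /red_a -mulmxA [h i *m (_ *m _)]mulmxA hdh.
by move=> H; rewrite -ad mulmxA -E.
Qed.

Lemma reduction_image i (w : 'rV_(rk i.+1)) :
  w *m d i *m h i = 0 -> exists w', w *m d i *m red_mask i = w' *m reduction i.
Proof.
move=> wh; exists (w - w *m h i.+1 *m d i.+1).
rewrite /reduction mulmxA; congr (_ *m _); rewrite mask_core mulmxBr.
have wb : (w - w *m h i.+1 *m d i.+1) *m red_b i.+1 = 0.
  apply/eqP; rewrite mulmxBl subr_eq0; apply/eqP.
  by rewrite /red_b -{1}hdh !mulmxA.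
rewrite mulmxA wb mul0mx subr0 [RHS]mulmxBl -[w *m h _ *m d _ *m _]mulmxA d_core mulmx0 subr0.
by rewrite mulmxBr !mulmxA wh mul0mx subr0.
Qed.

Lemma reduction0 : reduction 0 = red_mask 1 *m (1%:M - d 0 *m h 0) *m d 0.
Proof.
rewrite /reduction -mulmxA core_mask /red_a mulmx0 subr0 -mulmxA.
by congr (_ *m _); rewrite mulmxBl mul1mx.
Qed.

End Reduction.

Section ReductionRank.
Variables (k : fieldType) (rk : nat -> nat).
Variable d : forall i, 'M[k]_(rk i.+1, rk i).
Variable h : forall i, 'M[k]_(rk i, rk i.+1).
Variable g : forall i, 'M[k]_(rk i.+1, rk i).
Hypothesis dd : forall i, d i.+1 *m d i = 0.
Hypothesis hdh : forall i, h i *m d i *m h i = h i.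

(** The differential is [red_core] plus [d h d]. The row spaces are independent because [h] kills
    the first summand on the right, the second has the rank of [h], and masking [red_core] loses no
    rank. *)
Lemma rank_reduction i : (\rank (reduction d h g i) + \rank (h i) = \rank (d i))%N.
Proof.
have rh : \rank (h i) = \rank (d i *m h i *m d i).
  apply/eqP; rewrite eqn_leq; apply/andP; split.
    have {1}-> : h i = h i *m (d i *m h i *m d i) *m h i by rewrite !mulmxA !hdh.
    exact: leq_trans (mxrankM_maxl _ _) (mxrankM_maxr _ _).
  exact: leq_trans (mxrankM_maxl _ _) (mxrankM_maxr _ _).
have rc : \rank (reduction d h g i) = \rank (red_core d h i).
  apply/eqP; rewrite eqn_leq; apply/andP; split.
    exact: leq_trans (mxrankM_maxl _ _) (mxrankM_maxr _ _).
  apply: (@leq_trans (\rank (red_mask h g i.+1 *m red_core d h i))).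
    have {1}-> : red_core d h i = (1%:M - h i.+1 *m d i.+1) *m (red_mask h g i.+1 *m red_core d h i).
      rewrite mulmxBl mul1mx mask_core //.
      rewrite [X in _ - X](_ : _ = - (red_b h g i.+1 *m red_core d h i)); first by rewrite opprK subrK.
      rewrite mulmxBr -mulmxA (d_core h dd) mulmx0 sub0r; congr (- _).
      by rewrite /red_b !mulmxA hdh.
    exact: mxrankM_maxr.
  rewrite /reduction; case: i {rh} => [|i].
    by rewrite -[in leqRHS]mulmxA core_mask // /red_a mulmx0 subr0.
  have {1}-> : red_mask h g i.+2 *m red_core d h i.+1 =
    (red_mask h g i.+2 *m red_core d h i.+1 *m red_mask h g i.+1) *m (1%:M - d i *m h i).
    rewrite -!mulmxA; congr (_ *m _); rewrite mulmxA core_mask // mulmxBB !mulmx1.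
    have -> : red_core d h i.+1 *m (d i *m h i) = 0.
      rewrite mulmxA mulmxBl -[d i.+1 *m _ *m _ *m _]mulmxA dd mulmx0 subr0 mul0mx //.
    rewrite -mulmxA [red_a _ _ _ *m _]mulmxA.
    have -> : red_a h g i.+1 *m d i *m h i = red_a h g i.+1.
      by rewrite /red_a -!mulmxA [h i *m (_ *m _)]mulmxA hdh.
    by rewrite subrr !subr0.
  exact: mxrankM_maxl.
rewrite rc rh -mxrank_disjoint_sum; last first.
  apply/eqP; rewrite -submx0; apply/rV_subP => v; rewrite sub_capmx => /andP[].
  move=> /submxP[x ->] /submxP[y E].
  have : x *m red_core d h i *m h i = 0 by rewrite -mulmxA core_h // mulmx0.
  rewrite E -mulmxA.
  have -> : d i *m h i *m d i *m h i = d i *m h i.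
    by rewrite -!mulmxA [h i *m (_ *m _)]mulmxA hdh.
  by move=> E0; rewrite [X in (X <= _)%MS]mulmxA E0 mul0mx sub0mx.
apply/eqP; rewrite eqn_leq; apply/andP; split; apply: mxrankS; last first.
  rewrite -[X in (X <= _)%MS](subrK (d i *m h i *m d i)); exact: addmx_sub_adds.
rewrite addsmx_sub submxMl andbT.
by rewrite /red_core -{1}[d i]mul1mx -mulmxBl submxMl.
Qed.

End ReductionRank.

Section ReductionProj.
Variables (R : pzRingType) (rk : nat -> nat).
Variable d : forall i, 'M[R]_(rk i.+1, rk i).
Variable h : forall i, 'M[R]_(rk i, rk i.+1).
Variable g : forall i, 'M[R]_(rk i.+1, rk i).
Variable P : forall i, 'M[R]_(rk i).
Hypothesis PP : forall i, P i *m P i = P i.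
Hypothesis Pd : forall i, P i.+1 *m d i = d i *m P i.
Hypothesis Ph : forall i, P i *m h i = h i *m P i.+1.
Hypothesis Pg : forall i, P i.+1 *m g i = g i *m P i.

(** Elimination commutes with projections that commute with all the data. With the projections onto
    one degree, ranks can be followed degree by degree. *)
Lemma reduction_proj i :
  reduction (fun i => P i.+1 *m d i) (fun i => P i *m h i) (fun i => P i.+1 *m g i) i =
  P i.+1 *m reduction d h g i.
Proof.
have Eb j : red_b (fun i => P i *m h i) (fun i => P i.+1 *m g i) j = P j *m red_b h g j.
  by rewrite /red_b Ph -mulmxA [P j.+1 *m _]mulmxA PP mulmxA -Ph mulmxA.
have Ea j : red_a (fun i => P i *m h i) (fun i => P i.+1 *m g i) j = P j *m red_a h g j.
  case: j => [|j]; first by rewrite /red_a mulmx0.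
  by rewrite /red_a Pg -mulmxA [P j *m _]mulmxA PP mulmxA -Pg mulmxA.
have Ec j : red_core (fun i => P i.+1 *m d i) (fun i => P i *m h i) j = P j.+1 *m red_core d h j.
  rewrite /red_core mulmxBr; congr (_ - _).
  rewrite Ph -!mulmxA [P j.+1 *m (P j.+1 *m _)]mulmxA PP [h j *m (P _ *m _)]mulmxA -Ph.
  by rewrite -mulmxA [d j *m (P j *m _)]mulmxA -Pd -mulmxA [P j.+1 *m (P _ *m _)]mulmxA PP.
have Pa j : P j *m red_a h g j = red_a h g j *m P j.
  by case: j => [|j]; rewrite /red_a ?mulmx0 ?mul0mx // mulmxA Pg -!mulmxA Ph.
have Pb j : P j *m red_b h g j = red_b h g j *m P j.
  by rewrite /red_b mulmxA Ph -!mulmxA Pg.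
have Pm j : P j *m red_mask h g j = red_mask h g j *m P j.
  by rewrite /red_mask !mulmxBr !mulmxBl mulmx1 mul1mx Pa Pb.
have Pc j : P j.+1 *m red_core d h j = red_core d h j *m P j.
  by rewrite /red_core mulmxBr mulmxBl Pd !mulmxA Pd -!mulmxA [P j *m _]mulmxA Ph -mulmxA Pd.
have Em j : P j *m red_mask (fun i => P i *m h i) (fun i => P i.+1 *m g i) j = P j *m red_mask h g j.
  by rewrite /red_mask !mulmxBr Ea Eb !mulmxA PP.
have Em' j : red_mask (fun i => P i *m h i) (fun i => P i.+1 *m g i) j *m P j = P j *m red_mask h g j.
  rewrite Pm /red_mask !mulmxBl Ea Eb -[P j *m _ *m _]mulmxA -[P j *m red_b h g j *m _]mulmxA.
  by rewrite -Pa -Pb !mulmxA !PP.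
have Q : P i.+1 *m red_mask h g i.+1 *m red_core d h i = red_mask h g i.+1 *m red_core d h i *m P i.
  by rewrite Pm -mulmxA Pc mulmxA.
by rewrite /reduction Ec mulmxA Em' Q -mulmxA Em mulmxA -Q !mulmxA.
Qed.
End ReductionProj.

Lemma delta_mulmx_delta (R : comPzRingType) m n p q (b : 'I_m) (a : 'I_n) (D : 'M[R]_(n, p)) (b' : 'I_p) (a' : 'I_q) :
  delta_mx b a *m D *m delta_mx b' a' = D a b' *: delta_mx b a'.
Proof.
apply/matrixP => x y; rewrite !mxE (bigD1 b') //= big1 ?addr0 => [|z zb]; last first.
  by rewrite [X in _ * X]mxE (negPf zb) mulr0.
rewrite !mxE (bigD1 a) //= big1 ?addr0 => [|z za]; last by rewrite mxE (negPf za) andbF mul0r.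
rewrite !mxE !eqxx andbT /=; by case: (x == b); case: (y == a'); rewrite ?(mul1r, mul0r, mulr1, mulr0).
Qed.

Section Elimination.
Variables (k : fieldType) (n : nat).
Local Notation R := {mpoly k[n]}.

Definition homogz (z : int) (f : R) := forall m, f@_m != 0 -> (mdeg m)%:Z = z.

Lemma homog_intP z (f : R) : homog_int z f -> homogz z f.
Proof.
case: z => [d|d] /=; last by move=> -> m; rewrite mcoeff0 eqxx.
by move/dhomogP => hf m fm; rewrite hf // mcoeff_msupp.
Qed.

Lemma homogz_const z (f : R) : homogz z f -> f@_0%MM != 0 -> z = 0 /\ f = (f@_0%MM)%:MP.
Proof.
move=> hf f0; have z0 : z = 0 by rewrite -(hf _ f0) mdeg0.
split=> //; apply/mpolyP => m; have [->|m0] := eqVneq m 0%MM; first by rewrite mpolyCK.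
rewrite mcoeffC (negPf m0) mulr0; apply/eqP; apply: contraNT m0 => /hf.
by rewrite z0 -mdeg_eq0 => /eqP.
Qed.

Variables (rk : nat -> nat) (deg : forall i, 'I_(rk i) -> int).

Definition dpiece i (j : int) : 'M[k]_(rk i) := diag_mx (\row_a (deg a == j)%:R).

Lemma dpieceK i j : dpiece i j *m dpiece i j = dpiece i j.
Proof.
rewrite /dpiece mulmx_diag; congr diag_mx; apply/rowP => a; rewrite !mxE.
by case: (_ == _); rewrite ?mulr1 ?mulr0.
Qed.

Lemma dpiece_comm i i' j (D : 'M[k]_(rk i', rk i)) :
  (forall a b, D a b != 0 -> deg a = deg b) -> dpiece i' j *m D = D *m dpiece i j.
Proof.
move=> hD; apply/matrixP => a b; rewrite mul_diag_mx mul_mx_diag !mxE mulrC.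
by have [->|/hD ->] := eqVneq (D a b) 0; rewrite ?mul0r.
Qed.

Variables (q : nat) (N : 'M[R]_(q, rk 0)) (bt : nat -> int -> nat).

Definition supported i (A : {set 'I_(rk i)}) (v : 'rV[R]_(rk i)) := forall a, a \notin A -> v 0 a = 0.

Definition drank (df : forall i, 'M[R]_(rk i.+1, rk i)) i j := \rank (dpiece i.+1 j *m cterm (df i)).
Definition drank_out df i j := if i is i'.+1 then drank df i' j else 0%N.

(* A i indexes a part of the basis of F_i; the complex spanned by these parts resolves
   coker N and computes the Betti numbers bt. *)
Record subresolution (A : forall i, {set 'I_(rk i)}) (df : forall i, 'M[R]_(rk i.+1, rk i)) : Prop :=
  Subresolution {
  sub_homog : forall i a b, homogz (deg (i := i.+1) a - deg (i := i) b) (df i a b);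
  sub_dd : forall i, df i.+1 *m df i = 0;
  sub_off : forall i a b, ~~ ((a \in A i.+1) && (b \in A i)) -> df i a b = 0;
  sub_exact : forall i v, supported (A i.+1) v -> v *m df i = 0 -> exists w, v = w *m df i.+1;
  sub_exact0 : forall v, supported (A 0%N) v -> (exists y, v = y *m N) <-> (exists w, v = w *m df 0%N);
  sub_surj : forall v, exists2 v', supported (A 0%N) v' & exists y, v - v' = y *m N;
  sub_betti : forall i j, (bt i j + drank df i j + drank_out df i j =
    #|[set a in A i | deg a == j]|)%N
}.

Section Step.
Variables (A : forall i, {set 'I_(rk i)}) (df : forall i, 'M[R]_(rk i.+1, rk i)).
Hypothesis sub : subresolution A df.
Variable X : forall i, option ('I_(rk i) * 'I_(rk i.+1)).
Hypothesis XA : forall i b a, X i = Some (b, a) -> (df i a b)@_0%MM != 0.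
Hypothesis X1 : forall i i', X i != None -> X i' != None -> i = i'.

(** [X] marks at most one unit entry in the whole complex; a family of options keeps the formulas
    uniform in [i]. *)
Definition pivot_h i : 'M[k]_(rk i, rk i.+1) :=
  if X i is Some (b, a) then ((df i a b)@_0%MM)^-1 *: delta_mx b a else 0.
Definition pivot_g i : 'M[k]_(rk i.+1, rk i) :=
  if X i is Some (b, a) then (df i a b)@_0%MM *: delta_mx a b else 0.
Definition pivots_b i : {set 'I_(rk i)} := if X i is Some (b, a) then [set b] else set0.
Definition pivots_a i : {set 'I_(rk i)} :=
  match i with
  | 0 => set0
  | i'.+1 => if X i' is Some (b, a) then [set a] else set0
  end.
Definition step_A i := A i :\: (pivots_a i :|: pivots_b i).
Let h i := map_mx (@mpolyC n k) (pivot_h i).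
Let g i := map_mx (@mpolyC n k) (pivot_g i).
Definition step_df := reduction df h g.

Lemma XE i b a : X i = Some (b, a) ->
  [/\ a \in A i.+1, b \in A i, deg a = deg b & df i a b = ((df i a b)@_0%MM)%:MP].
Proof.
move=> Xi; have c0 := XA Xi; have [/eqP] := homogz_const (@sub_homog _ _ sub i a b) c0.
rewrite subr_eq0 => /eqP dab dE.
have : (a \in A i.+1) && (b \in A i).
  by apply: contraNT c0 => /(sub_off sub) ->; rewrite mcoeff0.
by case/andP.
Qed.

Lemma step_hdh i : h i *m df i *m h i = h i.
Proof.
rewrite /h /pivot_h; case Xi: (X i) => [[b a]|]; last by rewrite map_mx0 !mul0mx.
have [_ _ _ dE] := XE Xi; have c0 := XA Xi.
rewrite map_mxZ map_delta_mx -!scalemxAl -scalemxAr delta_mulmx_delta dE mcoeffC eqxx mulr1.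
by rewrite !scalerA -!mpolyCM -mulrA mulVf // mulr1.
Qed.

Lemma step_hh i : h i *m h i.+1 = 0.
Proof.
rewrite /h /pivot_h; case Xi: (X i) => [[b a]|]; last by rewrite map_mx0 mul0mx.
case Xi': (X i.+1) => [[b' a']|]; last by rewrite map_mx0 mulmx0.
by have := @X1 i i.+1; rewrite Xi Xi' => /(_ isT isT) /n_Sn.
Qed.

Definition proj_on l (B : {set 'I_l}) : 'M[R]_l := diag_mx (\row_x (x \in B)%:R).

Lemma proj_on0 l : proj_on (set0 : {set 'I_l}) = 0.
Proof. by apply/matrixP => x y; rewrite !mxE inE mul0rn. Qed.

Lemma proj_on1 l (b : 'I_l) : proj_on [set b] = delta_mx b b.
Proof.
by apply/matrixP => x y; rewrite !mxE inE (eq_sym y); case: eqVneq => [->|_]; case: eqVneq.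
Qed.

Lemma mul_proj_on l (B : {set 'I_l}) (v : 'rV_l) x : (v *m proj_on B) 0 x = v 0 x * (x \in B)%:R.
Proof. by rewrite mul_mx_diag !mxE. Qed.

Lemma step_b i : red_b h g i = proj_on (pivots_b i).
Proof.
rewrite /red_b -map_mxM /pivot_h /pivot_g /pivots_b; case Xi: (X i) => [[b a]|]; last first.
  by rewrite mul0mx map_mx0 proj_on0.
rewrite -scalemxAl -scalemxAr scalerA mulVf ?(XA Xi) // scale1r mul_delta_mx map_delta_mx.
by rewrite proj_on1.
Qed.

Lemma step_a i : red_a h g i = proj_on (pivots_a i).
Proof.
case: i => [|i]; first by rewrite proj_on0.
rewrite /red_a -map_mxM /pivot_h /pivot_g /pivots_a; case Xi: (X i) => [[b a]|]; last first.
  by rewrite mul0mx map_mx0 proj_on0.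
rewrite -scalemxAl -scalemxAr scalerA mulfV ?(XA Xi) // scale1r mul_delta_mx map_delta_mx.
by rewrite proj_on1.
Qed.

Lemma pivots_disj i x : x \in pivots_a i -> x \in pivots_b i = false.
Proof.
case: i x => [|i] x; rewrite /pivots_a /pivots_b ?inE //.
case Xi: (X i) => [[b a]|]; rewrite ?inE // => _.
case Xi': (X i.+1) => [[b' a']|]; rewrite ?inE //.
by have := @X1 i i.+1; rewrite Xi Xi' => /(_ isT isT) /n_Sn.
Qed.

Lemma step_mask i : red_mask h g i = proj_on (~: (pivots_a i :|: pivots_b i)).
Proof.
apply/matrixP => x y; rewrite /red_mask step_a step_b !mxE !inE.
case: eqVneq => [_|_] /=; last by rewrite !subr0.
case xa: (x \in pivots_a i) => /=; first by rewrite (pivots_disj xa) /= subr0 subrr.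
by case: (x \in pivots_b i); rewrite /= !(subr0, subrr).
Qed.

Lemma step_core i x y : red_core df h i x y =
  if X i is Some (b, a) then df i x y - (((df i a b)@_0%MM)^-1)%:MP * (df i x b * df i a y) else df i x y.
Proof.
rewrite /red_core /h /pivot_h; case: (X i) => [[b a]|]; last first.
  by rewrite map_mx0 mulmx0 mul0mx subr0.
rewrite map_mxZ map_delta_mx -scalemxAr -scalemxAl !mxE; congr (_ - _ * _).
rewrite (bigD1 a) //= big1 ?addr0 => [|z za]; last first.
  rewrite !mxE big1 ?mul0r // => t _; by rewrite mxE (negPf za) andbF mulr0.
rewrite !mxE (bigD1 b) //= big1 ?addr0 => [|z zb]; last by rewrite mxE (negPf zb) mulr0.
by rewrite mxE !eqxx mulr1.
Qed.

Lemma step_dfE i x y : step_df i x y =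
  if (x \in step_A i.+1) && (y \in step_A i) then red_core df h i x y else 0.
Proof.
rewrite /step_df /reduction !step_mask.
have -> (D : 'M[R]_(rk i.+1, rk i)) u v : (diag_mx u *m D *m diag_mx v) x y = u 0 x * D x y * v 0 y.
  by rewrite mul_mx_diag mul_diag_mx !mxE.
rewrite [(\row__ _) 0 x]mxE [(\row__ _) 0 y]mxE !in_setC.
have cA : red_core df h i x y != 0 -> (x \in A i.+1) && (y \in A i).
  apply: contraR; rewrite negb_and => /orP[] xA; rewrite step_core.
    have df0 z : df i x z = 0 by apply: (sub_off sub); rewrite (negPf xA).
    by case: (X i) => [[b a]|]; rewrite !df0 // mul0r mulr0 subr0.
  have df0 z : df i z y = 0 by apply: (sub_off sub); rewrite (negPf xA) andbF.
  by case: (X i) => [[b a]|]; rewrite !df0 // !mulr0 subr0.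
have [->|/cA/andP[xA yA]] := eqVneq (red_core df h i x y) 0; first by rewrite mulr0 mul0r if_same.
rewrite !in_setD xA yA !andbT.
by case: (x \in _); case: (y \in _); rewrite /= ?(mul0r, mulr0, mulr1, mul1r).
Qed.

Lemma supportedD i (B : {set 'I_(rk i)}) u v : supported B u -> supported B v -> supported B (u + v).
Proof. by move=> uB vB a aB; rewrite mxE uB // vB // addr0. Qed.

Lemma supportedN i (B : {set 'I_(rk i)}) u : supported B u -> supported B (- u).
Proof. by move=> uB a aB; rewrite mxE uB // oppr0. Qed.

Lemma supported_df i (w : 'rV_(rk i.+1)) : supported (A i) (w *m df i).
Proof.
move=> a aA; rewrite mxE big1 // => b _; rewrite (sub_off sub) ?mulr0 //.
by rewrite (negPf aA) andbF.
Qed.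

Lemma supported_h i (w : 'rV_(rk i)) : supported (A i.+1) (w *m h i).
Proof.
move=> x xA; rewrite /h /pivot_h; case Xi: (X i) => [[b a]|]; last first.
  by rewrite map_mx0 mulmx0 mxE.
have [aA _ _ _] := XE Xi; rewrite map_mxZ map_delta_mx mxE big1 // => z _.
rewrite !mxE; case: (eqVneq x a) => [xa|]; first by move: xA; rewrite xa aA.
by rewrite andbF !mulr0.
Qed.

Lemma step_supported i v : supported (step_A i) v ->
  [/\ supported (A i) v, v *m red_a h g i = 0 & v *m red_b h g i = 0].
Proof.
move=> vs; split; first by move=> a aA; apply: vs; rewrite inE (negPf aA) andbF.
all: rewrite ?step_a ?step_b; apply/rowP => x; rewrite mul_proj_on [RHS]mxE.
all: case xp: (x \in _); rewrite ?mulr0 // vs ?mul0r // !inE xp ?orbT //.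
Qed.

Lemma step_supported_iff i v : supported (A i) v -> v *m red_a h g i = 0 -> v *m red_b h g i = 0 ->
  supported (step_A i) v.
Proof.
move=> vA va vb x; rewrite !inE negb_and negbK => /orP[|]; last exact: vA.
move: va vb; rewrite step_a step_b => /rowP/(_ x) + /rowP/(_ x).
rewrite !mul_proj_on !mxE => va vb.
by case/orP => xp; [move: va | move: vb]; rewrite xp mulr1.
Qed.

Lemma step_hgh i : h i *m g i *m h i = h i.
Proof.
rewrite -[h i *m g i]/(red_b h g i) step_b /h /pivot_h /pivots_b; case Xi: (X i) => [[b a]|]; last first.
  by rewrite map_mx0 mulmx0.
by rewrite proj_on1 map_mxZ map_delta_mx -scalemxAr mul_delta_mx.
Qed.

Lemma h_mask i : h i *m red_mask h g i.+1 = 0.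
Proof.
rewrite /red_mask !mulmxBr mulmx1 /red_a mulmxA step_hgh subrr sub0r.
by rewrite /red_b mulmxA step_hh mul0mx oppr0.
Qed.

Lemma step_exact i v : supported (step_A i.+1) v -> v *m step_df i = 0 ->
  exists w, v = w *m step_df i.+1.
Proof.
move=> /step_supported[vA va vb] v0.
have [|w wE] := sub_exact sub _ (reduction_kernel (sub_dd sub) step_hdh va vb v0).
  by apply: supportedD => //; apply: supportedN; exact: supported_h.
have vh : v *m h i.+1 = 0.
  by rewrite -step_hgh mulmxA -[h i.+1 *m _]/(red_b h g i.+1) vb mul0mx.
have [|w' w'E] := @reduction_image _ _ _ _ g (sub_dd sub) step_hdh _ w.
  by rewrite -wE mulmxBl vh -mulmxA step_hh mulmx0 subrr.
exists w'; rewrite -[RHS]w'E -wE mulmxBl -mulmxA h_mask mulmx0 subr0.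
by rewrite /red_mask !mulmxBr mulmx1 va vb !subr0.
Qed.

Lemma step_exact0 v : supported (step_A 0) v ->
  (exists y, v = y *m N) <-> (exists w, v = w *m step_df 0).
Proof.
move=> /step_supported[vA va vb]; split.
  move/(sub_exact0 sub vA) => [w wE].
  have vh : v *m h 0 = 0.
    by rewrite -step_hgh mulmxA -[h 0 *m _]/(red_b h g 0) vb mul0mx.
  have [|w' w'E] := @reduction_image _ _ _ _ g (sub_dd sub) step_hdh _ w.
    by rewrite -wE vh.
  exists w'; rewrite -[RHS]w'E -wE.
  by rewrite /red_mask !mulmxBr mulmx1 va vb !subr0.
move=> [w wE]; apply/(sub_exact0 sub vA); rewrite wE /step_df (reduction0 _ step_hdh).
by rewrite mulmxA; eexists.
Qed.

Lemma step_surj v : exists2 v', supported (step_A 0) v' & exists y, v - v' = y *m N.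
Proof.
have [v' v'A [y yE]] := sub_surj sub v.
have sd : supported (A 0%N) (v' *m h 0 *m df 0) by exact: supported_df.
have [|z zE] := (sub_exact0 sub sd).2; first by eexists.
exists (v' - v' *m h 0 *m df 0).
  apply: step_supported_iff.
  - by apply: supportedD => //; apply: supportedN.
  - by rewrite mulmx0.
  apply/eqP; rewrite mulmxBl subr_eq0; apply/eqP.
  by rewrite /red_b -{1}step_hdh !mulmxA.
by exists (y + z); rewrite opprB mulmxDl -yE -zE addrCA addrC.
Qed.

Definition pivot_count i j : nat :=
  if X i is Some (b, a) then (deg b == j) else 0.

Lemma rank_pivot i j : \rank (dpiece i j *m pivot_h i) = pivot_count i j.
Proof.
rewrite /pivot_h /pivot_count; case Xi: (X i) => [[b a]|]; last by rewrite mulmx0 mxrank0.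
have -> : dpiece i j *m (((df i a b)@_0%MM)^-1 *: delta_mx b a) =
    ((deg b == j)%:R * ((df i a b)@_0%MM)^-1) *: delta_mx b a.
  apply/matrixP => x y; rewrite mul_diag_mx !mxE.
  by case: (eqVneq x b) => [->|] /=; rewrite ?mulr0 // mulrA.
case: (deg b == j); last by rewrite mul0r scale0r mxrank0.
by rewrite mul1r mxrank_scale_nz ?mxrank_delta // invr_neq0 // (XA Xi).
Qed.

Lemma map_reduction i : cterm (step_df i) =
  reduction (fun i => cterm (df i)) pivot_h pivot_g i.
Proof.
have Ea l : cterm (red_a h g l) = red_a pivot_h pivot_g l.
  case: l => [|l]; first exact: map_mx0.
  by rewrite /red_a ctermM !ctermC.
have Eb l : cterm (red_b h g l) = red_b pivot_h pivot_g l.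
  by rewrite /red_b ctermM !ctermC.
have BB p q' (D E : 'M[R]_(p, q')) : cterm (D - E) = cterm D - cterm E by exact: map_mxB.
have Em l : cterm (red_mask h g l) = red_mask pivot_h pivot_g l.
  rewrite /red_mask !BB Ea Eb; congr (_ - _ - _); exact: map_mx1.
by rewrite /step_df /reduction !ctermM !Em /red_core BB !ctermM ctermC.
Qed.

Lemma drank_step i j : (drank step_df i j + pivot_count i j = drank df i j)%N.
Proof.
have Pd l : dpiece l.+1 j *m cterm (df l) = cterm (df l) *m dpiece l j.
  apply: dpiece_comm => a b; rewrite mxE => c0.
  by have [/eqP] := homogz_const (@sub_homog _ _ sub l a b) c0; rewrite subr_eq0 => /eqP.
have Ph l : dpiece l j *m pivot_h l = pivot_h l *m dpiece l.+1 j.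
  apply: dpiece_comm => b a; rewrite /pivot_h; case Xl: (X l) => [[b' a']|]; last by rewrite mxE eqxx.
  rewrite !mxE; have [_ _ dab _] := XE Xl.
  by case: (eqVneq b b') => [->|_]; case: (eqVneq a a') => [->|_]; rewrite /= ?mulr0 ?eqxx ?dab.
have Pg l : dpiece l.+1 j *m pivot_g l = pivot_g l *m dpiece l j.
  apply: dpiece_comm => a b; rewrite /pivot_g; case Xl: (X l) => [[b' a']|]; last by rewrite mxE eqxx.
  rewrite !mxE; have [_ _ dab _] := XE Xl.
  by case: (eqVneq a a') => [->|_]; case: (eqVneq b b') => [->|_]; rewrite /= ?mulr0 ?eqxx ?dab.
have dd l : cterm (df l.+1) *m cterm (df l) = 0.
  by rewrite -ctermM (sub_dd sub); exact: map_mx0.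
have hdh l : pivot_h l *m cterm (df l) *m pivot_h l = pivot_h l.
  by have := congr1 (@cterm _ _ _ _) (step_hdh l); rewrite !ctermM !ctermC.
rewrite /drank map_reduction.
rewrite -(@reduction_proj _ _ _ _ _ (fun l => dpiece l j) (fun l => dpieceK l j) Pd Ph Pg).
rewrite -rank_pivot; apply: rank_reduction => l.
- by rewrite Pd -mulmxA [dpiece _ _ *m (_ *m _)]mulmxA dpieceK Pd mulmxA dd mul0mx.
- have hdh' : pivot_h l *m (cterm (df l) *m pivot_h l) = pivot_h l by rewrite mulmxA.
  have KK l' (p : nat) (D : 'M_(_, p)) : dpiece l' j *m (dpiece l' j *m D) = dpiece l' j *m D.
    by rewrite mulmxA dpieceK.
  rewrite {1}Ph -!mulmxA KK [pivot_h l *m (dpiece _ _ *m _)]mulmxA -Ph -mulmxA.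
  rewrite [cterm _ *m (dpiece _ _ *m _)]mulmxA -Pd -mulmxA.
  by rewrite [pivot_h l *m (dpiece _ _ *m _)]mulmxA -Ph -mulmxA KK hdh'.
Qed.

Lemma card_step i j : (#|[set a in step_A i | deg a == j]| + pivot_count i j +
  (if i is i'.+1 then pivot_count i' j else 0) = #|[set a in A i | deg a == j]|)%N.
Proof.
have card0 l (P : pred 'I_(rk l)) : #|[set a in set0 | P a]| = 0%N.
  by apply/eqP; rewrite cards_eq0; apply/eqP/setP => x; rewrite !inE.
have card1 l (P : pred 'I_(rk l)) b : #|[set a in [set b] | P a]| = P b.
  rewrite (_ : [set a in _ | P a] = if P b then [set b] else set0).
    by case: (P b); rewrite ?cards1 ?cards0.
  by apply/setP => x; rewrite !inE; case: (eqVneq x b) => [->|xb]; case: ifP; rewrite ?inE ?eqxx ?(negPf xb).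
have cb : #|[set a in pivots_b i | deg a == j]| = pivot_count i j.
  by rewrite /pivots_b /pivot_count; case: (X i) => [[b a]|]; rewrite ?card0 ?card1.
have ca : #|[set a in pivots_a i | deg a == j]| = if i is i'.+1 then pivot_count i' j else 0.
  case: i {cb} => [|i]; first exact: card0.
  rewrite /pivots_a /pivot_count; case Xi: (X i) => [[b a]|]; last exact: card0.
  by have [_ _ <- _] := XE Xi; rewrite card1.
have sub_ab x : x \in pivots_a i :|: pivots_b i -> x \in A i.
  rewrite inE /pivots_a /pivots_b => /orP[].
    case: i x {ca cb} => [|i] x; rewrite ?inE //; case Xi: (X i) => [[b a]|]; rewrite ?inE // => /eqP ->.
    by case: (XE Xi).
  by case Xi: (X i) => [[b a]|]; rewrite ?inE // => /eqP ->; case: (XE Xi).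
rewrite -ca -cb.
have -> : [set a in A i | deg a == j] = [set a in step_A i | deg a == j] :|:
    ([set a in pivots_b i | deg a == j] :|: [set a in pivots_a i | deg a == j]).
  apply/setP => x; rewrite !inE; have := sub_ab x; rewrite inE.
  by case: (x \in pivots_a i); case: (x \in pivots_b i); case: (x \in A i) => //= h'; rewrite ?orbF ?orbb //;
     have := h' isT.
rewrite !cardsU -addnA.
have -> : [set a in step_A i | deg a == j] :&:
    ([set a in pivots_b i | deg a == j] :|: [set a in pivots_a i | deg a == j]) = set0.
  apply/setP => x; rewrite !inE.
  by case: (x \in pivots_a i); case: (x \in pivots_b i); rewrite /= ?andbF.
have -> : [set a in pivots_b i | deg a == j] :&: [set a in pivots_a i | deg a == j] = set0.
  apply/setP => x; rewrite !inE; case xa: (x \in pivots_a i); last by rewrite /= andbF.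
  by rewrite (pivots_disj xa).
by rewrite cards0 !subn0.
Qed.

Lemma step_homog i x y : homogz (deg (i := i.+1) x - deg (i := i) y) (step_df i x y).
Proof.
move=> m; rewrite step_dfE; case: ifP => _; last by rewrite mcoeff0 eqxx.
rewrite step_core; case Xi: (X i) => [[b a]|]; last exact: (sub_homog sub).
have [_ _ dab _] := XE Xi; rewrite mcoeffB mcoeffCM.
have [->|/(sub_homog sub) //] := eqVneq (df i x y)@_m 0.
rewrite sub0r oppr_eq0 mulf_eq0 negb_or => /andP[_].
rewrite mcoeffM => nz.
have /exists_inP[[m1 m2] /= /eqP mE] : [exists (mm : 'X_{1..n < (mdeg m).+1, (mdeg m).+1} |
    m == (mm.1 + mm.2)%MM), (df i x b)@_mm.1 * (df i a y)@_mm.2 != 0].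
  apply: contraNT nz; rewrite negb_exists_in => /forall_inP nz.
  by apply/eqP; apply: big1 => mm /nz; rewrite negbK => /eqP.
rewrite mulf_eq0 negb_or => /andP[/(sub_homog sub) E1 /(sub_homog sub) E2].
by rewrite mE mdegD PoszD E1 E2 dab; ring.
Qed.

Lemma step_subresolution : subresolution step_A step_df.
Proof.
split.
- exact: step_homog.
- move=> i; apply: reduction_dd; [exact: (sub_dd sub)|exact: step_hdh|exact: step_hh].
- by move=> i a b ab; rewrite step_dfE (negPf ab).
- exact: step_exact.
- exact: step_exact0.
- exact: step_surj.
move=> i j; have := card_step i j; have := sub_betti sub i j; have := drank_step i j.
case: i => [|i] /=; last have := drank_step i j.
  move: (pivot_count _ _) (drank _ _ _) (drank _ _ _) #|_| #|_| (bt _ _) => x1 x2 x3 x4 x5 x6; lia.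
move: (pivot_count i j) (pivot_count i.+1 j) (drank step_df i j) (drank df i j) => x1 x2 x3 x4.
move: (drank _ _ _) (drank _ _ _) #|_| #|_| (bt _ _) => x5 x6 x7 x8 x9; lia.
Qed.

End Step.
End Elimination.

Lemma single_family (T : nat -> Type) p (x : T p) :
  exists X : forall i, option (T i), X p = Some x /\ forall i, X i -> i = p.
Proof.
exists (fun i => if p =P i is ReflectT e then Some (eq_rect p T x i e) else None); split.
  by case: eqP => // e; rewrite (eq_axiomK e).
by move=> i; case: eqP => [e _|//]; exact: esym.
Qed.

Section Minimal.
Variables (k : fieldType) (n : nat).
Local Notation R := {mpoly k[n]}.
Variables (rk : nat -> nat) (deg : forall i, 'I_(rk i) -> int).
Variables (q : nat) (N : 'M[R]_(q, rk 0)) (bt : nat -> int -> nat).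

(** The given resolution may be infinite, so units are removed only below [L]. Each removal deletes
    a basis element in a position at most [L], where there are finitely many. *)
Lemma minimal_subresolution L (A : forall i, {set 'I_(rk i)}) (df : forall i, 'M[R]_(rk i.+1, rk i)) :
  subresolution deg N bt A df ->
  exists A' df', subresolution deg N bt A' df' /\
    forall i a b, (i < L)%N -> (df' i a b)@_0%MM = 0.
Proof.
have [s] := ubnP (\sum_(i < L.+1) #|A i|)%N; elim: s A df => // s IHs A df As sub.
have [/existsP[[p pL] /existsP[a /existsP[b /= ab]]]|min] :=
    boolP [exists i : 'I_L, exists a, exists b, (df i a b)@_0%MM != 0]; last first.
  exists A, df; split=> // i a b iL; apply/eqP; apply: contraNT min => ab.
  by apply/existsP; exists (Ordinal iL); apply/existsP; exists a; apply/existsP; exists b.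
have [X [Xp X1]] := single_family (T := fun i => ('I_(rk i) * 'I_(rk i.+1))%type) (b, a).
have XA i b' a' : X i = Some (b', a') -> (df i a' b')@_0%MM != 0.
  move=> Xi; have ip : i = p by apply: X1; rewrite Xi.
  by move: Xi; subst i; rewrite Xp => -[<- <-].
have X1' i i' : X i != None -> X i' != None -> i = i'.
  move=> Xi Xi'; have -> : i = p by apply: X1; case: (X i) Xi.
  by apply: esym; apply: X1; case: (X i') Xi'.
apply: (IHs (step_A A X) (step_df df X)); last exact: step_subresolution.
have [aA _ _ _] := XE sub XA Xp.
move: As; rewrite ltnS; apply: leq_trans.
have leA i : (#|step_A A X i| <= #|A i|)%N by apply: subset_leq_card; exact: subsetDl.
have pL' : (p.+1 < L.+1)%N by [].
rewrite (bigD1 (Ordinal pL')) //= [leqRHS](bigD1 (Ordinal pL')) //= -addSn.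
apply: leq_add; last by apply: leq_sum.
apply: proper_card; rewrite properE subsetDl /=; apply/subsetPn; exists a => //.
by rewrite !inE /pivots_a Xp !inE eqxx.
Qed.

End Minimal.

Section Pick.
Variables (R : pzRingType) (m : nat) (B : {set 'I_m}).

Definition pick_mx : 'M[R]_(#|B|, m) := \matrix_(t < #|B|, a < m) (a == enum_val t)%:R.

Lemma mul_pick_mx p (D : 'M[R]_(m, p)) t y : (pick_mx *m D) t y = D (enum_val t) y.
Proof.
rewrite mxE (bigD1 (enum_val t)) //= mxE eqxx mul1r big1 ?addr0 // => a at'.
by rewrite mxE (negPf at') mul0r.
Qed.

Lemma mul_mx_pick p (D : 'M[R]_(p, m)) x t : (D *m pick_mx^T) x t = D x (enum_val t).
Proof.
rewrite mxE (bigD1 (enum_val t)) //= !mxE eqxx mulr1 big1 ?addr0 // => a at'.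
by rewrite !mxE (negPf at') mulr0.
Qed.

Lemma pick_mxK : pick_mx *m pick_mx^T = 1%:M.
Proof.
by apply/matrixP => t t'; rewrite mul_pick_mx !mxE (inj_eq enum_val_inj).
Qed.

Lemma pick_mx_diag a b : (pick_mx^T *m pick_mx) a b = ((a == b) && (a \in B))%:R.
Proof.
have [aB|aB] := boolP (a \in B); rewrite mxE ?andbT ?andbF.
  rewrite (bigD1 (enum_rank_in aB a)) //= big1 ?addr0 => [|t ta]; last first.
    rewrite !mxE; case: eqVneq => [at'|]; last by rewrite mul0r.
    by case/negP: ta; rewrite -(inj_eq enum_val_inj) enum_rankK_in // at'.
  by rewrite !mxE enum_rankK_in // eqxx mul1r eq_sym.
rewrite big1 // => t _; rewrite !mxE; case: eqVneq => [at'|]; last by rewrite mul0r.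
by case/negP: aB; rewrite at' enum_valP.
Qed.

Lemma pick_mx_id p (D : 'M[R]_(p, m)) : (forall x a, a \notin B -> D x a = 0) ->
  D *m pick_mx^T *m pick_mx = D.
Proof.
move=> D0; apply/matrixP => x a; rewrite -mulmxA mxE (bigD1 a) //= big1 ?addr0.
  by rewrite pick_mx_diag eqxx; case: (boolP (a \in B)) => [_|/D0 ->]; rewrite ?mulr1 ?mul0r.
by move=> b ba; rewrite pick_mx_diag (negPf ba) mulr0.
Qed.

Lemma pick_mx_idl p (D : 'M[R]_(m, p)) : (forall a y, a \notin B -> D a y = 0) ->
  pick_mx^T *m (pick_mx *m D) = D.
Proof.
move=> D0; apply/matrixP => a y; rewrite mulmxA mxE (bigD1 a) //= big1 ?addr0.
  by rewrite pick_mx_diag eqxx; case: (boolP (a \in B)) => [_|/D0 ->]; rewrite ?mul1r ?mulr0.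
by move=> b ba; rewrite pick_mx_diag eq_sym (negPf ba) mul0r.
Qed.

End Pick.

Section Initial.
Variables (k : fieldType) (n : nat) (M : gradedModule k n) (F : freeResolution M).
Local Notation R := {mpoly k[n]}.

Lemma rank_tor_piece i j : \rank (tor_piece F i j) = #|[set a : 'I_(fr_rank F i) | fr_deg a == j]|.
Proof.
set S := [set _ | _].
pose E := pick_mx k S.
have DE : tor_piece F i j = E^T *m E.
  apply/matrixP => a b; rewrite pick_mx_diag !mxE inE.
  by case: (a == b); case: (_ == j); rewrite /= ?mulr1n ?mulr0n.
have EDE : E *m tor_piece F i j *m E^T = 1%:M by rewrite DE mulmxA pick_mxK mul1mx pick_mxK.
apply/eqP; rewrite eqn_leq; apply/andP; split.
  by rewrite DE; apply: leq_trans (mxrankM_maxr _ _) (rank_leq_row _).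
by rewrite -[leqLHS](mxrank1 k) -EDE; apply: leq_trans (mxrankM_maxl _ _) (mxrankM_maxr _ _).
Qed.

Lemma tor_piece_diff i j : tor_piece F i.+1 j *m tor_diff F i = tor_diff F i *m tor_piece F i j.
Proof.
apply: dpiece_comm => a b; rewrite mxE => c0.
by have [/eqP] := homogz_const (homog_intP (@fr_diff_homog _ _ _ F i a b)) c0; rewrite subr_eq0 => /eqP.
Qed.

Lemma rank_betti i j : (betti F i j + \rank (tor_boundaries F i j) +
  (if i is i'.+1 then \rank (tor_boundaries F i' j) else 0) =
  #|[set a : 'I_(fr_rank F i) | fr_deg a == j]|)%N.
Proof.
have cyc : (tor_boundaries F i j <= tor_cycles F i j)%MS.
  rewrite /tor_boundaries; case: i => [|i] /=; first by rewrite tor_piece_diff submxMl.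
  rewrite sub_capmx tor_piece_diff submxMl /= -tor_piece_diff.
  apply/sub_kermxP; rewrite -mulmxA; have -> : tor_diff F i.+1 *m tor_diff F i = 0; last by rewrite mulmx0.
  rewrite -map_mxM; have -> : fr_diff F i.+1 *m fr_diff F i = 0; last exact: map_mx0.
  apply/row_matrixP => a; rewrite row_mul row0; apply/fr_exactS.
  by exists (delta_mx 0 a); rewrite rowE.
rewrite /betti subnK ?mxrankS // -rank_tor_piece.
case: i {cyc} => [|i] /=; first by rewrite addn0.
by rewrite addnC mxrank_mul_ker.
Qed.

Lemma initial_subresolution :
  subresolution (@fr_deg _ _ _ F) (fr_diff F 0) (betti F) (fun i => setT) (fr_diff F).
Proof.
split.
- by move=> i a b; apply: homog_intP; apply: fr_diff_homog.
- move=> i; apply/row_matrixP => a; rewrite row_mul row0; apply/fr_exactS.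
  by exists (delta_mx 0 a); rewrite rowE.
- by move=> i a b; rewrite !inE.
- by move=> i v _ /fr_exactS.
- by [].
- by move=> v; exists v => [a|]; [rewrite inE | exists 0; rewrite subrr mul0mx].
move=> i j; have := rank_betti i j; case: i => [|i] /= ->.
all: by apply: eq_card => a; rewrite !inE.
Qed.

End Initial.

(** * Prime chains *)

Section Avoidance.
Variables (R : comNzRingType) (I S : R -> Prop).

Definition ideal_prop (J : R -> Prop) := J 0 /\ forall a u v, J u -> J v -> J (a * u + v).

(** By Zorn's lemma there is an ideal maximal among those containing [I] and disjoint from [S]. If
    it missed [a] and [b] but not [a * b], enlarging it by each would give two elements of [S] with
    product in the ideal. *)
Lemma prime_avoidance :
  ideal_prop I -> S 1 -> (forall u v, S u -> S v -> S (u * v)) -> (forall u, I u -> ~ S u) ->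
  exists P : {pred R}, [/\ idealr_closed P, prime_idealr_closed P,
    forall u, I u -> u \in P & forall u, u \in P -> ~ S u].
Proof.
move=> II S1 SM IS.
pose T := {J : R -> Prop | [/\ ideal_prop J, forall u, I u -> J u & forall u, J u -> ~ S u]}.
have t0 : T by exists I.
pose rT : rel T := fun J J' => boolp.asbool (forall u, sval J u -> sval J' u).
have rTP (J J' : T) : reflect (forall u, sval J u -> sval J' u) (rT J J') by exact: boolp.asboolP.
have [||A tA|[J JP] Jmax] := classical_sets.ZL_preorder t0 (R := rT).
- by move=> J; apply/rTP.
- by move=> J1 J2 J3 /rTP h1 /rTP h2; apply/rTP => u /h1 /h2.
- have [[J AJ]|nA] := boolp.pselect (exists J, A J); last first.
    by exists t0 => J AJ; case: nA; exists J.
  pose U u := exists2 J', A J' & sval J' u.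
  have UP : [/\ ideal_prop U, forall u, I u -> U u & forall u, U u -> ~ S u].
    split.
    - split; first by exists J => //; case: (J) => K KP /=; case: KP => -[].
      move=> a u v [J1 A1 u1] [J2 A2 v2].
      case: (tA J1 J2 A1 A2) => [/rTP h|/rTP h].
        exists J2 => //; case: (J2) h v2 => K KP /=; case: KP => -[_ KD] _ _ h v2; apply: KD => //; exact: h.
      exists J1 => //; case: (J1) h u1 => K KP /=; case: KP => -[_ KD] _ _ h u1; apply: KD => //; exact: h.
    - by move=> u Iu; exists J => //; case: (J) => K KP /=; case: KP => _ IK _; exact: IK.
    by move=> u [J' _]; case: J' => K KP /=; case: KP => _ _ KS; exact: KS.
  by exists (exist _ U UP) => J' AJ'; apply/rTP => u J'u; exists J'.
have [[J0 JD] IJ JS] := JP.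
have ext a : ~ J a -> exists r j, J j /\ S (r * a + j).
  move=> nJa; case: (boolp.pselect (exists r j, J j /\ S (r * a + j))) => // none.
  pose K u := exists r j, J j /\ u = r * a + j.
  have KP : [/\ ideal_prop K, forall u, I u -> K u & forall u, K u -> ~ S u].
    split.
    - split; first by exists 0, 0; rewrite mul0r addr0.
      move=> c u v [r1 [j1 [J1 ->]]] [r2 [j2 [J2 ->]]].
      exists (c * r1 + r2), (c * j1 + j2); split; first exact: JD.
      by ring.
    - by move=> u Iu; exists 0, u; rewrite mul0r add0r; split=> //; apply: IJ.
    by move=> u [r [j [Jj ->]]] Sr; apply: none; exists r, j.
  case: nJa; have JK : rT (exist _ J JP) (exist _ K KP).
    by apply/rTP => u Ju; exists 0, u; rewrite mul0r add0r.
  have /rTP := Jmax _ JK; apply.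
  by exists 1, 0; rewrite mul1r addr0.
exists (fun u => boolp.asbool (J u)).
have inE' u : u \in (fun u => boolp.asbool (J u)) = boolp.asbool (J u) by [].
split.
- split; first by rewrite inE'; apply/boolp.asboolP.
    by rewrite inE'; apply/boolp.asboolP => /JS.
  by move=> a u v; rewrite !inE' => /boolp.asboolP Ju /boolp.asboolP Jv; apply/boolp.asboolP/JD.
- move=> a b; rewrite !inE' => /boolp.asboolP Jab.
  apply/orP; case: (boolp.pselect (J a)) => [Ja|nJa]; first by left; apply/boolp.asboolP.
  case: (boolp.pselect (J b)) => [Jb|nJb]; first by right; apply/boolp.asboolP.
  have [r1 [j1 [J1 S1']]] := ext _ nJa; have [r2 [j2 [J2 S2']]] := ext _ nJb.
  case: (JS _ _ (SM _ _ S1' S2')).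
  have -> : (r1 * a + j1) * (r2 * b + j2) = (r1 * r2) * (a * b) + ((r1 * a + j1) * j2 + ((r2 * b) * j1 + 0)) by ring.
  by apply: (JD) => //; apply: (JD) => //; apply: (JD).
- by move=> u /IJ Ju; rewrite inE'; apply/boolp.asboolP.
by move=> u; rewrite inE' => /boolp.asboolP /JS.
Qed.

End Avoidance.

Section Chains.
Variables (k : fieldType) (n : nat) (M : lmodType {mpoly k[n]}).
Local Notation R := {mpoly k[n]}.

Definition ann_mod (s : seq R) (f : R) := forall x : M, in_ideal_mul s (f *: x).

Lemma in_ideal_mulD (s : seq R) a (x y : M) :
  in_ideal_mul s x -> in_ideal_mul s y -> in_ideal_mul s (a *: x + y).
Proof.
move=> [c ->] [c' ->]; exists (fun i => a *: c i + c' i).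
rewrite scaler_sumr -big_split /=; apply: eq_bigr => i _.
by rewrite scalerDr !scalerA mulrC.
Qed.

Lemma in_ideal_mul0 (s : seq R) : in_ideal_mul s (0 : M).
Proof. by exists (fun=> 0); rewrite big1 // => i _; rewrite scaler0. Qed.

Lemma ann_mod_ideal s : ideal_prop (ann_mod s).
Proof.
split=> [x|a u v hu hv x]; first by rewrite scale0r; exact: in_ideal_mul0.
by rewrite scalerDl -scalerA; apply: in_ideal_mulD.
Qed.

Lemma in_ideal_mul_nat s (x : M) :
  in_ideal_mul s x <-> exists c : nat -> M, x = \sum_(i < size s) s`_i *: c i.
Proof.
split=> [[c ->]|[c ->]]; last by exists (fun i => c i).
exists (fun i => if insub i is Some j then c j else 0).
by apply: eq_bigr => i _; rewrite valK.
Qed.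

Lemma in_ideal_mul_rcons s a (x : M) :
  in_ideal_mul (rcons s a) x <-> exists y z, in_ideal_mul s y /\ x = y + a *: z.
Proof.
split=> [/in_ideal_mul_nat[c ->]|[y [z [/in_ideal_mul_nat[c ->] ->]]]].
  rewrite size_rcons big_ord_recr /= nth_rcons ltnn eqxx.
  exists (\sum_(i < size s) s`_i *: c i), (c (size s)); split; first by exists (fun i => c i).
  by congr (_ + _); apply: eq_bigr => i _; rewrite nth_rcons ltn_ord.
apply/in_ideal_mul_nat; exists (fun i => if (i < size s)%N then c i else z).
rewrite size_rcons big_ord_recr /= nth_rcons !ltnn eqxx; congr (_ + _).
by apply: eq_bigr => i _; rewrite nth_rcons ltn_ord.
Qed.

Lemma regular_rcons s a : regular_sequence M (rcons s a) ->
  regular_sequence M s /\ forall x : M, in_ideal_mul s (a *: x) -> in_ideal_mul s x.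
Proof.
move=> [reg [x0 x0P]]; split; first split.
- move=> i il x; have := reg i; rewrite size_rcons nth_rcons il -cats1 takel_cat; last exact: ltnW.
  move=> h; apply: h; exact: (leqW il).
- exists x0 => h; apply: x0P; apply/in_ideal_mul_rcons; exists x0, 0; split=> //.
  by rewrite scaler0 addr0.
move=> x; have := reg (size s); rewrite size_rcons nth_rcons ltnn eqxx -cats1 take_size_cat //.
exact.
Qed.

(* Each s_q lies in P, but is a nonzerodivisor on M / (s_1, .., s_(q-1)) M, so it
   avoids some prime of that module inside P. *)
Lemma regular_chain s : regular_sequence M s -> forall P : {pred R}, is_prime_ideal P ->
  (forall f, ann_mod s f -> f \in P) ->
  exists Q, prime_chain M (size s) Q /\ Q (size s) = P.
Proof.
elim/last_ind: s => [|s a IHs].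
  move=> _ P Pp PA; exists (fun=> P); split=> //; split=> // i _; split=> // f fM.
  by apply: PA => x; rewrite fM; exact: in_ideal_mul0.
move=> /regular_rcons[regs rega] P [[P0 P1 PD] Pp] PA.
have aP : a \in P.
  by apply: PA => x; apply/in_ideal_mul_rcons; exists 0, x; rewrite add0r; split=> //; exact: in_ideal_mul0.
have sP f : ann_mod s f -> f \in P.
  move=> fs; apply: PA => x; apply/in_ideal_mul_rcons; exists (f *: x), 0.
  by rewrite scaler0 addr0.
(* Avoiding [S] puts the new prime inside [P], by [e = 0], and keeps [a] out of it, by [v = 1]. *)
pose S u := exists v e, v \notin P /\ u = v * a ^+ e.
have [|||P' [P'I P'p sP' SP']] := prime_avoidance (ann_mod_ideal s) (S := S).
- by exists 1, 0%N; rewrite mulr1.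
- move=> u u' [v [e [vP ->]]] [v' [e' [vP' ->]]]; exists (v * v'), (e + e')%N.
  split; last by rewrite exprD; ring.
  by apply/negP => /Pp; rewrite (negPf vP) (negPf vP').
- move=> u us [v [e [vP uE]]]; case/negP: vP; apply: sP => x.
  have := us x; rewrite uE mulrC -scalerA; elim: e {uE} => [|e IHe]; first by rewrite scale1r.
  by rewrite exprS -scalerA => /rega.
have P'P u : u \in P' -> u \in P.
  move=> /SP' nS; apply: contraT => uP; case: nS; exists u, 0%N.
  by rewrite mulr1.
have [|Q [[Q1 Q2] QE]] := IHs regs P' _ sP'; first by split.
exists (fun i => if (i <= size s)%N then Q i else P); rewrite size_rcons ltnn; split=> //; split.
  move=> i; rewrite leq_eqVlt => /orP[/eqP ->|].
    by rewrite ltnn; split=> // f fM; apply: sP => x; rewrite fM; exact: in_ideal_mul0.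
  by rewrite ltnS => il; rewrite il; exact: Q1.
move=> i; rewrite ltnS => il; rewrite il; case: (ltnP i (size s)) => [/Q2 //|li].
have -> : i = size s by apply/eqP; rewrite eqn_leq il.
rewrite QE; split; first exact: P'P.
by exists a => //; apply/negP => /SP'; apply; exists 1, 1%N; rewrite mul1r expr1.
Qed.

(** Otherwise some prime over the annihilator of [M / (s) M] avoids all [u * x ^+ e]. It lies in the
    irrelevant ideal but misses [x], so the chain of length [d] below it extends by that ideal,
    exceeding the dimension. *)
Lemma power_kills s d (x : R) : is_krull_dim M d -> size s = d -> regular_sequence M s ->
  x@_0%MM = 0 ->
  exists u e, u@_0%MM != 0 /\ forall y : M, in_ideal_mul s ((u * x ^+ e) *: y).
Proof.
move=> [_ dmax] ss reg x0.
case: (boolp.pselect (exists u e, u@_0%MM != 0 /\ forall y : M, in_ideal_mul s ((u * x ^+ e) *: y))) => // none.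
pose S (f : R) := exists u e, u@_0%MM != 0 /\ f = u * x ^+ e.
have [|||P [PI Pp sP SP]] := prime_avoidance (ann_mod_ideal s) (S := S).
- by exists 1, 0%N; rewrite mulr1 mcoeff1 eqxx oner_eq0.
- move=> u u' [v [e [vP ->]]] [v' [e' [vP' ->]]]; exists (v * v'), (e + e')%N.
  split; last by rewrite exprD; ring.
  by rewrite rmorphM /= mulf_neq0.
- by move=> f fs [u [e [u0 fE]]]; apply: none; exists u, e; split=> // y; rewrite -fE.
have [Q [[Q1 Q2] QE]] := regular_chain reg (conj PI Pp) sP.
have mP f : f \in P -> f@_0%MM = 0.
  by move=> /SP nS; apply/eqP; apply: contraT => f0; case: nS; exists f, 0%N; rewrite mulr1.
pose m : {pred R} := fun f => f@_0%MM == 0.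
have mE f : (f \in m) = (f@_0%MM == 0) by [].
suff /dmax : prime_chain M d.+1 (fun i => if (i <= d)%N then Q i else m) by rewrite ltnn.
split=> i; last rewrite ltnS.
  rewrite leq_eqVlt => /orP[/eqP ->|]; last by rewrite ltnS -ss => il; rewrite il; exact: Q1.
  rewrite ltnn; split; first split.
  - split; rewrite ?mE ?mcoeff0 ?mcoeff1 ?eqxx ?oner_eq0 // => a u v; rewrite !mE rmorphD rmorphM /=.
    by move=> /eqP -> /eqP ->; rewrite mulr0 addr0.
  - by move=> u v; rewrite !mE rmorphM mulf_eq0.
  move=> f fM; rewrite mE; apply/eqP/mP/sP => y; rewrite fM; exact: in_ideal_mul0.
move=> il; rewrite il; case: (ltnP i d) => [|li]; first by rewrite -ss => /Q2.
have -> : i = size s by apply/eqP; rewrite eqn_leq ss il.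
rewrite QE; split; first by move=> f /mP f0; rewrite mE f0.
exists x; first by rewrite mE x0.
by apply/negP => /SP; apply; exists 1, 1%N; rewrite mul1r expr1 mcoeff1 eqxx oner_eq0.
Qed.

End Chains.

(** The chain consists of the kernels of [kill v], the primes generated by the first [v]
    variables. *)
Lemma krull_dim_mpoly (k : fieldType) n d :
  is_krull_dim ({mpoly k[n]}^o : lmodType {mpoly k[n]}) d -> (n <= d)%N.
Proof.
move=> [_ dmax]; apply: (dmax n (fun v f => kill v f == 0)).
have kE v (f : {mpoly k[n]}) : (f \in (fun f => kill v f == 0)) = (kill v f == 0) by [].
split=> i il; last first.
  split.
    by move=> f fi; rewrite kE; apply/eqP/(kill_le (leqnSn i))/eqP.
  exists 'X_(Ordinal il); first by rewrite kE killX /= ltnSn.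
  rewrite kE killX /= ltnn; apply/eqP => /(congr1 (mcoeff U_(Ordinal il))).
  by rewrite mcoeffXU eqxx mcoeff0 => /eqP; rewrite oner_eq0.
split; last first.
  move=> f /(_ 1); rewrite kE => h; have -> : f = 0 by rewrite -[RHS]h [RHS]mulr1.
  by rewrite rmorph0.
split.
  split; rewrite ?kE ?rmorph0 ?rmorph1 ?oner_eq0 // => a u v; rewrite !kE rmorphD rmorphM /=.
  by move=> /eqP -> /eqP ->; rewrite mulr0 addr0.
by move=> u v; rewrite !kE rmorphM mulf_eq0.
Qed.

(** * Growth of the Hilbert function *)

Section Order.
Variables (k : nzRingType) (n : nat).
Local Notation R := {mpoly k[n]}.

(* f lies in the N-th power of the irrelevant ideal. *)
Definition ord_ge N (f : R) := forall m, (mdeg m < N)%N -> f@_m = 0.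

Lemma ord_ge_le N N' f : (N' <= N)%N -> ord_ge N f -> ord_ge N' f.
Proof. by move=> le h m mN; apply: h; apply: leq_trans mN le. Qed.

Lemma ord_ge0 N : ord_ge N 0.
Proof. by move=> m _; rewrite mcoeff0. Qed.

Lemma ord_geD N f g : ord_ge N f -> ord_ge N g -> ord_ge N (f + g).
Proof. by move=> hf hg m mN; rewrite mcoeffD hf // hg // addr0. Qed.

Lemma ord_ge_sum N I (r : seq I) (P : pred I) F :
  (forall i, P i -> ord_ge N (F i)) -> ord_ge N (\sum_(i <- r | P i) F i).
Proof. by move=> h; apply: (big_ind (ord_ge N)) => //; [exact: ord_ge0|exact: ord_geD]. Qed.

Lemma ord_geM a b f g : ord_ge a f -> ord_ge b g -> ord_ge (a + b) (f * g).
Proof.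
move=> hf hg m mN; rewrite mcoeffM; apply: big1 => -[m1 m2] /= /eqP mE.
have {}mN : (mdeg m1 + mdeg m2 < a + b)%N by rewrite -mdegD -mE.
have [l1|l1] := ltnP (mdeg m1) a; first by rewrite hf // mul0r.
by rewrite hg ?mulr0 //; lia.
Qed.

Lemma ord_geMr N f g : ord_ge N g -> ord_ge N (f * g).
Proof. by apply: (@ord_geM 0 N). Qed.

Lemma ord_ge_prod I (r : seq I) (F : I -> R) (d : I -> nat) :
  (forall i, ord_ge (d i) (F i)) -> ord_ge (\sum_(i <- r) d i) (\prod_(i <- r) F i).
Proof.
move=> h; elim: r => [|i r IHr]; first by rewrite !big_nil.
by rewrite !big_cons; apply: ord_geM.
Qed.

Lemma ord_ge_exp d (F : R) : ord_ge 1 F -> ord_ge d (F ^+ d).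
Proof.
move=> h; elim: d => [|d IHd] //; rewrite exprS -add1n; exact: ord_geM.
Qed.

Lemma ord_geX m : ord_ge (mdeg m) ('X_[m] : R).
Proof. by move=> m' h; rewrite mcoeffX; case: eqP h => [->|//]; rewrite ltnn. Qed.

Lemma ord_ge1 f : f@_0%MM = 0 -> ord_ge 1 f.
Proof. by move=> f0 m; rewrite ltnS leqn0 mdeg_eq0 => /eqP ->. Qed.

End Order.

Section Growth.
Variables (k : fieldType) (n : nat).
Local Notation R := {mpoly k[n]}.
Variables (q c0 : nat) (D : 'M[R]_(q, c0)) (s : seq R).
Hypothesis s0 : forall i, (i < size s)%N -> (s`_i)@_0%MM = 0.

Definition low N (v : 'rV[R]_c0) := forall a, ord_ge N (v 0 a).

Lemma lowD N u v : low N u -> low N v -> low N (u + v).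
Proof. by move=> hu hv a; rewrite mxE; apply: ord_geD. Qed.
Lemma low0 N : low N 0.
Proof. by move=> a; rewrite mxE; exact: ord_ge0. Qed.
Lemma lowZ N e f v : ord_ge e f -> low N v -> low (e + N) (f *: v).
Proof. by move=> hf hv a; rewrite mxE; apply: ord_geM. Qed.
Lemma lowZr N f v : low N v -> low N (f *: v).
Proof. exact: (@lowZ N 0). Qed.

(* Membership in im D + (s) F_0 + m^N F_0. *)
Definition tail N v := exists y (c : 'I_(size s) -> 'rV[R]_c0) w,
  v = y *m D + \sum_(i < size s) s`_i *: c i + w /\ low N w.

Lemma tailD N u v : tail N u -> tail N v -> tail N (u + v).
Proof.
move=> [y [c [w [-> lw]]]] [y' [c' [w' [-> lw']]]].
exists (y + y'), (fun i => c i + c' i), (w + w'); split; last exact: lowD.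
have -> : \sum_(i < size s) s`_i *: (c i + c' i) = \sum_(i < size s) s`_i *: c i + \sum_(i < size s) s`_i *: c' i.
  by rewrite -big_split /=; apply: eq_bigr => i _; rewrite scalerDr.
by rewrite mulmxDl [LHS](AC (3*3) ((1*4)*(2*5)*(3*6))) /=.
Qed.

Lemma tailZ N f v : tail N v -> tail N (f *: v).
Proof.
move=> [y [c [w [-> lw]]]]; exists (f *: y), (fun i => f *: c i), (f *: w); split; last exact: lowZr.
have -> : \sum_(i < size s) s`_i *: (f *: c i) = f *: \sum_(i < size s) s`_i *: c i.
  by rewrite scaler_sumr; apply: eq_bigr => i _; rewrite !scalerA mulrC.
by rewrite -[(f *: y) *m D]scalemxAl -scalerDr -scalerDr.
Qed.

Lemma tail_low N v : low N v -> tail N v.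
Proof.
move=> lv; exists 0, (fun=> 0), v; split=> //.
by rewrite mul0mx big1 ?add0r // => i _; rewrite scaler0.
Qed.

Lemma tail_sum N I (r : seq I) (P : pred I) F :
  (forall i, P i -> tail N (F i)) -> tail N (\sum_(i <- r | P i) F i).
Proof.
move=> h; apply: (big_ind (tail N)) => //; last exact: tailD.
by apply: tail_low; exact: low0.
Qed.

Lemma tail_sub N v : in_sub D s v -> tail N v.
Proof. by move=> [y [c ->]]; exists y, c, 0; rewrite addr0; split=> //; exact: low0. Qed.

Hypothesis pow : forall i : 'I_n, exists u e, u@_0%MM != 0 /\
  forall v : 'rV_c0, in_sub D s ((u * 'X_i ^+ e) *: v).

Lemma row_monomials (v : 'rV[R]_c0) :
  v = \sum_a \sum_(m <- msupp (v 0 a)) ((v 0 a)@_m)%:MP *: ('X_[m] *: delta_mx 0 a).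
Proof.
rewrite {1}[v]row_sum_delta; apply: eq_bigr => a _.
rewrite [X in X *: _](mpolyE (v 0 a)) scaler_suml; apply: eq_bigr => m _.
by rewrite scalerA mul_mpolyC.
Qed.

(** A monomial of large degree is divisible by some ['X_i ^+ e i], hence is killed by [u i] modulo
    the submodule. As [u i] is a nonzero constant plus terms of positive order, the monomial equals
    one of higher order: a Nakayama argument, one order at a time. *)
Lemma tail_step : exists E, forall N v, (E <= N)%N -> low N v -> tail N.+1 v.
Proof.
have /fin_all_exists[u /fin_all_exists[e ue]] : forall i : 'I_n, exists u e, u@_0%MM != 0 /\
    forall v : 'rV_c0, in_sub D s ((u * 'X_i ^+ e) *: v) by [].
(* Pigeonhole: degree above the sum of the [e i] forces some exponent to reach [e i]; the successor
   also covers [n = 0]. *)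
exists (\sum_i e i).+1 => N v EN lv; rewrite [v]row_monomials.
apply: tail_sum => a _; rewrite big_seq_cond; apply: tail_sum => m; rewrite andbT => mv.
apply: tailZ; have Nm : (N <= mdeg m)%N.
  rewrite leqNgt; apply/negP => /(lv a); move: mv; rewrite mcoeff_msupp => /eqP nz /eqP.
  by move/eqP.
have [i ei] : exists i, (e i <= m i)%N.
  apply/existsP; apply: contraLR (leq_trans EN Nm); rewrite negb_exists -leqNgt => /forallP h.
  by rewrite mdegE leq_sum // => i _; rewrite ltnW // ltnNge.
have [ui0 ui] := ue i; set z := _ *: _.
have zE : z = 'X_[m - U_(i) *+ e i] *: ('X_i ^+ e i *: delta_mx 0 a).
  rewrite /z scalerA mpolyXn -mpolyXD submK //; apply/mnm_lepP => j.
  by rewrite mulmnE mnm1E; case: eqVneq => [<-|_]; rewrite ?mul1n ?mul0n.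
have zlow : low (mdeg m) z.
  by rewrite -[mdeg m]addn0; apply: lowZ; [exact: ord_geX | move=> b x; rewrite ltn0].
set c := (u i)@_0%MM in ui0.
have -> : z = (c^-1)%:MP *: (u i *: z - (u i - c%:MP) *: z).
  rewrite -scalerBl opprB addrCA subrr addr0 scalerA -mpolyCM mulVf // mpolyC1 scale1r //.
apply: tailZ; apply: tailD.
  have -> : u i *: z = 'X_[m - U_(i) *+ e i] *: ((u i * 'X_i ^+ e i) *: delta_mx 0 a).
    by rewrite zE !scalerA [u i * _]mulrC mulrAC mulrA.
  by apply: tailZ; apply: tail_sub; exact: ui.
rewrite -scaleNr; apply: tail_low => b x xN.
apply: (lowZ (e := 1) _ zlow); last by rewrite add1n; apply: leq_trans xN _.
by apply: ord_ge1; rewrite mcoeffN mcoeffB mpolyCK subrr oppr0.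
Qed.

Lemma tail_all : exists E, forall N v, low E v -> tail N v.
Proof.
have [E step] := tail_step; exists E => N v lv; elim: N => [|N [y [c [w [vE lw]]]]].
  by apply: tail_low => a x; rewrite ltn0.
have [NE|EN] := ltnP N E; first by apply: tail_low => a; apply: ord_ge_le (lv a).
rewrite vE; apply: tailD; last exact: step EN lw.
by apply: tail_sub; exists y, c.
Qed.

Let ev : {mpoly k[size s]} -> R := mmap (@mpolyC n k) (fun i : 'I_(size s) => s`_i).
HB.instance Definition _ := GRing.RMorphism.on ev.

Lemma ord_ge_ev N (Q : {mpoly k[size s]}) : ord_ge N Q -> ord_ge N (ev Q).
Proof.
move=> hQ; rewrite /ev /mmap big_seq_cond; apply: ord_ge_sum => m; rewrite andbT => mQ.
apply: ord_geMr; have mN : (N <= mdeg m)%N.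
  rewrite leqNgt; apply/negP => /hQ Q0; move: mQ.
  by rewrite mcoeff_msupp Q0 eqxx.
apply: ord_ge_le mN _; rewrite mdegE; apply: ord_ge_prod => i.
by apply: ord_ge_exp; apply: ord_ge1; exact: s0.
Qed.

(* Modulo im D and m^N F_0, every row is a combination of the monomials in s times
   finitely many rows; E bounds the degrees of the latter, uniformly in N. *)
Lemma monomial_span : exists E, forall N (v : 'rV[R]_c0),
  exists (Q : 'I_c0 * 'X_{1..n < E} -> {mpoly k[size s]}) y,
    low N (v - \sum_x ev (Q x) *: ('X_[x.2] *: delta_mx 0 x.1) - y *m D).
Proof.
have [E hE] := tail_all; exists E; elim=> [|N IHN] v.
  by exists (fun=> 0), 0 => a x; rewrite ltn0.
pose g (x : 'I_c0 * 'X_{1..n < E}) : 'rV[R]_c0 := 'X_[x.2] *: delta_mx 0 x.1.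
pose cf (x : 'I_c0 * 'X_{1..n < E}) : R := ((v 0 x.1)@_x.2)%:MP.
pose W := \sum_x cf x *: g x.
have : low E (v - W).
  move=> a m mE; rewrite mxE mcoeffD [(- W) _ _]mxE mcoeffN summxE raddf_sum /=.
  rewrite (bigD1 (a, BMultinom mE)) //= big1 ?addr0 => [|[b m'] /= nx].
    by rewrite !mxE !eqxx mulr1 mcoeffCM mcoeffX eqxx mulr1 subrr.
  rewrite !mxE eqxx /=; case: (eqVneq a b) nx => [->|_] nx; last by rewrite !mulr0 mcoeff0.
  rewrite mulr1 mcoeffCM mcoeffX; case: eqVneq => [mm'|_]; last by rewrite mulr0.
  by case/negP: nx; apply/eqP; congr (_, _); apply: val_inj.
move=> /(hE N.+1)[y [c [w [vE lw]]]].
have /fin_all_exists[Q /fin_all_exists[y' hQ]] (i : 'I_(size s)) := IHN (c i).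
pose cQ (x : 'I_c0 * 'X_{1..n < E}) : {mpoly k[size s]} :=
  ((v 0 x.1)@_x.2)%:MP + \sum_(i < size s) 'X_i * Q i x.
exists cQ, (y + \sum_(i < size s) s`_i *: y' i).
have -> : v - \sum_x ev (cQ x) *: g x -
      (y + \sum_(i < size s) s`_i *: y' i) *m D =
    w + \sum_(i < size s) s`_i *: (c i - \sum_x ev (Q i x) *: g x - y' i *m D).
  have evE x : ev (cQ x) =
      cf x + \sum_(i < size s) s`_i * ev (Q i x).
    rewrite /cQ rmorphD rmorph_sum /=; congr (_ + _); first exact: mmapC.
    apply: eq_bigr => i _; rewrite rmorphM /=; congr (_ * _).
    by rewrite /ev mmapX mmap1U.
  have -> : \sum_x ev (cQ x) *: g x =
      W + \sum_(i < size s) \sum_x (s`_i * ev (Q i x)) *: g x.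
    rewrite exchange_big -big_split /=; apply: eq_bigr => x _.
    by rewrite evE scalerDl scaler_suml.
  have -> : \sum_(i < size s) s`_i *: (c i - \sum_x ev (Q i x) *: g x - y' i *m D) =
     \sum_(i < size s) s`_i *: c i - \sum_(i < size s) \sum_x (s`_i * ev (Q i x)) *: g x -
     \sum_(i < size s) (s`_i *: y' i) *m D.
    rewrite -!sumrB; apply: eq_bigr => i _.
    have -> : \sum_x (s`_i * ev (Q i x)) *: g x = s`_i *: \sum_x ev (Q i x) *: g x.
      by rewrite scaler_sumr; apply: eq_bigr => x _; rewrite scalerA.
    by rewrite -scalemxAl -scalerBr -scalerBr.
  rewrite opprD addrA vE mulmxDl mulmx_suml.
  move: (y *m D) (\sum_(i < size s) s`_i *: c i) (\sum_(i < size s) \sum_x _) (\sum_(i < size s) _ *m D) => x1 x2 x3 x4.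
  apply/eqP; rewrite subr_eq; apply/eqP.
  by rewrite [RHS](AC ((1*3)*2) ((5*2*1*3)*(6*4))) /= subrr addr0.
apply: lowD => //; move=> a; rewrite summxE; apply: ord_ge_sum => i _; rewrite mxE -add1n.
by apply: ord_geM; [apply: ord_ge1; exact: s0 | exact: hQ].
Qed.

Lemma ev_bounded N (Q : {mpoly k[size s]}) :
  exists c : 'X_{1..(size s) < N} -> k,
    ord_ge N (ev Q - \sum_(m : 'X_{1..(size s) < N}) (c m)%:MP * ev 'X_[m]).
Proof.
exists (fun m => Q@_m); have -> : \sum_(m : 'X_{1..(size s) < N}) (Q@_m)%:MP * ev 'X_[m] =
    ev (\sum_(m : 'X_{1..(size s) < N}) Q@_m *: 'X_[m]).
  rewrite rmorph_sum; apply: eq_bigr => m _; rewrite -mul_mpolyC rmorphM /=.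
  by congr (_ * _); rewrite /ev mmapC.
rewrite -rmorphB; apply: ord_ge_ev => m mN.
by rewrite mcoeffB (mcoeff_mpoly (fun m' : 'X_{1..(size s)} => Q@_m') mN) subrr.
Qed.

End Growth.

Section EulerBound.
Variables (k : fieldType) (n : nat).
Local Notation R := {mpoly k[n]}.
Variables (rk : nat -> nat) (dg : forall i, 'I_(rk i) -> nat).
Variable (df : forall i, 'M[R]_(rk i.+1, rk i)).
Hypothesis acy : acyclic df.
Hypothesis hdf : forall i, homogm (@dg i.+1) (@dg i) (df i).
Hypothesis rk4 : rk 4 = 0%N.
Hypothesis dg0 : forall a : 'I_(rk 0), dg a = 0%N.

Local Notation cdim := (cdim n dg).

Lemma cdimE i N : pdim n (fun j => j <= N)%N N.+1 dg i = cdim i N.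
Proof.
apply: pdim_cdim => d; case: leqP => [di|id]; last first.
  by apply/eqP; rewrite cards_eq0; apply/eqP/setP => m; rewrite !inE; apply/negbTE; lia.
rewrite -(@card_mnm_le n N.+1 (N - d)); last by lia.
by apply: eq_card => m; rewrite !inE; lia.
Qed.

Lemma euler_lower N : (cdim 1 N + cdim 3 N <= cdim 0 N + cdim 2 N)%N.
Proof.
have pB j : (j <= N)%N -> (j < N.+1)%N by [].
by rewrite -!cdimE -(euler_rank pB acy hdf rk4) leq_add2r rank_leq_col.
Qed.

(** In degrees at most [N] the cokernel is spanned by [E] fixed rows times the monomials of degree
    at most [N] in [s], which the binomial coefficient counts. *)
Lemma euler_upper (s : seq R) :
  (forall i, (i < size s)%N -> (s`_i)@_0%MM = 0) ->
  (forall i : 'I_n, exists u e, u@_0%MM != 0 /\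
    forall v, in_sub (df 0) s ((u * 'X_i ^+ e) *: v)) ->
  exists E, forall N, (cdim 0 N + cdim 2 N <= cdim 1 N + cdim 3 N + E * 'C(size s + N, size s))%N.
Proof.
move=> s0 /(monomial_span s0)[E hE]; exists #|{: 'I_(rk 0) * 'X_{1..n < E}}| => N.
have pB j : (j <= N)%N -> (j < N.+1)%N by [].
rewrite -!cdimE.
have <- : #|{: 'X_{1..(size s) < N.+1}}| = 'C(size s + N, size s).
  rewrite -(@card_mnm_le (size s) N.+1 N) // cardsE; apply: eq_card => m; rewrite !inE.
  by symmetry; rewrite unfold_in; have := bmdeg m; rewrite ltnS.
rewrite -card_prod.
pose I : finType := (('I_(rk 0) * 'X_{1..n < E}) * 'X_{1..(size s) < N.+1})%type.
rewrite -/I.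
pose ev := mmap (@mpolyC n k) (fun i : 'I_(size s) => s`_i).
pose u (x : I) : 'rV[R]_(rk 0) := ev 'X_[x.2] *: ('X_[x.1.2] *: delta_mx 0 x.1.1).
apply: (euler_span (u := fun e => u (enum_val e)) pB acy hdf rk4) => v.
have [Q [y Qy]] := hE N.+1 v.
have /fin_all_exists[c hc] x := ev_bounded s0 N.+1 (Q x).
exists (fun e => c (enum_val e).1 (enum_val e).2), y.
pose g (x : 'I_(rk 0) * 'X_{1..n < E}) : 'rV[R]_(rk 0) := 'X_[x.2] *: delta_mx 0 x.1.
pose eQ x := ev (Q x) - \sum_(m : 'X_{1..(size s) < N.+1}) (c x m)%:MP * ev 'X_[m].
have -> : v - \sum_(e < #|I|) (c (enum_val e).1 (enum_val e).2)%:MP *: u (enum_val e) - y *m df 0 =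
   (v - \sum_x ev (Q x) *: g x - y *m df 0) + \sum_x eQ x *: g x.
  have -> : \sum_(e < #|I|) (c (enum_val e).1 (enum_val e).2)%:MP *: u (enum_val e) =
      \sum_x ev (Q x) *: g x - \sum_x eQ x *: g x.
    rewrite -(big_enum_val (fun x : I => (c x.1 x.2)%:MP *: u x)) /= -sumrB.
    rewrite -(pair_bigA _ (fun x m => (c x m)%:MP *: u (x, m))) /=; apply: eq_bigr => x _.
    rewrite -scalerBl opprB addrCA subrr addr0 scaler_suml; apply: eq_bigr => m _.
    by rewrite scalerA.
  move: (\sum_x ev _ *: _) (\sum_x eQ _ *: _) (y *m _) => x1 x2 x3.
  by rewrite opprB addrA addrAC [RHS]addrAC; congr (_ + _); rewrite addrAC.
have lw : low N.+1 ((v - \sum_x ev (Q x) *: g x - y *m df 0) + \sum_x eQ x *: g x).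
  apply: lowD; first exact: Qy.
  move=> a; rewrite summxE; apply: ord_ge_sum => x _; rewrite mxE mulrC.
  by apply: ord_geMr; exact: hc.
apply/rowP => a; apply/mpolyP => m; rewrite mxE mcoeff_part dg0 addn0.
have -> : ((0 : 'rV[R]_(rk 0)) 0 a)@_m = 0 by rewrite mxE mcoeff0.
by case: ifP => // mN; apply: (lw a).
Qed.

End EulerBound.

(** * Hilbert series *)

(* Coefficient of t^N in P(t) / (1 - t)^(m+1). *)
Definition hilb m N (P : {poly rat}) : rat := \sum_(i < N.+1) P`_i * 'C(m + (N - i), m)%:R.

Lemma hilbD m N P Q : hilb m N (P + Q) = hilb m N P + hilb m N Q.
Proof. by rewrite /hilb -big_split /=; apply: eq_bigr => i _; rewrite coefD mulrDl. Qed.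

Lemma hilb_sum m N I (r : seq I) (P : pred I) F :
  hilb m N (\sum_(i <- r | P i) F i) = \sum_(i <- r | P i) hilb m N (F i).
Proof.
apply: (big_morph _ (hilbD m N)); rewrite /hilb big1 // => i _.
by rewrite coef0 mul0r.
Qed.

Lemma hilbN m N P : hilb m N (- P) = - hilb m N P.
Proof. by rewrite /hilb -sumrN; apply: eq_bigr => i _; rewrite coefN mulNr. Qed.

Lemma hilbXn m N l : hilb m N 'X^l = if (l <= N)%N then 'C(m + (N - l), m)%:R else 0.
Proof.
rewrite /hilb; case: leqP => lN; last first.
  by rewrite big1 // => i _; rewrite coefXn; case: eqP => [E|]; rewrite ?mul0r //; have := ltn_ord i; lia.
have lN' : (l < N.+1)%N by [].
rewrite (bigD1 (Ordinal lN')) //= coefXn eqxx mul1r big1 ?addr0 // => i il.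
rewrite coefXn; case: eqP => [E|]; rewrite ?mul0r //.
by case/negP: il; apply/eqP/val_inj.
Qed.

Lemma hilbC m N (c : rat) : hilb m N c%:P = c * 'C(m + N, m)%:R.
Proof.
rewrite /hilb big_ord_recl coefC /= subn0 big1 ?addr0 // => i _.
by rewrite coefC mul0r.
Qed.

Lemma coef_mul1X (P : {poly rat}) i : ((1 - 'X) * P)`_i = P`_i - (if i is j.+1 then P`_j else 0).
Proof. by rewrite mulrBl mul1r coefB coefXM; case: i. Qed.

Lemma hilbS m N P : hilb m.+1 N ((1 - 'X) * P) = hilb m N P.
Proof.
rewrite /hilb; under eq_bigr => i _ do rewrite coef_mul1X mulrBl.
rewrite sumrB [X in _ - X]big_ord_recl mul0r add0r.
rewrite big_ord_recr [RHS]big_ord_recr /= subnn !addn0 !binn.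
rewrite addrAC -sumrB; congr (_ + _); apply: eq_bigr => i _.
rewrite -mulrBr /bump /= add1n; congr (_ * _).
have -> : (N - i = (N - i.+1).+1)%N by have := ltn_ord i; lia.
have -> : ('C(m.+1 + (N - i.+1).+1, m.+1) =
    'C(m.+1 + (N - i.+1), m.+1) + 'C(m + (N - i.+1).+1, m))%N.
  by rewrite addnS binS addSnnS.
by rewrite natrD addrAC subrr add0r.
Qed.

Lemma hilb0 N P : hilb 0 N ((1 - 'X) * P) = P`_N.
Proof.
rewrite /hilb; elim: N => [|N IHN].
  by rewrite big_ord1 coef_mul1X subr0 bin0 mulr1.
rewrite big_ord_recr /= coef_mul1X bin0 mulr1.
rewrite (eq_bigr (fun i : 'I_N.+1 => ((1 - 'X) * P)`_i * 'C(0 + (N - i), 0)%:R)).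
  by rewrite IHN addrC subrK.
by move=> i _; rewrite !bin0.
Qed.

Lemma hilb2_cube N P : hilb 2 N ((1 - 'X) ^+ 3 * P) = P`_N.
Proof. by rewrite !exprS expr0 mulr1 -!mulrA !hilbS hilb0. Qed.

Lemma hilb_norm m N P : `|hilb m N P| <= (\sum_(i < size P) `|P`_i|) * 'C(m + N, m)%:R.
Proof.
apply: le_trans (ler_norm_sum _ _ _) _.
have -> : \sum_(i < size P) `|P`_i| = \sum_(i < maxn (size P) N.+1) `|P`_i|.
  rewrite (big_ord_widen_cond _ xpredT (fun i => `|P`_i|) (leq_maxl _ N.+1)) /=.
  rewrite [RHS](bigID (fun i : 'I_(maxn (size P) N.+1) => (i < size P)%N)) /= [X in _ = _ + X]big1 ?addr0 //.
  by move=> i; rewrite -leqNgt => h; rewrite nth_default ?normr0.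
rewrite mulr_suml (big_ord_widen_cond _ xpredT (fun i => `|P`_i * 'C(m + (N - i), m)%:R|) (leq_maxr (size P) _)) /=.
rewrite [leRHS](bigID (fun i : 'I_(maxn (size P) N.+1) => (i < N.+1)%N)) /=.
rewrite -[leLHS]addr0; apply: lerD.
  apply: ler_sum => i _; rewrite normrM normr_nat; apply: ler_wpM2l => //.
  by rewrite ler_nat; apply: leq_bin2l; lia.
by apply: sumr_ge0 => i _; rewrite mulr_ge0.
Qed.

(** Splitting off the value of [P] at 1 leaves a multiple of [1 - 'X], whose [hilb m.+1] has order
    at most [N^m]. A nonzero value would contribute order [N^(m+1)], against the assumed bound. *)
Lemma bounded_growth_root m r B (P : {poly rat}) : (r <= m)%N ->
  (forall N, `|hilb m.+1 N P| <= B * 'C(r + N, r)%:R) -> exists P1, P = (1 - 'X) * P1.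
Proof.
move=> rm bnd; pose c := P.[1].
have /factor_theorem[Q PQ] : root (P - c%:P) 1 by rewrite rootE !hornerE subrr.
have PE : P = (1 - 'X) * (- Q) + c%:P.
  by rewrite -[LHS](subrK c%:P) PQ; congr (_ + _); rewrite mulrN -mulNr opprB mulrC.
suff c0 : c = 0 by exists (- Q); rewrite {1}PE c0 addr0.
pose B1 := \sum_(i < size (- Q)) `|(- Q)`_i|.
have B10 : 0 <= B1 by apply: sumr_ge0.
have B0 : 0 <= B by have := bnd 0%N; rewrite addn0 binn mulr1; apply: le_trans.
have key N : `|c| * (m.+1 + N)%:R <= m.+1%:R * (B + B1).
  have C0 : (0 < 'C(m + N, m))%N by rewrite bin_gt0 leq_addr.
  rewrite -(ler_pM2r (x := 'C(m + N, m)%:R)) ?ltr0n //.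
  have Cdiag : (m.+1 + N)%:R * 'C(m + N, m)%:R = m.+1%:R * 'C(m.+1 + N, m.+1)%:R :> rat.
    by rewrite -!natrM; congr (_%:R); rewrite mul_bin_diag.
  rewrite -mulrA Cdiag mulrCA -mulrA ler_pM2l ?ltr0n //.
  have -> : `|c| * 'C(m.+1 + N, m.+1)%:R = `|hilb m.+1 N P - hilb m N (- Q)|.
    by rewrite {1}PE hilbD hilbS addrC addKr hilbC normrM normr_nat.
  apply: le_trans (ler_normB _ _) _; rewrite mulrDl; apply: lerD; last exact: hilb_norm.
  apply: le_trans (bnd N) _; apply: ler_wpM2l => //; rewrite ler_nat.
  rewrite -[leqLHS]bin_sub ?leq_addr // -[leqRHS]bin_sub ?leq_addr // !addKn.
  by apply: leq_bin2l; rewrite leq_add2r.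
apply/eqP; rewrite -normr_le0 leNgt; apply/negP => c0.
pose x := m.+1%:R * (B + B1) / `|c|.
have x0 : 0 <= x by rewrite divr_ge0 // mulr_ge0 ?addr_ge0.
have := archi_boundP x0; rewrite ltNge => /negP; apply.
rewrite ler_pdivlMr // mulrC; apply: le_trans (key (Num.bound x)).
by rewrite ler_wpM2l // ler_nat leq_addl.
Qed.

Lemma bounded_growth_cube r j B (P : {poly rat}) :
  (forall N, `|hilb (r + j) N P| <= B * 'C(r + N, r)%:R) -> exists h, P = (1 - 'X) ^+ j * h.
Proof.
elim: j P => [|j IHj] P bnd; first by exists P; rewrite mul1r.
have [|P1 PE] := @bounded_growth_root (r + j) r B P (leq_addr _ _); first by rewrite -addnS.
have [|h hE] := IHj P1.
  by move=> N; rewrite -hilbS -PE -addnS.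
by exists h; rewrite PE hE mulrA -exprS.
Qed.

Lemma pairing_mul1X (f : nat -> rat) K (P : {poly rat}) : (size P <= K)%N ->
  \sum_(l < K.+1) ((1 - 'X) * P)`_l * f l = \sum_(l < K) P`_l * (f l - f l.+1).
Proof.
move=> sP; under eq_bigr => l _ do rewrite coef_mul1X mulrBl.
rewrite sumrB [X in _ - X]big_ord_recl mul0r add0r big_ord_recr /=.
rewrite (nth_default _ sP) mul0r addr0 -sumrB; apply: eq_bigr => l _.
by rewrite mulrBr.
Qed.

(** Summation by parts three times, so [f] enters through minus its third difference: 6 for a cubic
    with leading coefficient -1, and 0 for a quadratic. *)
Lemma pairing_cube (f : nat -> rat) K (P : {poly rat}) : (size P <= K)%N ->
  \sum_(l < K.+3) ((1 - 'X) ^+ 3 * P)`_l * f l =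
  \sum_(l < K) P`_l * (f l - f l.+1 *+ 3 + f l.+2 *+ 3 - f l.+3).
Proof.
have s1 K' (Q : {poly rat}) : (size Q <= K')%N -> (size ((1 - 'X) * Q)%R <= K'.+1)%N.
  move=> sQ; apply: leq_trans (size_polyMleq _ _) _.
  have -> : (1 - 'X : {poly rat}) = - ('X - 1%:P) by rewrite opprB.
  by rewrite size_polyN size_XsubC.
move=> sP; rewrite !exprS expr0 mulr1 -!mulrA.
pose f1 l := f l - f l.+1; pose f2 l := f1 l - f1 l.+1.
rewrite (pairing_mul1X f (s1 _ _ (s1 _ _ sP))) (pairing_mul1X f1 (s1 _ _ sP)) (pairing_mul1X f2 sP).
by apply: eq_bigr => l _; congr (_ * _); rewrite /f2 /f1; ring.
Qed.

(** Each step replaces the factor [g J] of a nonpositive partial sum by the smaller [g J.+1], which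
    can only increase the product. *)
Lemma abel_le (g w : nat -> rat) J :
  (forall l, (0 < l)%N -> (l < J)%N -> g l.+1 <= g l) ->
  (forall j, (0 < j)%N -> (j < J)%N -> \sum_(1 <= l < j.+1) w l <= 0) -> (0 < J)%N ->
  \sum_(1 <= l < J.+1) g l * w l <= g J * \sum_(1 <= l < J.+1) w l.
Proof.
elim: J => // J IHJ gd wd _; case: J IHJ gd wd => [|J] IHJ gd wd.
  by rewrite !big_nat1.
rewrite big_nat_recr // [X in _ <= _ * X]big_nat_recr //= mulrDr lerD2r.
apply: le_trans (IHJ _ _ _) _ => //.
- by move=> l l0 lJ; apply: gd => //; exact: ltnW.
- by move=> j j0 jJ; apply: wd => //; exact: ltnW.
have := gd J.+1 isT (leqnn _); have := wd J.+1 isT (leqnn _).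
move: (\sum_(1 <= l < J.+2) w l) => T T0 gg; rewrite -subr_ge0 -mulrBl.
by rewrite mulr_le0 // subr_le0.
Qed.

Lemma level_inequality (d1 d2 d3 : nat) (b1 b2 : nat -> rat) :
  (0 < d1)%N -> (0 < d2)%N -> (1 < d3)%N ->
  (forall l, 0 <= b1 l) -> (forall l, 0 <= b2 l) ->
  (forall l, (d1 < l)%N -> b1 l = 0) -> (forall l, (d2 < l)%N -> b2 l = 0) ->
  let w l := l%:R * (d3%:R - l%:R) * (b2 l - b1 l) in
  (forall j, (0 < j)%N -> (j < d3)%N -> \sum_(1 <= l < j.+1) w l <= 0) ->
  \sum_(1 <= l < d3) w l = 0 ->
  \sum_(1 <= l < d3) (d1%:R - l%:R) * (d2%:R - l%:R) * (d3%:R - l%:R) * (b2 l - b1 l) <= 0.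
Proof.
move=> d1p d2p d3p b1p b2p b1z b2z w T0 Tz.
pose g l : rat := (d1%:R - l%:R) * (d2%:R - l%:R) / l%:R.
have wg l : (0 < l)%N ->
    (d1%:R - l%:R) * (d2%:R - l%:R) * (d3%:R - l%:R) * (b2 l - b1 l) = g l * w l.
  by move=> l0; rewrite /g /w; field; rewrite pnatr_eq0 -lt0n.
rewrite (eq_big_nat _ _ (F2 := fun l => g l * w l)); last by move=> l /andP[l0 _]; exact: wg.
(* Up to [J] both factors of [g] are nonnegative and [g] decreases. The boundary term vanishes:
   either [J] is a root of [g], or it is [d3.-1], where the partial sum is the total 0. *)
pose J := minn (minn d1 d2) d3.-1.
have J0 : (0 < J)%N by rewrite /J; lia.
have gdec l : (0 < l)%N -> (l < J)%N -> g l.+1 <= g l.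
  move=> l0 lJ; rewrite /g.
  have l1 : (l.+1 <= d1)%N by move: lJ; rewrite /J; lia.
  have l2 : (l.+1 <= d2)%N by move: lJ; rewrite /J; lia.
  have {}l1 : l%:R + 1 <= d1%:R :> rat by rewrite natr1 ler_nat.
  have {}l2 : l%:R + 1 <= d2%:R :> rat by rewrite natr1 ler_nat.
  have {}l0 : 0 < l%:R :> rat by rewrite ltr0n.
  rewrite -natr1; move: l1 l2 l0; move: (l%:R) (d1%:R) (d2%:R) => x y1 y2 h1 h2 h3.
  have h4 : 0 < x + 1 by lra.
  rewrite ler_pdivrMr // mulrAC ler_pdivlMr //.
  apply: ler_pM; rewrite ?mulr_ge0 ?subr_ge0 //; try lra.
have main : \sum_(1 <= l < J.+1) g l * w l <= 0.
  apply: le_trans (abel_le gdec _ J0) _.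
    by move=> j j0 jJ; apply: T0 => //; move: jJ; rewrite /J; lia.
  have [Jd|Jd] := eqVneq J d3.-1.
    by rewrite Jd prednK ?(ltnW d3p) // Tz mulr0.
  have : J = d1 \/ J = d2 by move: Jd; rewrite /J; lia.
  by case=> E; rewrite {1}/g E subrr ?mul0r ?mulr0 ?mul0r.
rewrite (@big_cat_nat _ _ _ J.+1) //=; last by rewrite /J; lia.
rewrite -[leRHS]addr0; apply: lerD => //.
have wl l : (J.+1 <= l < d3)%N -> 0 < l%:R * (d3%:R - l%:R) :> rat.
  by move=> /andP[lJ ld]; rewrite mulr_gt0 ?ltr0n ?subr_gt0 ?ltr_nat //; lia.
(* Beyond [J], if [d1 <= d2], only [b2] remains and [g] is nonpositive where [b2] is supported.
   Otherwise only [b1] remains, so all [w l] are nonpositive; their sum is minus a nonpositive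
   partial sum, hence each is 0. *)
have [d12|d21] := leqP d1 d2.
  rewrite big_nat; apply: sumr_le0 => l lJ; have := wl l lJ; rewrite /w => wl0.
  have ld1 : (d1 < l)%N by move: lJ; rewrite /J; lia.
  rewrite (b1z l ld1) subr0; have [ld2|ld2] := leqP l d2; last by rewrite (b2z l ld2) !mulr0.
  apply: mulr_le0_ge0; last by rewrite mulr_ge0 // ltW.
  rewrite /g mulr_le0_ge0 ?invr_ge0 // mulr_le0_ge0 // ?subr_le0 ?subr_ge0 ler_nat //.
  exact: ltnW.
have Jd2 : (J < d3.-1)%N -> J = d2 by rewrite /J; lia.
have w0 l : (J.+1 <= l < d3)%N -> w l = 0.
  move=> lJ; have {}Jd2 : J = d2 by apply: Jd2; case/andP: lJ; lia.
  have wle i : (J.+1 <= i < d3)%N -> 0 <= - w i.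
    move=> iJ; have := wl i iJ; rewrite /w => wi0; rewrite (b2z i) ?sub0r ?mulrN ?opprK.
      by rewrite mulr_ge0 // ltW.
    by case/andP: iJ; rewrite Jd2.
  have S0 : \sum_(J.+1 <= i < d3) - w i = 0.
    apply/eqP; rewrite eq_le; apply/andP; split; last by rewrite big_nat; apply: sumr_ge0 => i /wle.
    rewrite sumrN oppr_le0.
    have : \sum_(1 <= i < J.+1) w i + \sum_(J.+1 <= i < d3) w i = 0.
      by rewrite -(@big_cat_nat _ _ _ J.+1 1%N d3) //; case/andP: lJ => lJ1 lJ2; apply: ltnW; exact: leq_ltn_trans lJ1 lJ2.
    have := T0 J J0; have -> : (J < d3)%N by case/andP: lJ => lJ1 lJ2; apply: ltn_trans lJ1 _.
    by move=> /(_ isT); lra.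
  move/eqP: S0; rewrite big_nat psumr_eq0 // => /allP/(_ l); rewrite mem_index_iota lJ => /(_ isT).
  by rewrite oppr_eq0 => /eqP.
by rewrite big_nat big1 // => l /w0 ->; rewrite mulr0.
Qed.

(** * The bound for a minimal resolution *)

Section MinimalBound.
Variables (k : fieldType) (n : nat).
Local Notation R := {mpoly k[n]}.
Variables (rk : nat -> nat) (dg : forall i, 'I_(rk i) -> nat).
Variable (df : forall i, 'M[R]_(rk i.+1, rk i)).
Variables (e d1 d2 : nat).
Hypothesis acy : acyclic df.
Hypothesis hdf : forall i, homogm (@dg i.+1) (@dg i) (df i).
Hypothesis rk_ge4 : forall i, (4 <= i)%N -> rk i = 0%N.
Hypothesis dg0 : forall a : 'I_(rk 0), dg a = 0%N.
Hypothesis dg3 : forall a : 'I_(rk 3), dg a = e.+2.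
Hypothesis min1 : forall a b, (df 1 a b)@_0%MM = 0.
Hypothesis dg1b : forall a : 'I_(rk 1), (0 < dg a <= d1)%N.
Hypothesis dg2b : forall a : 'I_(rk 2), (0 < dg a <= d2)%N.
Hypothesis d1p : (0 < d1)%N.
Hypothesis d2p : (0 < d2)%N.

Definition degree_poly i : {poly rat} := \sum_(a < rk i) 'X^(dg a).
Definition k_poly := degree_poly 0 - degree_poly 1 + degree_poly 2 - degree_poly 3.
Definition nb i l : nat := #|[set a : 'I_(rk i) | dg a == l]|.

Lemma hilb_degree_poly m N i : hilb m N (degree_poly i) = (cdim m dg i N)%:R.
Proof.
rewrite hilb_sum /cdim natr_sum [RHS]big_mkcond /=; apply: eq_bigr => a _.
by rewrite hilbXn.
Qed.

Lemma hilb_k_poly m N : hilb m N k_poly =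
  (cdim m dg 0 N)%:R - (cdim m dg 1 N)%:R + (cdim m dg 2 N)%:R - (cdim m dg 3 N)%:R.
Proof. by rewrite !(hilbD, hilbN) !hilb_degree_poly. Qed.

Lemma coef_degree_poly i l : (degree_poly i)`_l = (nb i l)%:R.
Proof.
rewrite coef_sum /nb -sum1_card natr_sum [RHS]big_mkcond /=; apply: eq_bigr => a _.
by rewrite coefXn inE eq_sym; case: eqP.
Qed.

Lemma coef_k_poly l : k_poly`_l = (nb 0 l)%:R - (nb 1 l)%:R + (nb 2 l)%:R - (nb 3 l)%:R.
Proof. by rewrite !(coefD, coefN) !coef_degree_poly. Qed.

Lemma core_of_dim : (3 <= n)%N ->
  (forall j, (j < e.+2)%N ->
     (\sum_(a : 'I_(rk 2) | dg a <= j) dg a * (e.+2 - dg a) <=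
      \sum_(b : 'I_(rk 1) | dg b < j) dg b * (e.+2 - dg b))%N) /\
  (forall i, (i + 3 != e.+2)%N ->
     (cdim 2 dg 0 i.+1 + cdim 2 dg 2 i.+1 = cdim 2 dg 1 i.+1 + cdim 2 dg 3 i.+1)%N ->
     (cdim 2 dg 0 i + cdim 2 dg 2 i = cdim 2 dg 1 i + cdim 2 dg 3 i)%N).
Proof.
move: df acy hdf min1; case: n => [|[|[|m]]] // D aD hD mD _.
exact: (core_statement rk_ge4 dg0 dg3 aD hD mD).
Qed.

Lemma nb_eq0 i l : (forall a : 'I_(rk i), dg a != l) -> nb i l = 0%N.
Proof. by move=> h; apply/eqP; rewrite cards_eq0; apply/eqP/setP => a; rewrite !inE; apply/negbTE. Qed.

Lemma nb_sum (f : nat -> nat) i j : (forall a : 'I_(rk i), 0 < dg a)%N ->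
  (\sum_(1 <= l < j.+1) f l * nb i l = \sum_(a : 'I_(rk i) | dg a <= j) f (dg a))%N.
Proof.
move=> dp; rewrite /nb; under eq_bigr => l _ do rewrite -sum1_card big_distrr /=.
rewrite (exchange_big_dep xpredT) //= [RHS]big_mkcond /=; apply: eq_bigr => a _.
case: leqP => aj.
  rewrite big_mkcond (bigD1_seq (dg a)) ?iota_uniq //=; last by rewrite mem_index_iota dp ltnS.
  by rewrite inE eqxx muln1 big1 ?addn0 // => l al; rewrite inE eq_sym (negPf al).
rewrite big_seq_cond big1 // => l; rewrite mem_index_iota inE => /andP[/andP[_ lj] /eqP al].
by move: lj; rewrite -al ltnS leqNgt aj.
Qed.

Lemma minimal_bound r E : n = r.+3 ->
  (forall N, (cdim n dg 0 N + cdim n dg 2 N <= cdim n dg 1 N + cdim n dg 3 N + E * 'C(r + N, r))%N) ->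
  exists h, k_poly = (1 - 'X) ^+ 3 * h /\
    6 * h.[1] <= (rk 0)%:R * (d1 * d2 * e.+2)%:R.
Proof.
move=> nr up; have n3 : (3 <= n)%N by rewrite nr.
have [h kh] : exists h, k_poly = (1 - 'X) ^+ 3 * h.
  apply: (@bounded_growth_cube r 3 E%:R) => N; have := up N.
  have := euler_lower acy hdf (rk_ge4 (leqnn 4)) N.
  rewrite addn3 -nr hilb_k_poly -!(ler_nat rat) !natrD natrM.
  move: (_%:R) (_%:R) (_%:R) (_%:R) (_%:R * _%:R) => x0 x1 x2 x3 x4 lo hi.
  by rewrite ger0_norm; lra.
exists h; split=> //.
have [Tj top] := core_of_dim n3.
(* Dividing by the cube identifies [h] with the Hilbert series of the complex over three variables,
   whatever [n] was. *)
have hE i : h`_i = (cdim 2 dg 0 i)%:R - (cdim 2 dg 1 i)%:R + (cdim 2 dg 2 i)%:R - (cdim 2 dg 3 i)%:R.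
  by rewrite -hilb_k_poly kh hilb2_cube.
have h0 i : h`_i = 0 <-> (cdim 2 dg 0 i + cdim 2 dg 2 i = cdim 2 dg 1 i + cdim 2 dg 3 i)%N.
  rewrite hE.
  move: (cdim 2 dg 0 i) (cdim 2 dg 1 i) (cdim 2 dg 2 i) (cdim 2 dg 3 i) => x0 x1 x2 x3.
  split=> [E0|/(congr1 (fun x => x%:R : rat))]; last by rewrite !natrD; lra.
  by apply/eqP; rewrite -(eqr_nat rat) !natrD; apply/eqP; lra.
(* The polynomial [h] vanishes in large degrees, and [top] carries this down through every degree
   above [e - 1]. So no coefficient survives beyond degree [d3 - 3]. *)
have sh : (size h <= e)%N.
  apply/leq_sizeP => i ei; move: {2}(size h - i)%N (leqnn (size h - i)) => t.
  elim: t i ei => [|t IHt] i ei; first by rewrite leqn0 subn_eq0 => hi; rewrite nth_default.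
  move=> hi; apply/h0; apply: top; first by lia.
  by apply/h0; apply: IHt; lia.
have d3E : (e.+2)%:R = e%:R + 2 :> rat by rewrite -addn2 natrD.
have nb0 l : (nb 0 l)%:R = (if l == 0%N then (rk 0)%:R else 0) :> rat.
  rewrite /nb; case: eqP => [->|l0].
    by rewrite -[in RHS](card_ord (rk 0)) -cardsT; congr (_%:R); apply: eq_card => a; rewrite !inE dg0 eqxx.
  by rewrite -/(nb 0 l) nb_eq0 // => a; rewrite dg0; lia.
have nbpos i : (forall a : 'I_(rk i), (0 < dg a)%N) -> nb i 0 = 0%N.
  by move=> dp; apply: nb_eq0 => a; rewrite -lt0n.
have dp1 (a : 'I_(rk 1)) : (0 < dg a)%N by case/andP: (dg1b a).
have dp2 (a : 'I_(rk 2)) : (0 < dg a)%N by case/andP: (dg2b a).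
have nb3 l : (l != e.+2)%N -> nb 3 l = 0%N.
  by move=> le; apply: nb_eq0 => a; rewrite dg3 eq_sym.
have pair f : f e.+2 = 0 -> \sum_(l < e.+3) k_poly`_l * f l =
    (rk 0)%:R * f 0%N + \sum_(1 <= l < e.+2) ((nb 2 l)%:R - (nb 1 l)%:R) * f l.
  move=> fe; rewrite big_ord_recr /= fe mulr0 addr0 big_ord_recl /=; congr (_ + _).
    by rewrite coef_k_poly nb0 eqxx !nbpos ?subr0 ?addr0 // => a; rewrite dg3.
  rewrite big_add1 /= big_mkord; apply: eq_bigr => l _.
  rewrite /bump add1n coef_k_poly nb0 nb3; last by have := ltn_ord l; lia.
  by rewrite /= subr0 sub0r addrC.
pose f l : rat := (d1%:R - l%:R) * (d2%:R - l%:R) * ((e.+2)%:R - l%:R).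
have := pairing_cube f sh; rewrite -kh pair; last by rewrite /f subrr mulr0.
rewrite {1}/f !subr0 => main.
have hsum : \sum_(l < e) h`_l * 6 = 6 * h.[1].
  rewrite (horner_coef_wide _ sh) mulr_sumr; apply: eq_bigr => l _.
  by rewrite expr1n mulr1 mulrC.
pose w l : rat := l%:R * ((e.+2)%:R - l%:R).
have := pairing_cube w sh; rewrite -kh pair; last by rewrite /w subrr mulr0.
rewrite {1}/w mul0r mulr0 add0r => Tz.
have S2 i j : (j < e.+2)%N -> (forall a : 'I_(rk i), (0 < dg a)%N) ->
    \sum_(1 <= l < j.+1) w l * (nb i l)%:R =
    (\sum_(a : 'I_(rk i) | dg a <= j) dg a * (e.+2 - dg a))%N%:R :> rat.
  move=> je dp; rewrite -(nb_sum (fun l => l * (e.+2 - l))%N j dp) natr_sum.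
  apply: eq_big_nat => l /andP[_ lj]; rewrite /w !natrM natrB //.
  by apply: leq_trans (ltnW je); rewrite -ltnS.
have nbz i d l : (forall a : 'I_(rk i), (0 < dg a <= d)%N) -> (d < l)%N -> (nb i l)%:R = 0 :> rat.
  by move=> db dl; rewrite nb_eq0 // => a; have := db a; lia.
have lev : \sum_(1 <= l < e.+2) f l * ((nb 2 l)%:R - (nb 1 l)%:R) <= 0.
  apply: (@level_inequality d1 d2 e.+2 (fun l => (nb 1 l)%:R) (fun l => (nb 2 l)%:R)) => //.
  - by move=> l; exact: nbz dg1b.
  - by move=> l; exact: nbz dg2b.
  - move=> j j0 je; under eq_bigr => l _ do rewrite mulrBr.
    rewrite sumrB subr_le0 !S2 // ler_nat; apply: leq_trans (Tj j je) _.
    rewrite [leqLHS]big_mkcond [leqRHS]big_mkcond /=; apply: leq_sum => a _.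
    by case: ltngtP.
  under eq_bigr => l _ do rewrite mulrC; rewrite Tz big1 // => l _.
  rewrite /w -!natr1; ring.
have {}main : (rk 0)%:R * (d1%:R * d2%:R * (e.+2)%:R) +
    \sum_(1 <= l < e.+2) f l * ((nb 2 l)%:R - (nb 1 l)%:R) = 6 * h.[1].
  rewrite -hsum; transitivity (\sum_(l < e) h`_l * (f l - f l.+1 *+ 3 + f l.+2 *+ 3 - f l.+3)).
    by rewrite -main; congr (_ + _); apply: eq_bigr => l _; rewrite mulrC.
  by apply: eq_bigr => l _; congr (_ * _); rewrite /f -!natr1; ring.
rewrite -main !natrM; move: lev; move: (\sum_(1 <= l < e.+2) _) => x; lra.
Qed.

End MinimalBound.

(** * The finite complex carried by a minimal subresolution *)

Section Package.
Variables (k : fieldType) (n : nat).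
Local Notation R := {mpoly k[n]}.
Variables (rk : nat -> nat) (deg : forall i, 'I_(rk i) -> int).
Variables (q : nat) (N : 'M[R]_(q, rk 0)) (bt : nat -> int -> nat).
Variables (A : forall i, {set 'I_(rk i)}) (df : forall i, 'M[R]_(rk i.+1, rk i)).
Hypothesis sub : subresolution deg N bt A df.
Hypothesis A4 : A 4 = set0.

(** Minimality is available only in finitely many positions, so the complex is cut at 4; [A4] makes
    the cut harmless for exactness at position 3. *)
Definition active i : {set 'I_(rk i)} := if (i < 4)%N then A i else set0.
Definition active_df i : 'M[R]_(#|active i.+1|, #|active i|) :=
  pick_mx R (active i.+1) *m df i *m (pick_mx R (active i))^T.

Lemma active_ge4 i : (4 <= i)%N -> #|active i| = 0%N.
Proof. by move=> i4; rewrite /active ltnNge i4 cards0. Qed.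

Lemma activeE i : (i <= 4)%N -> active i = A i.
Proof. by rewrite /active leq_eqVlt => /orP[/eqP ->|->]. Qed.

Lemma df_pick i : (i <= 4)%N -> df i *m (pick_mx R (active i))^T *m pick_mx R (active i) = df i.
Proof.
move=> i4; apply: pick_mx_id => x a; rewrite activeE // => aA.
by apply: (sub_off sub); rewrite (negPf aA) andbF.
Qed.

Lemma pick_df i : (i < 4)%N -> (pick_mx R (active i.+1))^T *m (pick_mx R (active i.+1) *m df i) = df i.
Proof.
move=> i4; apply: pick_mx_idl => a y; rewrite activeE // => aA.
by apply: (sub_off sub); rewrite (negPf aA).
Qed.

Lemma active_acyclic : acyclic active_df.
Proof.
have void p i (D D' : 'M[R]_(p, #|active i|)) : (4 <= i)%N -> D = D'.
  by move=> i4; apply/matrixP => x t; have := ltn_ord t; rewrite [X in (_ < X)%N]active_ge4.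
split=> i.
  have [i4|i4] := leqP 4 i; first exact: void.
  rewrite /active_df -!mulmxA [pick_mx _ (active i.+1) *m _]mulmxA.
  rewrite [(pick_mx _ (active i.+1))^T *m _]mulmxA [(pick_mx _ (active i.+1))^T *m _]mulmxA -[_^T *m _ *m _]mulmxA.
  by rewrite pick_df // [df i.+1 *m _]mulmxA (sub_dd sub) mul0mx mulmx0.
move=> v v0; have [i4|i4] := leqP 4 i.+1; first by exists 0; exact: void.
have v0' : v *m pick_mx R (active i.+1) *m df i = 0.
  have i4' : (i <= 4)%N by lia.
  have := congr1 (fun D => D *m pick_mx R (active i)) v0; rewrite mul0mx /active_df !mulmxA => <-.
  by rewrite -{1}(df_pick i4') !mulmxA.
have [|w wE] := sub_exact sub _ v0'.
  move=> a aA; rewrite mxE big1 // => t _; rewrite mxE; case: eqVneq => [at'|]; last by rewrite mulr0.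
  by case/negP: aA; rewrite at' -activeE ?enum_valP // ltnW.
exists (w *m (pick_mx R (active i.+2))^T).
rewrite /active_df !mulmxA -[w *m _ *m _]mulmxA -[w *m _ *m _]mulmxA -[_^T *m _ *m _]mulmxA pick_df //.
by rewrite -wE -mulmxA pick_mxK mulmx1.
Qed.

(** Moves facts about [M / (s) M] to the minimal complex: the coefficients of [s] are replaced by
    rows supported on [A 0] that represent the same classes modulo [N]. *)
Lemma active_in_sub (s : seq R) (v : 'rV_#|active 0|) :
  in_sub N s (v *m pick_mx R (active 0)) -> in_sub (active_df 0) s v.
Proof.
move=> [y [c vE]].
have surj (x : 'rV[R]_(rk 0)) : exists x', supported (A 0%N) x' /\ exists y, x - x' = y *m N.
  by have [x' h1 h2] := sub_surj sub x; exists x'.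
have /fin_all_exists[c' cP] i := surj (c i).
have /fin_all_exists[z zP] i : exists z, c i - c' i = z *m N by case: (cP i).
pose x := v *m pick_mx R (active 0) - \sum_(i < size s) s`_i *: c' i.
have xN : x = (y + \sum_(i < size s) s`_i *: z i) *m N.
  rewrite /x vE mulmxDl mulmx_suml -addrA; congr (_ + _); rewrite -sumrB; apply: eq_bigr => i _.
  by rewrite -scalerBr zP scalemxAl.
have xs : supported (A 0%N) x.
  move=> a aA; rewrite !mxE big1 ?sub0r => [|t _].
    apply/eqP; rewrite oppr_eq0 summxE; apply/eqP; apply: big1 => i _.
    by rewrite mxE (cP i).1 ?mulr0.
  rewrite mxE; case: eqVneq => [at'|]; last by rewrite mulr0.
  by case/negP: aA; rewrite at' -activeE ?enum_valP.
have [|w wE] := (sub_exact0 sub xs).1; first by exists (y + \sum_(i < size s) s`_i *: z i).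
exists (w *m (pick_mx R (active 1))^T), (fun i => c' i *m (pick_mx R (active 0))^T).
have -> : v = v *m pick_mx R (active 0) *m (pick_mx R (active 0))^T by rewrite -mulmxA pick_mxK mulmx1.
have -> : v *m pick_mx R (active 0) = x + \sum_(i < size s) s`_i *: c' i by rewrite subrK.
rewrite mulmxDl mulmx_suml; congr (_ + _); last by apply: eq_bigr => i _; rewrite scalemxAl.
by rewrite wE /active_df -{1}(@pick_df 0 isT) !mulmxA.
Qed.

Hypothesis minimal : forall i a b, (i < 5)%N -> (df i a b)@_0%MM = 0.

Lemma minimal_count i j : (i <= 4)%N -> bt i j = #|[set a in A i | deg a == j]|.
Proof.
move=> i4; have dr l : (l < 5)%N -> drank deg df l j = 0%N.
  move=> l5; rewrite /drank (_ : cterm (df l) = 0) ?mulmx0 ?mxrank0 //.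
  by apply/matrixP => a b; rewrite !mxE minimal.
rewrite -(sub_betti sub) dr // addn0; case: i i4 => [|i] i4 /=; first by rewrite addn0.
by rewrite dr ?addn0 // ltnW.
Qed.

(** A basis element with zero differential would be a boundary, although by minimality boundaries
    have no constant terms. A nonzero entry is not constant, so it lowers the degree of the basis
    element. *)
Lemma minimal_deg i (a : 'I_(rk i.+1)) : (i < 4)%N -> a \in A i.+1 ->
  exists2 b, b \in A i & deg b < deg a.
Proof.
move=> i4 aA; have [/existsP[b ab]|] := boolP [exists b, df i a b != 0].
  have bA : b \in A i by apply: contraNT ab => bA; apply/eqP/(sub_off sub); rewrite (negPf bA) andbF.
  exists b => //; have [m mab] : exists m, (df i a b)@_m != 0.
    by exists (mlead (df i a b)); rewrite mleadc_eq0.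
  have m0 : m != 0%MM by apply/eqP => m0; move: mab; rewrite m0 minimal ?eqxx // ltnW.
  by rewrite -subr_gt0 -(sub_homog sub mab) ltz_nat lt0n mdeg_eq0.
rewrite negb_exists => /forallP a0.
have [| |w wE] := sub_exact sub (v := delta_mx 0 a) (i := i).
- by move=> x xA; rewrite mxE eqxx /=; case: (eqVneq x a) xA => [->|//]; rewrite aA.
- by rewrite -rowE; apply/rowP => b; rewrite !mxE; apply/eqP; rewrite -[_ == _]negbK.
have := congr1 (fun u : 'rV_(rk i.+1) => (u 0 a)@_0%MM) wE.
rewrite !mxE !eqxx mcoeff1 eqxx raddf_sum big1 => [/eqP|b _]; first by rewrite oner_eq0.
by rewrite /= rmorphM /= minimal ?mulr0.
Qed.

Hypothesis deg_ge0 : forall i a, a \in active i -> 0 <= deg a.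

Definition active_deg i (t : 'I_#|active i|) : nat := absz (deg (enum_val t)).

Lemma active_degE i (t : 'I_#|active i|) : (active_deg t)%:Z = deg (enum_val t).
Proof. by rewrite /active_deg gez0_abs // (deg_ge0 (enum_valP t)). Qed.

Lemma active_dfE i t u : active_df i t u = df i (enum_val t) (enum_val u).
Proof. by rewrite /active_df mul_mx_pick mul_pick_mx. Qed.

Lemma active_homog i : homogm (active_deg (i := i.+1)) (active_deg (i := i)) (active_df i).
Proof.
move=> t u m; rewrite active_dfE => /(sub_homog sub) /eqP.
by rewrite -!active_degE; lia.
Qed.

End Package.

(** * Transfer between the module and its resolution *)

Section Assembly.
Variables (k : fieldType) (n : nat) (M : gradedModule k n) (F : freeResolution M).
Local Notation R := {mpoly k[n]}.

Lemma fr_acyclic : acyclic (fr_diff F).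
Proof.
split=> i; last by move=> v /fr_exactS.
exact: (sub_dd (initial_subresolution F)).
Qed.

Definition augm (v : 'rV[R]_(fr_rank F 0)) : M := \sum_a v 0 a *: fr_aug (f := F) a.

Lemma augmB u v : augm (u - v) = augm u - augm v.
Proof. by rewrite /augm -sumrB; apply: eq_bigr => a _; rewrite !mxE scalerBl. Qed.

Lemma augmZ f v : augm (f *: v) = f *: augm v.
Proof. by rewrite /augm scaler_sumr; apply: eq_bigr => a _; rewrite mxE scalerA. Qed.

Lemma augm_sum I (r : seq I) (P : pred I) V :
  augm (\sum_(i <- r | P i) V i) = \sum_(i <- r | P i) augm (V i).
Proof.
apply: (big_morph augm); last by rewrite /augm big1 // => a _; rewrite mxE scale0r.
by move=> u v; rewrite /augm -big_split /=; apply: eq_bigr => a _; rewrite mxE scalerDl.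
Qed.

Lemma in_ideal_augm s v : in_ideal_mul s (augm v) <-> in_sub (fr_diff F 0) s v.
Proof.
split=> [[c cE]|[y [c ->]]].
  have /fin_all_exists[w wE] i : exists w, c i = augm w by exact: fr_aug_surj.
  have : augm (v - \sum_(i < size s) s`_i *: w i) = 0.
    rewrite augmB cE augm_sum; apply/eqP; rewrite subr_eq0; apply/eqP.
    by apply: eq_bigr => i _; rewrite augmZ wE.
  by move/fr_exact0 => [y yE]; exists y, w; rewrite -yE subrK.
exists (fun i => augm (c i)).
have -> : y *m fr_diff F 0 + \sum_(i < size s) s`_i *: c i =
    \sum_(i < size s) s`_i *: c i - (- y) *m fr_diff F 0 by rewrite mulNmx opprK addrC.
rewrite augmB augm_sum.
have -> : augm (- y *m fr_diff F 0) = 0 by apply/fr_exact0; exists (- y).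
by rewrite subr0; apply: eq_bigr => i _; rewrite augmZ.
Qed.

Lemma betti_vanish (s : seq R) i j : all (@in_irrelevant k n) s -> regular_sequence M s ->
  (n <= i + size s)%N -> betti F i.+1 j = 0%N.
Proof.
move=> sm [reg _] ni; apply/eqP; rewrite subn_eq0; apply: mxrankS.
have tor := @tor_exact k n s _ _ fr_acyclic sm.
apply/row_subP => a; rewrite /tor_cycles.
set v := row a _; have : (v <= tor_piece F i.+1 j :&: kermx (tor_diff F i))%MS by exact: row_sub.
rewrite sub_capmx => /andP[/submxP[u uE] /sub_kermxP v0].
have [|w wE] := tor _ i ni v v0.
  move=> l ls x /in_ideal_augm; rewrite augmZ => h; apply/in_ideal_augm; exact: reg ls _ h.
have -> : v = v *m tor_piece F i.+1 j by rewrite uE -mulmxA dpieceK.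
by rewrite wE -mulmxA -[cterm _ *m _]tor_piece_diff submxMl.
Qed.

End Assembly.

Lemma krull_dim_uniq (k : fieldType) n (M : lmodType {mpoly k[n]}) d d' : is_krull_dim M d -> is_krull_dim M d' -> d = d'.
Proof.
move=> [[P hP] hd] [[P' hP'] hd']; apply/eqP; rewrite eqn_leq; apply/andP; split.
  exact: hd' hP.
exact: hd hP'.
Qed.

Section Final.
Variables (k : fieldType) (n : nat) (M : gradedModule k n) (F : freeResolution M).
Local Notation R := {mpoly k[n]}.

Lemma level_degree i d d' : (exists d0, is_min_shift F i d0 /\ is_max_shift F i d0) ->
  is_max_shift F i d -> betti F i d' != 0%N -> d' = d.
Proof.
move=> [d0 [[h0 hmin] [_ hmax]]] [hd hdmax] hd'.
have E : d = d0 by apply/eqP; rewrite eq_le hmax ?hdmax.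
by rewrite E; apply/eqP; rewrite eq_le hmax ?hmin.
Qed.

Lemma mem_degrees i a : @fr_deg _ _ _ F i a \in degrees F i.
Proof. by rewrite mem_undup codom_f. Qed.

Lemma sum_betti (V : zmodType) i (A : {set 'I_(fr_rank F i)}) (f : int -> V) :
  (forall j, betti F i j = #|[set a in A | fr_deg a == j]|) ->
  \sum_(j <- degrees F i) f j *+ betti F i j = \sum_(a in A) f (fr_deg a).
Proof.
move=> bE; have E j : f j *+ betti F i j = \sum_(a in A | fr_deg a == j) f j.
  by rewrite bE sumr_const; congr (_ *+ _); apply: eq_card => a; rewrite !inE.
rewrite (eq_bigr _ (fun j _ => E j)) (exchange_big_dep (fun a => a \in A)) /=; last by move=> j a _ /andP[].
apply: eq_bigr => a aA; rewrite big_mkcond (bigD1_seq (fr_deg a)) ?undup_uniq ?mem_degrees //=.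
rewrite aA eqxx big1 ?addr0 // => j; rewrite eq_sym => /negPf ->; by rewrite andbF.
Qed.

Lemma betti_numeratorE (A : forall i, {set 'I_(fr_rank F i)}) : (3 <= n)%N ->
  (forall i j, (i < 4)%N -> betti F i j = #|[set a in A i | fr_deg a == j]|) ->
  (forall i j, (4 <= i)%N -> betti F i j = 0%N) ->
  (forall i a, (i < 4)%N -> a \in A i -> 0 <= fr_deg (f := F) (i := i) a) ->
  betti_numerator F = 'X^(degree_bound F) *
    \sum_(i < 4) (-1) ^+ i * \sum_(a in A i) 'X^(absz (fr_deg a)).
Proof.
move=> n3 bE b0 dpos; rewrite /betti_numerator.
pose G i : {poly rat} := \sum_(j <- degrees F i) ((-1) ^+ i * (betti F i j)%:R) *: 'X^(absz (j + (degree_bound F)%:Z)).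
rewrite -[LHS]/(\sum_(i < n.+1) G i) mulr_sumr.
have G0 i : (4 <= i)%N -> G i = 0.
  by move=> i4; apply: big1 => j _; rewrite b0 // mulr0 scale0r.
have -> : \sum_(i < n.+1) G i = \sum_(i < 4) G i.
  rewrite -!(big_mkord xpredT G) (@big_cat_nat _ _ _ 4) //=.
  by rewrite [X in _ + X]big_nat [X in _ + X]big1 ?addr0 // => i /andP[/G0].
apply: eq_bigr => i _; rewrite mulrCA mulr_sumr.
have -> : G i = (-1) ^+ i * \sum_(j <- degrees F i) 'X^(absz (j + (degree_bound F)%:Z)) *+ betti F i j.
  rewrite mulr_sumr; apply: eq_bigr => j _.
  rewrite -scalerA scaler_nat; case: (odd i) (signr_odd {poly rat} i) (signr_odd rat i) => <- <-.
    by rewrite !expr1 scaleN1r mulN1r.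
  by rewrite !expr0 scale1r mul1r.
congr (_ * _); rewrite (sum_betti _ (fun j => bE i j (ltn_ord i))); apply: eq_bigr => a aA.
rewrite -exprD; congr ('X^_); have := dpos i a (ltn_ord i) aA.
by case: (fr_deg a) => d // _; rewrite -PoszD addnC.
Qed.

End Final.

Theorem theorem7p7 (k : fieldType) (n : nat) (M : gradedModule k n)
    (F : freeResolution M) (d1 d2 d3 : int) :
  is_level F 3 ->
  is_max_shift F 0 0 -> is_max_shift F 1 d1 ->
  is_max_shift F 2 d2 -> is_max_shift F 3 d3 ->
  multiplicity F 3 <= (betti_total F 0)%:R * ((d1 * d2 * d3)%:~R / (3`!)%:R).
Proof.
move=> [[r [dep krull]] [dR [dM [kR kM dRM]]] lev0 lev3] ms0 ms1 ms2 ms3.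
have n_le : (n <= r + 3)%N.
  by rewrite -(krull_dim_uniq kM krull) -dRM; exact: krull_dim_mpoly kR.
case: dep => [[s [sm reg ss]] _].
(* With fewer variables the depth would already force the third Betti numbers to vanish, while [d3]
   is attained. *)
have n_ge : (r + 3 <= n)%N.
  rewrite leqNgt; apply/negP => nr; case: ms3 => /negP[]; apply/eqP.
  by apply: (betti_vanish F d3 sm reg); rewrite ss; lia.
have nr : n = r.+3 by lia.
have b4 i j : (4 <= i)%N -> betti F i j = 0%N.
  by case: i => // i i4; apply: (betti_vanish F j sm reg); rewrite ss; lia.
(* The differentials into and out of position 4 must both be minimal for its Betti numbers to count
   basis elements, hence 5. *)
have [A [df [sub min]]] := minimal_subresolution 5 (initial_subresolution F).
have cnt i j : (i <= 4)%N -> betti F i j = #|[set a in A i | fr_deg a == j]|.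
  by move=> i4; exact: (minimal_count sub min j i4).
have bA i a : (i <= 4)%N -> a \in A i -> betti F i (fr_deg (f := F) a) != 0%N.
  by move=> i4 aA; rewrite cnt // -lt0n card_gt0; apply/set0Pn; exists a; rewrite !inE aA eqxx.
have Ab i j : (i <= 4)%N -> betti F i j != 0%N -> exists2 a, a \in A i & fr_deg (f := F) a = j.
  move=> i4; rewrite cnt // -lt0n card_gt0 => /set0Pn[a]; rewrite !inE => /andP[aA /eqP].
  by exists a.
have A4 : A 4 = set0.
  by apply/setP => a; rewrite inE; apply/negP => /(bA 4 a isT); rewrite b4.
have deg0 a : a \in A 0%N -> fr_deg (f := F) (i := 0%N) a = 0.
  by move=> /(bA 0%N a isT); apply: level_degree lev0 ms0.
have deg3 a : a \in A 3%N -> fr_deg (f := F) (i := 3%N) a = d3.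
  by move=> /(bA 3%N a isT); apply: level_degree lev3 ms3.
have deg_ge i a : (i <= 4)%N -> a \in A i -> i%:Z <= fr_deg (f := F) a.
  elim: i a => [|i IHi] a i4 aA; first by rewrite deg0.
  have [b bAi lt_ba] := minimal_deg sub min i4 aA.
  by have := IHi b (ltnW i4) bAi; lia.
have dpos i a : a \in active A i -> 0 <= fr_deg (f := F) (i := i) a.
  rewrite /active; case: ltnP => [i4 aA|_]; last by rewrite inE.
  by apply: le_trans (deg_ge i a (ltnW i4) aA).
have [a1 a1A a1E] := Ab 1%N d1 isT (proj1 ms1).
have [a2 a2A a2E] := Ab 2%N d2 isT (proj1 ms2).
have [a3 a3A a3E] := Ab 3%N d3 isT (proj1 ms3).
have d1p : 1 <= d1 by rewrite -a1E; exact: (deg_ge 1%N a1 isT a1A).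
have d2p : 1 <= d2 by rewrite -a2E; apply: le_trans (deg_ge 2%N a2 isT a2A).
have d3p : 3 <= d3 by rewrite -a3E; exact: (deg_ge 3%N a3 isT a3A).
have [n1 n1E] : exists n1, d1 = Posz n1 by exists (absz d1); lia.
have [n2 n2E] : exists n2, d2 = Posz n2 by exists (absz d2); lia.
have [e eE] : exists e, d3 = Posz e.+2 by exists (absz d3 - 2)%N; lia.
pose dg := active_deg (@fr_deg _ _ _ F) (A := A).
have dgE i t : (i < 4)%N -> (dg i t)%:Z = fr_deg (f := F) (enum_val t) /\ enum_val t \in A i.
  move=> i4; split; first exact: active_degE.
  by move: (enum_val t) (enum_valP t) => x; rewrite activeE // ltnW.
have acy := active_acyclic sub A4.
have hdf := active_homog sub dpos.
have sm0 i : (i < size s)%N -> (s`_i)@_0%MM = 0.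
  by move=> il; apply/eqP; apply: (allP sm); exact: mem_nth.
have dg0 (t : 'I_#|active A 0|) : dg 0%N t = 0%N.
  by have [dE tA] := dgE 0%N t isT; apply/eqP; rewrite -eqz_nat dE deg0.
have dg3 (t : 'I_#|active A 3|) : dg 3%N t = e.+2.
  by have [dE tA] := dgE 3%N t isT; apply/eqP; rewrite -eqz_nat dE deg3 // eE.
have dg1b (t : 'I_#|active A 1|) : (0 < dg 1%N t <= n1)%N.
  have [dE tA] := dgE 1%N t isT; have := deg_ge 1%N _ isT tA.
  have := proj2 ms1 _ (bA 1%N _ isT tA); rewrite -dE n1E; lia.
have dg2b (t : 'I_#|active A 2|) : (0 < dg 2%N t <= n2)%N.
  have [dE tA] := dgE 2%N t isT; have := deg_ge 2%N _ isT tA.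
  have := proj2 ms2 _ (bA 2%N _ isT tA); rewrite -dE n2E; lia.
(* The Cohen-Macaulay property enters here: the regular sequence [s] has as many elements as the
   dimension of [M]. *)
have pow (i : 'I_n) : exists u l, u@_0%MM != 0 /\
    forall v, in_sub (active_df A df 0) s ((u * 'X_i ^+ l) *: v).
  have [|u [l [u0 ul]]] := power_kills krull ss reg (x := 'X_i).
    by rewrite mcoeffX mnm1_eq0.
  exists u, l; split=> // v; apply: (active_in_sub sub A4).
  by rewrite -scalemxAl; apply/in_ideal_augm; rewrite augmZ; exact: ul.
have [E up] := euler_upper acy hdf (active_ge4 A (leqnn 4)) dg0 sm0 pow.
have min1 a b : (active_df A df 1 a b)@_0%MM = 0 by rewrite active_dfE min.
have n1p : (0 < n1)%N by lia.
have n2p : (0 < n2)%N by lia.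
rewrite ss in up.
have [h [kh hbound]] := minimal_bound acy hdf (@active_ge4 _ A) dg0 dg3 min1 dg1b dg2b n1p n2p nr up.
have numE : betti_numerator F = 'X^(degree_bound F) * ((1 - 'X) ^+ 3 * h).
  rewrite -kh (@betti_numeratorE _ _ _ F A); first last.
  - by move=> i a i4 aA; apply: le_trans (deg_ge i a (ltnW i4) aA).
  - exact: b4.
  - by move=> i j i4; apply: cnt; exact: ltnW.
  - by rewrite nr.
  have dpE i : (i < 4)%N -> degree_poly dg i = \sum_(a in A i) 'X^(absz (fr_deg (f := F) a)).
    move=> i4; rewrite -(activeE A4 (ltnW i4)) big_enum_val.
    by apply: eq_bigr => t _.
  congr (_ * _); rewrite /k_poly !dpE // !big_ord_recl big_ord0 /=.
  by rewrite /bump /= !(expr0, expr1, expr2, exprS); ring.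
have multE : multiplicity F 3 = h.[1].
  rewrite /multiplicity numE mulrCA mulrC mulpK; last first.
    by rewrite expf_neq0 // -[X in X != _]opprB oppr_eq0 polyXsubC_eq0.
  by rewrite hornerM hornerXn expr1n mul1r.
have totE : (betti_total F 0)%:R = (#|active A 0|)%:R :> rat.
  rewrite /betti_total natr_sum (activeE A4 (leq0n 4)).
  have := sum_betti (A := A 0%N) (fun=> 1 : rat) (fun j => cnt 0%N j isT).
  by rewrite sumr_const => <-.
rewrite multE totE n1E n2E eE -!PoszM; move: hbound.
have -> : (3`!)%N%:R = 6 :> rat by [].
move: h.[1] => x hb; by rewrite mulrA ler_pdivlMr // mulrC.
Qed.
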